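(* Let $n\ge2$, let $P$ be a positive regular polynomial $n$-tuple and let $m\in\mathbb N^n$. The multiplication $n$-tuple $\mathscr M_z$ on $\mathscr H^2_m(\triangle^n_P)$ is jointly subnormal if and only if for every $\gamma\in\mathbb Z_+^n$, $$\Big\{\frac1{A_{P,m}\big(\gamma+\sum_{j=1}^n\beta_j\sum_{k=j}^n\varepsilon_k\big)}\Big\}_{\beta\in\mathbb Z_+^n}$$ is a Hausdorff moment multisequence.
   Context: $\mathbb N$ = positive integers, $\mathbb Z_+$ = nonnegative integers, $\mathbb C_*=\mathbb C\setminus\{0\}$, $\varepsilon_k$ = $k$-th standard basis vector, $z\diamond w=(z_1w_1,\ldots,z_nw_n)$, and $\overline z$ is the entrywise conjugate. For $n\ge2$ let $\varphi(z)=\big(\frac{z_1}{z_2},\ldots,\frac{z_{n-1}}{z_n},z_n\big)$ for $z\in\mathbb C\times\mathbb C_*^{n-1}$. A polynomial $n$-tuple $P=(P_1,\ldots,P_n)$ in $\mathbb C[z_1,\ldots,z_n]$ is positive regular if for each $j$, $P_j$ has nonnegative coefficients and $P_j(z)=a_jz_j+\sum_{k=2}^{N_j}Q_{jk}(z)$ with $a_j>0$ and $Q_{jk}$ homogeneous of degree $k$. The $P$-triangle is $\triangle^n_P=\{z\in\mathbb C\times\mathbb C_*^{n-1}: P_j(\varphi(z)\diamond\overline{\varphi(z)})<1,\ j=1,\ldots,n\}$. For $m\in\mathbb N^n$, $\mathscr H^2_m(\triangle^n_P)$ is the reproducing kernel Hilbert space of holomorphic functions on $\triangle^n_P$ with kernel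 $$\mathscr K_{P,m}(z,w)=\prod_{j=2}^n\frac1{z_j\overline w_j}\prod_{j=1}^n\frac1{\big(1-P_j(\varphi(z)\diamond\overline{\varphi(w)})\big)^{m_j}}.$$ Each $z_j$ is a multiplier of this space; $\mathscr M_{z_j}$ is the bounded operator of multiplication by $z_j$, and $\mathscr M_z=(\mathscr M_{z_1},\ldots,\mathscr M_{z_n})$. The function $A_{P,m}:\mathbb Z_+^n\to(0,\infty)$ is defined by the power series expansion near the origin $\prod_{j=1}^n(1-P_j(x))^{-m_j}=\sum_{\alpha\in\mathbb Z_+^n}A_{P,m}(\alpha)x^\alpha$. A multisequence $\{a_\beta\}_{\beta\in\mathbb Z_+^n}$ of positive reals is Hausdorff moment if there is a finite positive regular Borel measure $\mu$ concentrated in some cube $C$ in the positive orthant of $\mathbb R^n$ (e.g. $C=[0,c]^n$) with $a_\beta=\int_Ct^\beta\,d\mu(t)$ for all $\beta\in\mathbb Z_+^n$. A commuting $n$-tuple $S$ on $H$ is jointly subnormal if there are a Hilbert space $K\supseteq H$ and a commuting $n$-tuple $N$ of normal operators on $K$ with $N_jh=S_jh$ for all $h\in H$ and all $j$. *)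

(* Defs.v *)
From HB Require Import structures.
From mathcomp.multinomials Require Export(canonicals,coercions) mpoly.
From mathcomp Require Import all_boot all_order all_algebra finmap complex.
From mathcomp Require Import all_classical all_reals all_analysis.
From mathcomp.analysis.showcase Require Import summability.

Set Implicit Arguments.
Unset Strict Implicit.
Unset Printing Implicit Defensive.

Import Order.TTheory GRing.Theory Num.Theory.
Import numFieldNormedType.Exports.

(* The notations of mpoly clash with those of MathComp-Analysis, so only its
   canonical structures and coercions are imported. *)
Notation multinom := mpoly.multinom.
Notation "{ 'mpoly' T [ n ] }" := (mpoly.mpoly n T)
  (at level 0, T, n at level 2, format "{ 'mpoly'  T [ n ] }") : type_scope.

Local Open Scope classical_set_scope.
Local Open Scope ring_scope.
Local Open Scope complex_scope.

Section HilbertSpaces.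
Variable R : realType.

Record hilbert := Hilbert {
  hilbert_space :> completeNormedModType R[i];
  hdot : {dot hilbert_space for Num.conj};
  hdotxx : forall x : hilbert_space, hdot x x = `|x| ^+ 2
}.

Definition bounded_operator (H : hilbert) (T : {linear H -> H}) :=
  exists c : R[i], forall x : H, `|T x| <= c * `|x|.

Definition adjoint (H : hilbert) (T S : {linear H -> H}) :=
  forall x y : H, hdot H (T x) y = hdot H x (S y).

Definition normal_operator (H : hilbert) (T : {linear H -> H}) :=
  bounded_operator T /\
  exists S : {linear H -> H}, adjoint T S /\ forall x : H, T (S x) = S (T x).

(* The inclusion of H into the larger Hilbert space is a linear isometry V. *)
Definition jointly_subnormal (n : nat) (H : hilbert)
    (S : 'I_n -> {linear H -> H}) :=
  exists (K : hilbert) (V : {linear H -> K}) (N : 'I_n -> {linear K -> K}),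
    [/\ forall x y : H, hdot K (V x) (V y) = hdot H x y,
        forall j, normal_operator (N j),
        forall j k (x : K), N j (N k x) = N k (N j x)
      & forall j (h : H), N j (V h) = V (S j h)].

(* A Hilbert space of complex functions on X: f is identified with the
   restriction to X of [ev f]; the values of [ev f] off X are irrelevant. *)
Record hilbert_of_functions (T : Type) (X : set T) := HilbertOfFunctions {
  function_space :> hilbert;
  ev : function_space -> T -> R[i];
  ev_linear : forall z, X z -> scalar (fun f => ev f z);
  ev_inj : forall f g, (forall z, X z -> ev f z = ev g z) -> f = g
}.

Definition reproducing_kernel (T : Type) (X : set T)
    (H : hilbert_of_functions X) (K : T -> T -> R[i]) :=
  forall w, X w -> exists2 k : H,
    (forall z, X z -> ev k z = K z w) & (forall f : H, ev f w = hdot H f k).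

Definition multiplication_operator (T : Type) (X : set T)
    (H : hilbert_of_functions X) (g : T -> R[i]) (M : {linear H -> H}) :=
  bounded_operator M /\
  forall (f : H) z, X z -> ev (M f) z = g z * ev f z.

(* [differentiable] is Frechet differentiability over the field R[i], that is,
   complex differentiability. *)
Definition holomorphic (n : nat) (X : set 'rV[R[i]]_n)
    (f : 'rV[R[i]]_n -> R[i]) :=
  forall z, X z ->
    differentiable (f : 'rV[(R[i])^o]_n -> (R[i])^o) (z : 'rV[(R[i])^o]_n).

End HilbertSpaces.

Section Triangle.
Variables (R : realType) (n : nat).
Local Notation C := R[i].
Implicit Types (z w : 'rV[C]_n) (P : 'I_n -> {mpoly C[n]}).

Definition peval (p : {mpoly C[n]}) (x : 'rV[C]_n) : C :=
  mpoly.meval (fun j => x ord0 j) p.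

Definition positive_regular P := forall j,
  (forall a : multinom n, 0 <= mpoly.mcoeff a (P j)) /\
  exists (a : C) (N : nat) (Q : nat -> {mpoly C[n]}),
    [/\ 0 < a,
        forall k, Q k \is @mpoly.ishomog1 n C k mpoly.mdeg
      & P j = a *: mpoly.mpolyX C (mpoly.mnm1 j) + \sum_(2 <= k < N.+1) Q k].

Definition diamond z w : 'rV[C]_n := \row_j (z ord0 j * w ord0 j).

Definition conjv z : 'rV[C]_n := \row_j (z ord0 j)^*.

(* [insub j.+1] is the index following j, if there is one. *)
Definition varphi z : 'rV[C]_n :=
  \row_j (if insub j.+1 is Some k then z ord0 j / z ord0 k else z ord0 j).

(* Indices are shifted by one: (0 < j) says that z_j is not the first
   coordinate. *)
Definition triangle P : set 'rV[C]_n := [set z : 'rV[C]_n |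
  (forall j : 'I_n, (0 < j)%N -> z ord0 j != 0) /\
  forall j, peval (P j) (diamond (varphi z) (conjv (varphi z))) < 1].

Definition triangle_kernel P (m : 'I_n -> nat) z w : C :=
  (\prod_(j < n | (0 < j)%N) (z ord0 j * (w ord0 j)^*)^-1) *
  \prod_(j < n) (1 - peval (P j) (diamond (varphi z) (conjv (varphi w)))) ^- m j.

(* Unconditional (equivalently, absolute) convergence to s of the series
   sum_a A_a x^a. *)
Definition power_series_sum (A : multinom n -> R) (x : 'rV[C]_n) (s : C) :=
  partial_sum (fun a : multinom n =>
    ((A a)%:C * \prod_(j < n) x ord0 j ^+ a j : C^o)) @ totally --> (s : C^o).

Definition power_series_at0 (F : 'rV[C]_n -> C) (A : multinom n -> R) :=
  \forall x \near (0 : 'rV[C^o]_n), power_series_sum A x (F x).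

(* gamma + sum_j beta_j sum_(k >= j) e_k *)
Definition staircase (g b : multinom n) : multinom n :=
  mpoly.mnm_add g
    (\big[@mpoly.mnm_add n/@mpoly.mnm0 n]_(j < n)
       mpoly.mnm_muln
         (\big[@mpoly.mnm_add n/@mpoly.mnm0 n]_(k < n | (j <= k)%N)
            mpoly.mnm1 k)
         (b j)).

End Triangle.

Section HausdorffMoments.
Variables (R : realType) (n : nat).

Definition borel_rV := g_sigma_algebraType (@open 'rV[R]_n).

Definition regular_measure (mu : {measure set borel_rV -> \bar R}) :=
  forall B : set borel_rV, measurable B ->
    mu B = ereal_inf [set mu U | U in [set U : set 'rV[R]_n |
                                       open U /\ B `<=` U]] /\
    mu B = ereal_sup [set mu K | K in [set K : set 'rV[R]_n |
                                       compact K /\ K `<=` B]].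

Definition cube (a : 'rV[R]_n) (s : R) : set 'rV[R]_n :=
  [set t | forall j, a ord0 j <= t ord0 j <= a ord0 j + s].

Definition hausdorff_moment (a : multinom n -> R) :=
  (forall b, 0 < a b) /\
  exists (mu : {finite_measure set borel_rV -> \bar R}) (c : 'rV[R]_n) (s : R),
    [/\ regular_measure mu,
        0 < s /\ forall j, 0 <= c ord0 j,
        mu (~` cube c s) = 0%E
      & forall b : multinom n,
          (a b)%:E =
          (\int[mu]_(t in cube c s)
             (\prod_(j < n) (t : 'rV[R]_n) ord0 j ^+ b j)%:E)%E].

End HausdorffMoments.

(* Main.v *)
Require Import Defs.
From HB Require Import structures.
From mathcomp.multinomials Require freeg mpoly.
From mathcomp Require Import all_boot all_order all_algebra finmap complex.
From mathcomp Require Import cyclic separable cyclotomic.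
From mathcomp Require Import all_classical all_reals all_analysis.
From mathcomp Require Import measurable_realfun.
From mathcomp.analysis.showcase Require Import summability.
From mathcomp Require Import ring lra zify.

(* The functions e_a(z) = varphi(z)^a / \prod_(j >= 2) z_j, rescaled by sqrt(A_a), form an orthonormal basis of
   the space, and M_j e_a = e_(a + sigma_j) with sigma_j = \sum_(k >= j) eps_k; so 1 / A (gamma + ...) are the squared
   norms of M^beta e_gamma.  The basis is obtained by averaging kernel functions over tori.

   If M has a normal extension N, then every N_j commutes with every N_k* (Fuglede), and after scaling N to contractions
   the sequences |N^beta y|^2 are completely monotone.  Bernstein weights then give discrete measures with nearly the
   right moments; their masses on dyadic boxes are passed to the limit along an ultrafilter, and the limit masses are
   realized as the image of Lebesgue measure on an interval under a digit map.

   Conversely, by the Halmos-Bram criterion it suffices to show that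
   \sum_(i, j) <M^(b_j) h_i, M^(b_i) h_j> >= 0, first for finite combinations of the e_a.  Basis vectors (g_i, b_i) and
   (g_j, b_j) interact only if g_i + sigma b_j = g_j + sigma b_i, where sigma b = \sum_j b_j sigma_j.  On such
   a class g_i = g_0 + sigma b_i, and the entry is 1 / A (g_0 + sigma (b_i + b_j)); if g_0 has nonnegative entries, the
   sum is the integral of a square against the moment measure of g_0.  In general a partition of unity separating the
   coordinate hyperplanes makes the missing monomial available as a factor. *)

Set Implicit Arguments.
Unset Strict Implicit.
Unset Printing Implicit Defensive.

Import Order.TTheory GRing.Theory Num.Theory.
Import numFieldNormedType.Exports.
Import mpoly(mnm0, mnm1, mnm_add, mnm_sub, mnm_muln, mdeg, mcoeff, mpolyX, msupp, meval).

Local Open Scope classical_set_scope.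
Local Open Scope ring_scope.

(** * Sequences and semi-inner products *)

(** The hypothesis of the converse yields one measure for each gamma. These measures are related
    only through their moments, and each may charge the coordinate hyperplanes, so none can be
    divided by a monomial to serve an index g_0 with negative entries. Hence only the functionals
    L_gamma are kept: they are nonnegative on polynomials nonnegative on a cube, and L_(gamma +
    sigma d)(q) = L_gamma(t^d q). On the piece of the partition of unity attached to J, an index
    whose b_i involves some t_l with l in J contributes O(1/k); for the other indices the piece is
    divisible by t^(2 b_i), and this factor moves the whole class to the nonnegative index g_i +
    sigma b_i. The basis cannot be read off from expansions of the elements of the space: A is given
    only by an expansion near 0, and the space is used only through its kernel. Finite averages over
    roots of unity replace contour integrals there, and also in the Cauchy estimate behind Fuglede's
    theorem. *)

Section Sequences.
Variable C : numClosedFieldType.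
Implicit Types V : normedZmodType C.

Definition tends V (u : nat -> V) (l : V) := forall e : C, 0 < e ->
  exists N, forall k, (N <= k)%N -> `|u k - l| < e.

Definition cauchy_seq V (u : nat -> V) := forall e : C, 0 < e ->
  exists N, forall i j, (N <= i)%N -> (N <= j)%N -> `|u i - u j| < e.

Definition seq_complete V := forall u : nat -> V, cauchy_seq u ->
  exists l, tends u l.

Lemma tends_cst V (l : V) : tends (fun=> l) l.
Proof. by move=> e e0; exists 0%N => k _; rewrite subrr normr0. Qed.

Lemma tends_ext V (u v : nat -> V) l : u =1 v -> tends u l -> tends v l.
Proof. by move=> uv ul e /ul [N h]; exists N => k Nk; rewrite -uv h. Qed.

Lemma tends_shift V (u : nat -> V) (m : nat) l : tends u l -> tends (fun k => u (k + m)%N) l.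
Proof.
by move=> ul e /ul [N h]; exists N => k Nk; rewrite h// (leq_trans Nk)// leq_addr.
Qed.

Arguments tends_shift {V u} m {l}.

Lemma tendsD V (u v : nat -> V) a b :
  tends u a -> tends v b -> tends (fun k => u k + v k) (a + b).
Proof.
move=> ua vb e e0; have e20 : 0 < e / 2 by rewrite divr_gt0.
have [N hN] := ua _ e20; have [M hM] := vb _ e20.
exists (maxn N M) => k; rewrite geq_max => /andP[Nk Mk].
rewrite opprD addrACA (le_lt_trans (ler_normD _ _))//.
by rewrite [e]splitr ltrD ?hN ?hM.
Qed.

Lemma tendsN V (u : nat -> V) a : tends u a -> tends (fun k => - u k) (- a).
Proof.
by move=> ua e /ua [N hN]; exists N => k /hN; rewrite -opprD normrN.
Qed.

Lemma tendsB V (u v : nat -> V) a b :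
  tends u a -> tends v b -> tends (fun k => u k - v k) (a - b).
Proof. by move=> ua /tendsN; apply: tendsD. Qed.

Lemma tends_uniq V (u : nat -> V) a b : tends u a -> tends u b -> a = b.
Proof.
move=> ua ub; apply/eqP; rewrite -subr_eq0 -normr_le0.
have [//|h] : `|a - b| <= 0 \/ 0 < `|a - b|.
  by have := normr_ge0 (a - b); rewrite le0r => /orP[/eqP->|]; [left|right].
have := tendsB ua ub => /(_ _ h) [N /(_ N (leqnn _))].
by rewrite subrr sub0r normrN ltxx.
Qed.

Lemma tends_squeeze V (u : nat -> V) (v : nat -> C) l :
  (forall k, `|u k - l| <= v k) -> tends v 0 -> tends u l.
Proof.
move=> uv v0 e /v0 [N hN]; exists N => k /hN; rewrite subr0 => h.
by rewrite (le_lt_trans (uv k))// (le_lt_trans _ h)// ger0_norm// (le_trans _ (uv k)).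
Qed.

Lemma tends_bounded V (u : nat -> V) a : tends u a ->
  exists2 N, True & forall k, (N <= k)%N -> `|u k| <= `|a| + 1.
Proof.
move=> /(_ 1 ltr01) [N hN]; exists N => // k /hN /ltW h.
by rewrite -[u k](subrK a) (le_trans (ler_normD _ _))// addrC lerD2l.
Qed.

Lemma tends0M (u : nat -> C) (v : nat -> C) B :
  (forall k, `|v k| <= B) -> tends u 0 -> tends (fun k => u k * v k) 0.
Proof.
move=> vB u0 e e0; have B0 : 0 <= B by rewrite (le_trans _ (vB 0%N)).
have B1 : 0 < B + 1 by rewrite ltr_wpDl.
have [N hN] := u0 _ (divr_gt0 e0 B1); exists N => k /hN; rewrite !subr0 => h.
rewrite normrM -[e](divfK (lt0r_neq0 B1)).
by rewrite ltr_pM// (le_lt_trans (vB k))// ltrDl.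
Qed.

Lemma tendsZ (c : C) (u : nat -> C) a : tends u a -> tends (fun k => c * u k) (c * a).
Proof.
move=> ua e e0; have c1 : 0 < `|c| + 1 by rewrite ltr_wpDl.
have [N hN] := ua _ (divr_gt0 e0 c1); exists N => k /hN h.
rewrite -mulrBr normrM (@le_lt_trans _ _ ((`|c| + 1) * `|u k - a|))//.
  by rewrite ler_wpM2r// lerDl.
by rewrite mulrC -ltr_pdivlMr.
Qed.

Lemma tends_conj (u : nat -> C) a : tends u a -> tends (fun k => (u k)^*) a^*.
Proof.
by move=> ua e /ua [N hN]; exists N => k /hN; rewrite -rmorphB norm_conjC.
Qed.

Lemma tends_ge0 (u : nat -> C) a : (forall k, 0 <= u k) -> tends u a -> 0 <= a.
Proof.
move=> u0 ua.
have ar : a \is Num.real.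
  apply/CrealP; apply: (@tends_uniq C u) => //.
  by apply: tends_ext (tends_conj ua) => k; rewrite geC0_conj.
rewrite real_leNgt ?rpred0//; apply/negP => a0.
have : 0 < - a by rewrite oppr_gt0.
move=> /ua [N /(_ N (leqnn _))].
rewrite ger0_norm ?ltrDr; last by rewrite addr_ge0 // oppr_ge0 ltW.
by rewrite gtrDr => /(le_lt_trans (u0 N)); rewrite ltxx.
Qed.

Lemma tends_le (u v : nat -> C) a b : (forall k, u k <= v k) ->
  tends u a -> tends v b -> a <= b.
Proof.
move=> uv ua vb; rewrite -subr_ge0; apply: tends_ge0 (tendsB vb ua) => k.
by rewrite subr_ge0.
Qed.

Lemma tendsM (u v : nat -> C) a b :
  tends u a -> tends v b -> tends (fun k => u k * v k) (a * b).
Proof.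
move=> ua vb; have [N _ hN] := tends_bounded vb.
have h0 : tends (fun k => (u (k + N)%N - a) * v (k + N)%N) 0.
  apply: (@tends0M _ _ (`|b| + 1)) => [k|].
    by apply: hN; rewrite leq_addl.
  by have := tendsB (tends_shift N ua) (tends_cst a); rewrite subrr.
have := tendsD h0 (tendsZ a (tends_shift N vb)); rewrite add0r.
move=> h e /h [M hM]; exists (M + N)%N => k MNk.
have Nk : (N <= k)%N by rewrite (leq_trans _ MNk)// leq_addl.
have := hM (k - N)%N; rewrite subnK// mulrBl subrK; apply.
by rewrite leq_subRL// addnC.
Qed.

Lemma tends_sum V (I : Type) (r : seq I) (P : pred I) (u : I -> nat -> V) (l : I -> V) :
  (forall i, P i -> tends (u i) (l i)) ->
  tends (fun k => \sum_(i <- r | P i) u i k) (\sum_(i <- r | P i) l i).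
Proof.
move=> h; elim: r => [|i r ih].
  by rewrite big_nil; apply: tends_ext (tends_cst 0) => k; rewrite big_nil.
rewrite big_cons; case: ifP => Pi.
  by apply: tends_ext (tendsD (h i Pi) ih) => k; rewrite big_cons Pi.
by apply: tends_ext ih => k; rewrite big_cons Pi.
Qed.

End Sequences.

(** Definiteness is left out on purpose: the Gram forms on free modules below are degenerate, and
    the completion identifies vectors at distance zero. *)
Record semidot (C : numClosedFieldType) (E : lmodType C) := Semidot {
  sdot :> E -> E -> C;
  sdotPl : forall a u v w, sdot (a *: u + v) w = a * sdot u w + sdot v w;
  sdotC : forall u v, sdot v u = (sdot u v)^*;
  sdot_ge0 : forall u, 0 <= sdot u u }.

Section SemidotTheory.
Variables (C : numClosedFieldType) (E : lmodType C) (f : semidot E).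
Implicit Types u v w : E.

Lemma sdotDl u v w : f (u + v) w = f u w + f v w.
Proof. by rewrite -[u in LHS]scale1r sdotPl mul1r. Qed.

Lemma sdot0l w : f 0 w = 0.
Proof. by apply/(addrI (f 0 w)); rewrite -sdotDl !addr0. Qed.

Lemma sdotZl a u w : f (a *: u) w = a * f u w.
Proof. by rewrite -[a *: u]addr0 sdotPl sdot0l addr0. Qed.

Lemma sdotNl u w : f (- u) w = - f u w.
Proof. by rewrite -scaleN1r sdotZl mulN1r. Qed.

Lemma sdotBl u v w : f (u - v) w = f u w - f v w.
Proof. by rewrite sdotDl sdotNl. Qed.

Lemma sdotDr w u v : f w (u + v) = f w u + f w v.
Proof. by rewrite [LHS]sdotC sdotDl rmorphD [f w u]sdotC [f w v]sdotC. Qed.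

Lemma sdot0r w : f w 0 = 0.
Proof. by rewrite sdotC sdot0l rmorph0. Qed.

Lemma sdotZr a w u : f w (a *: u) = a^* * f w u.
Proof. by rewrite [LHS]sdotC sdotZl rmorphM [f w u]sdotC. Qed.

Lemma sdotNr w u : f w (- u) = - f w u.
Proof. by rewrite [LHS]sdotC sdotNl rmorphN [f w u]sdotC. Qed.

Lemma sdotBr w u v : f w (u - v) = f w u - f w v.
Proof. by rewrite sdotDr sdotNr. Qed.

Lemma sdot_suml (I : Type) (r : seq I) (P : pred I) (F : I -> E) w :
  f (\sum_(i <- r | P i) F i) w = \sum_(i <- r | P i) f (F i) w.
Proof. by apply: (big_morph (f^~ w)) => [u v|]; [exact: sdotDl|exact: sdot0l]. Qed.

Lemma sdot_sumr (I : Type) (r : seq I) (P : pred I) (F : I -> E) w :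
  f w (\sum_(i <- r | P i) F i) = \sum_(i <- r | P i) f w (F i).
Proof. by apply: (big_morph (f w)) => [u v|]; [exact: sdotDr|exact: sdot0r]. Qed.

Lemma cauchy_schwarz_sq u v : `|f u v| ^+ 2 <= f u u * f v v.
Proof.
(* This expands the squared seminorm of u - t <u, v> v. The optimal value is t = 1 / <v, v>; for a
   null v the expression is affine in t and a suitable t makes it negative. *)
have key (t : C) : t \is Num.real ->
    0 <= f u u - 2 * t * `|f u v| ^+ 2 + t ^+ 2 * `|f u v| ^+ 2 * f v v.
  move=> tr; have := sdot_ge0 f (u - (t * f u v) *: v).
  rewrite sdotBl !sdotBr !sdotZl !sdotZr [f v u]sdotC rmorphM /= (CrealP tr).
  move=> /le_trans; apply.
  rewrite le_eqVlt; apply/orP; left; apply/eqP.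
  by rewrite normCK; ring.
have := sdot_ge0 f v; rewrite le0r => /orP[/eqP v0|v0].
  rewrite v0 mulr0; rewrite v0 in key.
  have := sdot_ge0 f u; rewrite le0r => /orP[/eqP u0|u0].
    have := key 1 (rpred1 _); rewrite u0 mulr0 addr0 add0r mulr1.
    by rewrite oppr_ge0 pmulr_rle0 ?ltr0n.
  rewrite real_leNgt ?rpred0 ?rpredX ?normr_real//; apply/negP => h.
  have tr : f u u / `|f u v| ^+ 2 \is Num.real.
    by rewrite ger0_real// divr_ge0// ?exprn_ge0// ltW.
  have := key _ tr; rewrite mulr0 addr0 mulrA divfK ?gt_eqF//.
  have -> : f u u - 2 * f u u = - f u u by ring.
  by rewrite oppr_ge0 => /le_lt_trans/(_ u0); rewrite ltxx.
have vr : (f v v)^-1 \is Num.real by rewrite realV realE ltW.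
have := key _ vr.
have -> : f u u - 2 * (f v v)^-1 * `|f u v| ^+ 2 +
   (f v v)^-1 ^+ 2 * `|f u v| ^+ 2 * f v v = f u u - `|f u v| ^+ 2 / f v v.
  by field; rewrite gt_eqF.
by rewrite subr_ge0 ler_pdivrMr.
Qed.

Definition snorm u := sqrtC (f u u).

Lemma snorm_ge0 u : 0 <= snorm u.
Proof. by rewrite sqrtC_ge0 sdot_ge0. Qed.

Lemma snormE u : snorm u ^+ 2 = f u u.
Proof. by rewrite sqrtCK. Qed.

Lemma cauchy_schwarz u v : `|f u v| <= snorm u * snorm v.
Proof.
rewrite -(@ler_pXn2r _ 2)// ?nnegrE ?mulr_ge0 ?snorm_ge0//.
by rewrite exprMn !snormE cauchy_schwarz_sq.
Qed.

Lemma snormZ a u : snorm (a *: u) = `|a| * snorm u.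
Proof.
apply: (@pexpIrn _ 2) => //; rewrite ?nnegrE ?mulr_ge0 ?snorm_ge0//.
by rewrite exprMn !snormE sdotZl sdotZr mulrA normCK.
Qed.

Lemma snormN u : snorm (- u) = snorm u.
Proof. by rewrite -scaleN1r snormZ normrN normr1 mul1r. Qed.

Lemma snorm0 : snorm 0 = 0.
Proof. by rewrite /snorm sdot0l sqrtC0. Qed.

Lemma snormBC u v : snorm (u - v) = snorm (v - u).
Proof. by rewrite -snormN opprB. Qed.

Lemma snormD u v : snorm (u + v) <= snorm u + snorm v.
Proof.
rewrite -(@ler_pXn2r _ 2)// ?nnegrE ?addr_ge0 ?snorm_ge0//.
rewrite snormE sdotDl !sdotDr sqrrD !snormE -!addrA lerD2l !addrA lerD2r.
rewrite [f v u]sdotC -[leRHS](@mulr_natl _ _ 2).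
apply: le_trans (_ : 2 * `|f u v| <= _); last by rewrite ler_pM2l// cauchy_schwarz.
have r : f u v + (f u v)^* \is Num.real.
  by apply/CrealP; rewrite rmorphD /= conjCK addrC.
rewrite (le_trans (real_ler_norm r))// (le_trans (ler_normD _ _))//.
by rewrite norm_conjC mulr_natl mulr2n.
Qed.

End SemidotTheory.

(** * Completion of a semi-inner product space *)

(** An abstract interface to R[i], instantiated by [complexF] below: sequential completeness and the
    Archimedean property are what the analytic arguments take from the scalars. *)
Structure completeClosedField := CompleteClosedField {
  ccf :> numClosedFieldType;
  ccf_complete : @seq_complete ccf ccf;
  ccf_archi : forall e : ccf, 0 < e -> exists n : nat, n.+1%:R^-1 < e }.

Section Completion.
Variables (C : completeClosedField) (E : lmodType C) (f : semidot E).
Implicit Types (u v w : nat -> E) (F G : E -> C^o).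

Definition scauchy u := forall e : C, 0 < e ->
  exists N, forall i j, (N <= i)%N -> (N <= j)%N -> snorm f (u i - u j) < e.

Definition represents u F := scauchy u /\ forall x, tends (fun k => f (u k) x) (F x).

Lemma scauchy_bounded u : scauchy u -> exists B, forall k, snorm f (u k) <= B.
Proof.
move=> /(_ 1 ltr01) [N hN].
exists (\sum_(i < N) snorm f (u i) + (snorm f (u N) + 1)) => k.
have s0 (I : finType) (P : pred I) (g : I -> E) : 0 <= \sum_(i | P i) snorm f (g i).
  by apply: sumr_ge0 => i _; exact: snorm_ge0.
case: (ltnP k N) => kN.
  rewrite (bigD1 (Ordinal kN))//= -addrA lerDl addr_ge0 ?s0//.
  by rewrite addr_ge0 ?snorm_ge0.
rewrite ler_wpDl ?s0// -[u k](subrK (u N)) addrC (le_trans (snormD _ _ _))//.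
by rewrite lerD2l; apply/ltW/hN.
Qed.

Lemma scauchyP a u v : scauchy u -> scauchy v -> scauchy (fun k => a *: u k + v k).
Proof.
move=> uc vc e e0; have a1 : 0 < `|a| + 1 by rewrite ltr_wpDl.
have e20 : 0 < e / 2 by rewrite divr_gt0.
have [N hN] := uc _ (divr_gt0 e20 a1); have [M hM] := vc _ e20.
exists (maxn N M) => i j; rewrite !geq_max => /andP[Ni Mi] /andP[Nj Mj].
rewrite opprD addrACA -scalerBr (le_lt_trans (snormD _ _ _))//.
rewrite [e]splitr ler_ltD ?hM// snormZ.
rewrite (@le_trans _ _ ((`|a| + 1) * snorm f (u i - u j)))//.
  by rewrite ler_wpM2r ?snorm_ge0// lerDl.
by rewrite mulrC -ler_pdivlMr// ltW// hN.
Qed.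

Lemma scauchy_cst x : scauchy (fun=> x).
Proof. by move=> e e0; exists 0%N => i j _ _; rewrite subrr snorm0. Qed.

Lemma scauchyB u v : scauchy u -> scauchy v -> scauchy (fun k => u k - v k).
Proof.
move=> uc vc; have := scauchyP (-1) vc uc.
by move=> h e /h [N hN]; exists N => i j Ni Nj; have := hN i j Ni Nj;
   rewrite !scaleN1r ![- _ + _]addrC.
Qed.

(** Write |w_k|^2 = <w_k, w_k - w_N> + <w_k, w_N>: the first term is small by the Cauchy property,
    the second by weak convergence. Consequently the functional represented by a Cauchy sequence
    determines it up to null sequences. *)
Lemma scauchy_null w : scauchy w -> (forall x, tends (fun k => f (w k) x) 0) ->
  tends (fun k => snorm f (w k)) 0.
Proof.
move=> wc w0 e e0; have [B hB] := scauchy_bounded wc.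
have B0 : 0 <= B by rewrite (le_trans _ (hB 0%N))// snorm_ge0.
have B1 : 0 < B + 1 by rewrite ltr_wpDl.
have e2 : 0 < e ^+ 2 / 2 by rewrite divr_gt0// exprn_gt0.
have [N hN] := wc _ (divr_gt0 e2 B1).
have [M hM] := w0 (w N) _ e2.
exists (maxn N M) => k; rewrite geq_max => /andP[Nk Mk].
rewrite subr0 ger0_norm ?snorm_ge0// -(@ltr_pXn2r _ 2)// ?nnegrE ?snorm_ge0 ?ltW//.
rewrite snormE -[X in f _ X](subrK (w N)) sdotDr.
have r : f (w k) (w k - w N) + f (w k) (w N) \is Num.real.
  by rewrite -sdotDr subrK ger0_real// sdot_ge0.
rewrite (le_lt_trans (real_ler_norm r))// (le_lt_trans (ler_normD _ _))//.
rewrite [e ^+ 2]splitr ler_ltD//; last by have := hM _ Mk; rewrite subr0.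
rewrite (le_trans (cauchy_schwarz _ _ _))//.
rewrite (@le_trans _ _ ((B + 1) * snorm f (w k - w N)))//.
  by rewrite ler_wpM2r ?snorm_ge0// (le_trans (hB k))// lerDl.
by rewrite mulrC -ler_pdivlMr// ltW// hN.
Qed.

Lemma scauchy_dot u v : scauchy u -> scauchy v ->
  exists l, tends (fun k => f (u k) (v k)) l.
Proof.
move=> uc vc; apply: (@ccf_complete C) => e e0.
have [A hA] := scauchy_bounded uc; have [B hB] := scauchy_bounded vc.
have A0 : 0 <= A by rewrite (le_trans _ (hA 0%N))// snorm_ge0.
have B0 : 0 <= B by rewrite (le_trans _ (hB 0%N))// snorm_ge0.
have A1 : 0 < A + 1 by rewrite ltr_wpDl.
have B1 : 0 < B + 1 by rewrite ltr_wpDl.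
have e2 : 0 < e / 2 by rewrite divr_gt0.
have [N hN] := uc _ (divr_gt0 e2 B1); have [M hM] := vc _ (divr_gt0 e2 A1).
exists (maxn N M) => i j; rewrite !geq_max => /andP[Ni Mi] /andP[Nj Mj].
have -> : f (u i) (v i) - f (u j) (v j) = f (u i - u j) (v i) + f (u j) (v i - v j).
  by rewrite sdotBl sdotBr; ring.
rewrite (le_lt_trans (ler_normD _ _))// [e]splitr ltrD//.
  rewrite (le_lt_trans (cauchy_schwarz _ _ _))//.
  rewrite (@le_lt_trans _ _ (snorm f (u i - u j) * (B + 1)))//.
    by rewrite ler_wpM2l ?snorm_ge0// (le_trans (hB i))// lerDl.
  by rewrite -ltr_pdivlMr// hN.
rewrite (le_lt_trans (cauchy_schwarz _ _ _))// mulrC.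
rewrite (@le_lt_trans _ _ (snorm f (v i - v j) * (A + 1)))//.
  by rewrite ler_wpM2l ?snorm_ge0// (le_trans (hA j))// lerDl.
by rewrite -ltr_pdivlMr// hM.
Qed.

(** This makes the inner product of the completion independent of the representing sequences. *)
Lemma represents_dot u u' v v' F G l : represents u F -> represents u' F ->
  represents v G -> represents v' G ->
  tends (fun k => f (u k) (v k)) l -> tends (fun k => f (u' k) (v' k)) l.
Proof.
move=> [uc uF] [uc' uF'] [vc vG] [vc' vG'] h.
have null w w' H : scauchy w -> scauchy w' -> (forall x, tends (fun k => f (w k) x) (H x)) ->
    (forall x, tends (fun k => f (w' k) x) (H x)) ->
    tends (fun k => snorm f (w k - w' k)) 0.
  move=> wc wc' wH wH'; apply: scauchy_null; first exact: scauchyB.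
  move=> x; have := tendsB (wH x) (wH' x); rewrite subrr.
  by apply: tends_ext => k; rewrite sdotBl.
have nu := null _ _ _ uc' uc uF' uF; have nv := null _ _ _ vc' vc vG' vG.
have [A hA] := scauchy_bounded uc; have [B hB] := scauchy_bounded vc'.
have A0 : 0 <= A by rewrite (le_trans _ (hA 0%N))// snorm_ge0.
have B0 : 0 <= B by rewrite (le_trans _ (hB 0%N))// snorm_ge0.
have t0 : tends (fun k => snorm f (u' k - u k) * snorm f (v' k) +
                          snorm f (v' k - v k) * snorm f (u k)) 0.
  rewrite -[X in tends _ X]addr0; apply: tendsD.
    by apply: (@tends0M C _ _ B) nu => k; rewrite ger0_norm ?snorm_ge0.
  by apply: (@tends0M C _ _ A) nv => k; rewrite ger0_norm ?snorm_ge0.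
have d0 : tends (fun k => f (u' k) (v' k) - f (u k) (v k)) 0.
  apply: tends_squeeze t0 => k; rewrite subr0.
  have -> : f (u' k) (v' k) - f (u k) (v k) =
            f (u' k - u k) (v' k) + f (u k) (v' k - v k).
    by rewrite sdotBl sdotBr; ring.
  rewrite (le_trans (ler_normD _ _))// lerD ?cauchy_schwarz// mulrC.
  exact: cauchy_schwarz.
have := tendsD d0 h; rewrite add0r; apply: tends_ext => k.
by rewrite subrK.
Qed.

Definition in_completion : {pred (E -> C^o)} :=
  [pred F : E -> C^o | `[< exists u, represents u F >]].

Lemma representsP a u v F G : represents u F -> represents v G ->
  represents (fun k => a *: u k + v k) (a *: F + G).
Proof.
move=> [uc uF] [vc vG]; split; first exact: scauchyP.
by move=> x; apply: tends_ext (tendsD (tendsZ a (uF x)) (vG x)) => k; rewrite sdotPl.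
Qed.

Lemma represents_cst x : represents (fun=> x) (f x).
Proof. by split; [exact: scauchy_cst|move=> y; exact: tends_cst]. Qed.

Lemma in_completion_submod : submod_closed in_completion.
Proof.
split=> [|a F G /asboolP[u uF] /asboolP[v vG]]; apply/asboolP.
  exists (fun=> 0); have := represents_cst 0.
  by have -> : f 0 = 0 :> (E -> C^o) by apply/funext => x; rewrite sdot0l.
by exists (fun k => a *: u k + v k); exact: representsP.
Qed.

HB.instance Definition _ :=
  GRing.isSubmodClosed.Build C (E -> C^o) in_completion in_completion_submod.

(* The Cauchy sequence u is represented by the functional x |-> lim <u_k, x>, which determines it. *)
Record completion := Completion {
  cfun : E -> C^o; cfunP : cfun \in in_completion }.

HB.instance Definition _ := [isSub for cfun].
HB.instance Definition _ := [Choice of completion by <:].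
HB.instance Definition _ := [SubChoice_isSubLmodule of completion by <:].

Implicit Types X Y Z : completion.

Lemma completion_rep X : exists u, represents u (cfun X).
Proof. by have := cfunP X => /asboolP. Qed.

Definition crep X := projT1 (cid (completion_rep X)).

Lemma crepP X : represents (crep X) (cfun X).
Proof. exact: (projT2 (cid (completion_rep X))). Qed.

Lemma cdot_ex X Y : exists l, tends (fun k => f (crep X k) (crep Y k)) l.
Proof. exact: scauchy_dot (crepP X).1 (crepP Y).1. Qed.

Definition cdot X Y : C := projT1 (cid (cdot_ex X Y)).

Lemma cdotP u v X Y : represents u (cfun X) -> represents v (cfun Y) ->
  tends (fun k => f (u k) (v k)) (cdot X Y).
Proof.
move=> uX vY; apply: represents_dot (crepP X) uX (crepP Y) vY _.
exact: (projT2 (cid (cdot_ex X Y))).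
Qed.

Lemma representsZD a u v X Y : represents u (cfun X) -> represents v (cfun Y) ->
  represents (fun k => a *: u k + v k) (cfun (a *: X + Y)).
Proof.
have -> : cfun (a *: X + Y) = a *: cfun X + cfun Y by exact: (linearP \val).
exact: representsP.
Qed.

Lemma cdotPl a X Y Z : cdot (a *: X + Y) Z = a * cdot X Z + cdot Y Z.
Proof.
have hX := crepP X; have hY := crepP Y; have hZ := crepP Z.
apply: tends_uniq (cdotP (representsZD a hX hY) hZ) _.
apply: tends_ext (tendsD (tendsZ a (cdotP hX hZ)) (cdotP hY hZ)) => k.
by rewrite sdotPl.
Qed.

Lemma cdotC X Y : cdot Y X = (cdot X Y)^*.
Proof.
have hX := crepP X; have hY := crepP Y.
apply: tends_uniq (cdotP hY hX) _.
by apply: tends_ext (tends_conj (cdotP hX hY)) => k; rewrite -sdotC.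
Qed.

Lemma cdot_ge0 X : 0 <= cdot X X.
Proof.
have hX := crepP X.
by apply: tends_ge0 (cdotP hX hX) => k; exact: sdot_ge0.
Qed.

Definition csemidot := Semidot cdotPl cdotC cdot_ge0.

Lemma cembed_proof x : (f x : E -> C^o) \in in_completion.
Proof. by apply/asboolP; exists (fun=> x); exact: represents_cst. Qed.

Definition cembed x := Completion (cembed_proof x).

Lemma cdot_cembedr X x : cdot X (cembed x) = cfun X x.
Proof.
have hX := crepP X.
exact: (@tends_uniq C C _ _ _ (cdotP (Y := cembed x) hX (represents_cst x)) (hX.2 x)).
Qed.

Lemma cdot_cembed x y : cdot (cembed x) (cembed y) = f x y.
Proof. by rewrite cdot_cembedr. Qed.

Lemma cdot_eq0 X : cdot X X = 0 -> X = 0.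
Proof.
move=> X0; apply: val_inj; apply/funext => x /=; apply/eqP.
rewrite -normr_le0 -cdot_cembedr.
have := cauchy_schwarz csemidot X (cembed x).
by rewrite /snorm /= X0 sqrtC0 mul0r.
Qed.

Lemma completion_dense u X : represents u (cfun X) ->
  forall e : C, 0 < e -> exists N, forall k, (N <= k)%N ->
    snorm csemidot (X - cembed (u k)) <= e.
Proof.
move=> uX e e0; have [N hN] := uX.1 _ e0; exists N => k Nk.
rewrite -(@ler_pXn2r _ 2)// ?nnegrE ?snorm_ge0 ?(ltW e0)// snormE.
have hk : represents (fun m => u m - u k) (cfun (X - cembed (u k))).
  have := representsZD (-1) (represents_cst (u k) : represents _ (cfun (cembed (u k)))) uX.
  rewrite !scaleN1r [- _ + _]addrC; congr (represents _ _).
  by apply/funext => m; rewrite addrC.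
apply: tends_le (tends_shift N (cdotP hk hk)) (tends_cst (e ^+ 2)) => m.
rewrite -snormE ler_pXn2r ?nnegrE ?snorm_ge0 ?ltW// hN//.
exact: leq_addl.
Qed.

Lemma csnormD X Y : snorm csemidot (X + Y) <= snorm csemidot X + snorm csemidot Y.
Proof. exact: snormD. Qed.

Lemma csnormZ a X : snorm csemidot (a *: X) = `|a| * snorm csemidot X.
Proof. exact: snormZ. Qed.

Lemma csnorm_eq0 X : snorm csemidot X = 0 -> X = 0.
Proof. by move=> /(congr1 (fun x => x ^+ 2)); rewrite snormE expr0n; exact: cdot_eq0. Qed.

HB.instance Definition _ :=
  Lmodule_isNormed.Build C completion csnormD csnormZ csnorm_eq0.

Lemma completion_normE X : `|X| = snorm csemidot X.
Proof. by []. Qed.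

Lemma completion_complete (F : set_system completion) :
  ProperFilter F -> cauchy F -> cvg F.
Proof.
move=> FF /cauchyP Fc.
have n0 (k : nat) : 0 < k.+1%:R^-1 :> C by rewrite invr_gt0 ltr0n.
have /choice[p hp] : forall k : nat, exists x, F (ball x (k.+1%:R^-1 : C)).
  by move=> k; have [x hx] := Fc _ (n0 k); exists x.
have hpp i j : `|p i - p j| <= i.+1%:R^-1 + j.+1%:R^-1.
  have [y [yi yj]] := filter_ex (filterI (hp i) (hp j)).
  move: yi yj; rewrite -ball_normE /ball_ /= => yi yj.
  rewrite -[p i](subrK y) -addrA (le_trans (ler_normD _ _))// lerD ?ltW//.
  by rewrite distrC.
(* Diagonal argument: each p k is replaced by a vector v k of E within 1 / (k + 1). The sequence v
   is Cauchy, and the functional it represents is the limit. *)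
have /choice[v hv] : forall k, exists x, `|p k - cembed x| <= k.+1%:R^-1.
  move=> k; have [N hN] := completion_dense (crepP (p k)) (n0 k).
  by exists (crep (p k) N); exact: hN.
have hvv i j : snorm f (v i - v j) <= 2 * i.+1%:R^-1 + 2 * j.+1%:R^-1.
  have -> : snorm f (v i - v j) = `|cembed (v i) - cembed (v j)|.
    rewrite completion_normE /snorm /= -cdot_cembed; congr (sqrtC (cdot _ _));
    by apply: val_inj; apply/funext => x; rewrite /= sdotBl.
  have -> : cembed (v i) - cembed (v j) =
      (cembed (v i) - p i) + (p i - p j) + (p j - cembed (v j)).
    by rewrite !addrA !subrK.
  rewrite (le_trans (ler_normD _ _))// (le_trans (lerD (ler_normD _ _) (lexx _)))//.
  rewrite [X in X + _ + _]distrC.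
  apply: le_trans (lerD (lerD (hv i) (hpp i j)) (hv j)) _.
  by rewrite !mulr_natl !mulr2n !addrA.
have small (c e : C) : 0 < c -> 0 < e -> exists N : nat, forall k, (N <= k)%N -> c * k.+1%:R^-1 < e.
  move=> c0 e0; have [N hN] := ccf_archi (divr_gt0 e0 c0).
  exists N => k Nk; rewrite mulrC -ltr_pdivlMr//; apply: le_lt_trans hN.
  by rewrite lef_pV2 ?posrE ?ltr0n// ler_nat.
have vc : scauchy v.
  move=> e e0; have [N hN] := small 2 (e / 2) (ltr0n _ 2) (divr_gt0 e0 (ltr0n _ 2)).
  exists N => i j Ni Nj; rewrite (le_lt_trans (hvv i j))// [e]splitr.
  by rewrite ltrD ?hN.
have /choice[g hg] : forall x, exists l, tends (fun k => f (v k) x) l.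
  by move=> x; exact: scauchy_dot vc (scauchy_cst x).
have gin : (g : E -> C^o) \in in_completion by apply/asboolP; exists v.
pose G := Completion gin; have vG : represents v (cfun G) by [].
apply/cvg_ex; exists G; apply/cvg_ballP => e e0.
have e20 : 0 < e / 2 by rewrite divr_gt0.
have [N hN] := small 2 (e / 2) (ltr0n _ 2) e20.
have [M hM] := completion_dense vG e20.
set k := maxn N M; have Nk : (N <= k)%N by rewrite leq_maxl.
have Mk : (M <= k)%N by rewrite leq_maxr.
have := hp k; apply: filterS => y; rewrite -!ball_normE /ball_ /= => y1.
have -> : G - y = (G - cembed (v k)) + ((cembed (v k) - p k) + (p k - y)).
  by rewrite !addrA !subrK.
rewrite (le_lt_trans (ler_normD _ _))// [e]splitr ler_ltD ?hM//.
rewrite (le_lt_trans (ler_normD _ _))// (le_lt_trans _ (hN _ Nk))//.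
rewrite mulr_natl mulr2n lerD//; last exact: ltW.
by rewrite distrC.
Qed.

HB.instance Definition _ := Uniform_isComplete.Build completion completion_complete.

End Completion.

Section CompletionDot.
Variables (C : completeClosedField) (E : lmodType C) (f : semidot E).
Local Notation T := (completion f).

Lemma cdot_zmod_l (Y : T) : zmod_morphism (cdot (f := f) ^~ Y).
Proof. by move=> u v; exact: (sdotBl (csemidot f)). Qed.

Lemma cdot_zmod_r (X : T) : zmod_morphism (cdot X).
Proof. by move=> u v; exact: (sdotBr (csemidot f)). Qed.

Lemma cdot_scal_l (Y : T) : scalable_for *%R (cdot (f := f) ^~ Y).
Proof. by move=> a u; exact: (sdotZl (csemidot f)). Qed.

Lemma cdot_scal_r (X : T) : scalable_for (Num.conj \; *%R) (cdot X).
Proof. by move=> a u; exact: (sdotZr (csemidot f)). Qed.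

HB.instance Definition _ :=
  @isBilinear.Build C T T C *%R (Num.conj \; *%R) (@cdot C E f)
    cdot_zmod_l cdot_zmod_r cdot_scal_l cdot_scal_r.

Lemma cdot_herm (X Y : T) : cdot X Y = (-1) ^+ false * (cdot Y X)^*.
Proof. by rewrite expr0 mul1r -cdotC. Qed.

HB.instance Definition _ :=
  @isHermitianSesquilinear.Build C T false Num.conj (@cdot C E f) cdot_herm.

Lemma cdot_gt0 (X : T) : X != 0 -> 0 < cdot X X.
Proof.
move=> X0; rewrite lt_def cdot_ge0 andbT; apply: contra X0 => /eqP h.
by rewrite (cdot_eq0 h).
Qed.

HB.instance Definition _ :=
  @isDotProduct.Build C T (@cdot C E f) cdot_gt0.

Lemma cdotxx (X : T) : cdot X X = `|X| ^+ 2.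
Proof. by rewrite completion_normE snormE. Qed.

End CompletionDot.

(** * Completeness of the complex numbers *)

Section ComplexComplete.
Variable R : realType.
Local Notation C := R[i].

Lemma real_seq_complete (u : nat -> R) :
  (forall e, 0 < e -> exists N, forall i j, (N <= i)%N -> (N <= j)%N -> `|u i - u j| < e) ->
  exists l, forall e, 0 < e -> exists N, forall k, (N <= k)%N -> `|u k - l| < e.
Proof.
move=> uc; have /cvg_ex[l /cvgrPdist_lt hl] : cvg (u @ \oo).
  apply: cauchy_cvg; apply/cauchyP => e e0; have [N hN] := uc e e0.
  by exists (u N); exists N => // k /= Nk; rewrite -ball_normE /ball_ /= hN.
exists l => e /hl [N _ hN]; exists N => k Nk; rewrite distrC; exact: hN.
Qed.

Lemma complex_seq_complete : @seq_complete C C.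
Proof.
move=> u uc.
have part (g : C -> R) : (forall x y, g x - g y = g (x - y)) ->
    (forall x, (`|g x|%:C <= `|x|)%C) ->
    exists l, forall e, 0 < e -> exists N, forall k, (N <= k)%N -> `|g (u k) - l| < e.
  move=> gB gn; apply: real_seq_complete => e e0.
  have [|N hN] := uc e%:C%C; first by rewrite ltcR.
  exists N => i j Ni Nj; rewrite gB -ltcR; apply: le_lt_trans (gn _) _.
  exact: hN.
have [a ha] := part (@complex.Re R) (fun x y => esym (raddfB (@complex.Re R) x y)) (@normc_ge_Re R).
have ni : `|'i%C : C| = 1 by rewrite normc_def /= expr0n /= add0r expr1n sqrtr1.
have normc_ge_Im (x : C) : (`|complex.Im x|%:C <= `|x|)%C.
  have -> : complex.Im x = complex.Re (- 'i%C * x) by case: x => x y /=; ring.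
  by rewrite (le_trans (normc_ge_Re _))// normrM normrN ni mul1r.
have [b hb] := part (@complex.Im R) (fun x y => esym (raddfB (@complex.Im R) x y)) normc_ge_Im.
exists (a +i* b)%C => e e0.
have [e' e'0 ee'] : exists2 e' : R, 0 < e' & (e'%:C)%C = e.
  by case: e e0 => x y; rewrite ltcE /= => /andP[/eqP -> x0]; exists x.
have e20 : 0 < e' / 2 by rewrite divr_gt0.
have [N hN] := ha _ e20; have [M hM] := hb _ e20.
exists (maxn N M) => k; rewrite geq_max => /andP[Nk Mk].
have -> : u k - (a +i* b)%C =
   ((complex.Re (u k) - a)%:C)%C + ('i%C * (complex.Im (u k) - b)%:C%C).
  by case: (u k) => x y; apply/eqP; rewrite eq_complex /= !(mul0r, mul1r, mulr0, add0r, addr0, subr0, sub0r, oppr0) !eqxx.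
rewrite (le_lt_trans (ler_normD _ _))// normrM -ee'.
have nr (x : R) : `|x%:C%C| = `|x|%:C%C by rewrite normc_def /= expr0n /= addr0 sqrtr_sqr.
by rewrite ni mul1r !nr -rmorphD ltcR [e']splitr ltrD ?hN ?hM.
Qed.

Lemma complex_archi (e : C) : 0 < e -> exists n : nat, n.+1%:R^-1 < e.
Proof.
case: e => x y; rewrite ltcE /= => /andP[/eqP -> x0].
have [n hn] := ltr_add_invr (x0 : 0 < x); exists n.
rewrite -[(_ +i* _)%C]/(x%:C)%C.
by move: hn; rewrite add0r -ltcR fmorphV rmorph_nat.
Qed.

Definition complexF : completeClosedField :=
  CompleteClosedField complex_seq_complete complex_archi.

End ComplexComplete.

(** * The Halmos-Bram criterion *)

Import freeg.

Section CompletionOperator.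
Variables (C : completeClosedField) (E : lmodType C) (f : semidot E).
Variables (T T' : {linear E -> E}) (c : C).
Hypothesis adjT : forall u v, f (T u) v = f u (T' v).
Hypothesis c_ge0 : 0 <= c.
Hypothesis bndT : forall u, snorm f (T u) <= c * snorm f u.
Local Notation K := (completion f).

Lemma represents_op u (F : E -> C^o) : represents f u F -> represents f (T \o u) (F \o T').
Proof.
move=> [uc uF]; split=> [e e0|x].
  have c1 : 0 < c + 1 by rewrite ltr_wpDl.
  have [N hN] := uc _ (divr_gt0 e0 c1); exists N => i j Ni Nj.
  rewrite /= -linearB (le_lt_trans (bndT _))//.
  apply: le_lt_trans (_ : (c + 1) * snorm f (u i - u j) < _); last first.
    by rewrite mulrC -ltr_pdivlMr// hN.
  by rewrite ler_wpM2r ?snorm_ge0// lerDl.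
by apply: tends_ext (uF (T' x)) => k; rewrite /= adjT.
Qed.

(** A vector of the completion is a functional x |-> <X, x>, so extending T means precomposing with
    its formal adjoint T'. The bound on T serves to keep representing sequences Cauchy. *)
Lemma completion_op_proof (X : K) : (cfun X \o T' : E -> C^o) \in in_completion f.
Proof.
by apply/asboolP; exists (T \o crep X); apply: represents_op; exact: crepP.
Qed.

Definition completion_op (X : K) : K := Completion (completion_op_proof X).

Lemma completion_op_linear : linear completion_op.
Proof. by move=> a X Y; apply: val_inj. Qed.

HB.instance Definition _ :=
  GRing.isLinear.Build C K K *:%R completion_op completion_op_linear.

Lemma completion_op_rep u X : represents f u (cfun X) ->
  represents f (T \o u) (cfun (completion_op X)).
Proof. exact: represents_op. Qed.

Lemma completion_op_cembed x : completion_op (cembed f x) = cembed f (T x).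
Proof. by apply: val_inj; apply/funext => y /=; rewrite adjT. Qed.

Lemma completion_op_bounded (X : K) : `|completion_op X| <= c * `|X|.
Proof.
rewrite !completion_normE -(@ler_pXn2r _ 2)// ?nnegrE ?mulr_ge0 ?snorm_ge0//.
rewrite exprMn !snormE; have hX := crepP X.
apply: tends_le (cdotP (completion_op_rep hX) (completion_op_rep hX))
  (tendsZ (c ^+ 2) (cdotP hX hX)) => k /=.
by rewrite -!snormE -exprMn ler_pXn2r ?nnegrE ?mulr_ge0 ?snorm_ge0.
Qed.

End CompletionOperator.

Lemma completion_op_adjoint (C : completeClosedField) (E : lmodType C)
  (f : semidot E) (T T' : {linear E -> E}) (c c' : C)
  (adj : forall u v, f (T u) v = f u (T' v))
  (adj' : forall u v, f (T' u) v = f u (T v))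
  (c0 : 0 <= c) (c0' : 0 <= c')
  (bnd : forall u, snorm f (T u) <= c * snorm f u)
  (bnd' : forall u, snorm f (T' u) <= c' * snorm f u) (X Y : completion f) :
  cdot (completion_op adj c0 bnd X) Y = cdot X (completion_op adj' c0' bnd' Y).
Proof.
have hX := crepP X; have hY := crepP Y.
have h1 := cdotP (Y := completion_op adj' c0' bnd' Y) hX (completion_op_rep adj' c0' bnd' hY).
apply: tends_uniq (cdotP (X := completion_op adj c0 bnd X) (completion_op_rep adj c0 bnd hX) hY) _.
by apply: tends_ext h1 => k /=; rewrite adj.
Qed.

Lemma bernoulli_inequality (C : numClosedFieldType) (t : C) k :
  1 <= t -> 1 + (t - 1) *+ k <= t ^+ k.
Proof.
move=> t1; elim: k => [|k ih]; first by rewrite mulr0n addr0.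
rewrite exprS; apply: le_trans (_ : t * (1 + (t - 1) *+ k) <= _); last first.
  by rewrite ler_pM2l// (lt_le_trans ltr01).
rewrite mulrS -subr_ge0; set y := (t - 1) *+ k.
have -> : t * (1 + y) - (1 + (t - 1 + y)) = (t - 1) * y by clearbody y; ring.
by rewrite mulr_ge0 ?mulrn_wge0 ?subr_ge0.
Qed.

(* Iterated Cauchy-Schwarz makes q log-convex, so that exponential growth at rate d bounds the first ratio. *)
Lemma geometric_bound (C : numClosedFieldType) (q : nat -> C) (B d : C) :
  (forall e : C, 0 < e -> exists n : nat, n.+1%:R^-1 < e) ->
  (forall k, 0 <= q k) -> 0 <= d ->
  (forall k, q k.+1 ^+ 2 <= q k * q k.+2) -> (forall k, q k <= B * d ^+ k) ->
  q 1%N <= d * q 0%N.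
Proof.
move=> archi q0 d0 qq qB.
have B0 : 0 <= B by have := le_trans (q0 0%N) (qB 0%N); rewrite expr0 mulr1.
have [/eqP h|q0p] := boolP (q 0%N == 0).
  have := qq 0%N; rewrite h mul0r mulr0 => h1.
  by rewrite -(@ler_pXn2r _ 2)// ?nnegrE// expr0n.
have {q0p}q0p : 0 < q 0%N by rewrite lt_def q0p q0.
rewrite -ler_pdivrMr//; set r := q 1%N / q 0%N.
have r0 : 0 <= r by rewrite divr_ge0.
rewrite real_leNgt ?ger0_real//; apply/negP => dr.
have rp : 0 < r by apply: le_lt_trans dr.
(* Log-convexity makes the successive ratios nondecreasing, so all of them are at least the first
   ratio r, assumed larger than d. *)
have step k : 0 < q k /\ r * q k <= q k.+1.
  elim: k => [|k [qk ih]]; first by split=> //; rewrite /r divfK ?gt_eqF.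
  have qk1 : 0 < q k.+1 by apply: lt_le_trans ih; rewrite mulr_gt0.
  split=> //; have := qq k; rewrite expr2 => h.
  rewrite -(ler_pM2l qk) (le_trans _ h)// mulrA [q k * r]mulrC.
  by rewrite ler_wpM2r// ltW.
have grow k : q 0%N * r ^+ k <= q k.
  elim: k => [|k ih]; first by rewrite mulr1.
  have [_ h] := step k; apply: le_trans h; rewrite exprS mulrCA.
  by rewrite ler_wpM2l.
have {grow qB} bnd k : q 0%N * r ^+ k <= B * d ^+ k by apply: le_trans (grow k) _.
have [h|dp] : d = 0 \/ 0 < d.
  by move: d0; rewrite le0r => /orP[/eqP->|]; [left|right].
  have := bnd 1%N; rewrite h !expr1 => h1.
  by have := lt_le_trans (mulr_gt0 q0p rp) h1; rewrite mulr0 ltxx.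
pose t := r / d; have t1 : 1 < t by rewrite /t ltr_pdivlMr// mul1r.
have tb k : q 0%N * t ^+ k <= B.
  rewrite /t expr_div_n mulrA ler_pdivrMr ?exprn_gt0//.
have bern k : 1 + (t - 1) *+ k <= t ^+ k by apply/bernoulli_inequality/ltW.
(* The Archimedean property provides an exponent at which Bernoulli's lower bound for t^k,
   multiplied by q 0, exceeds B. *)
have e0 : 0 < (t - 1) * q 0%N / (B + 1).
  by rewrite divr_gt0// ?mulr_gt0 ?subr_gt0// ltr_wpDl.
have [k hk] := archi _ e0.
have B1 : 0 < B + 1 by rewrite ltr_wpDl.
move: hk; rewrite ltr_pdivlMr// mulrC ltr_pdivrMr ?ltr0n// => hk.
have := le_trans (ler_wpM2l (ltW q0p) (bern k.+1)) (tb k.+1).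
rewrite mulrDr mulr1 => h.
have : B + 1 < B.
  apply: lt_le_trans h; apply: lt_le_trans hk _.
  rewrite -[(t - 1) *+ _]mulr_natr mulrA [q 0%N * _]mulrC.
  by rewrite lerDr ltW.
by rewrite gtrDl ltr10.
Qed.

Section MultiPower.
Variables (n : nat) (T : Type) (S : 'I_n -> T -> T).

Definition opow (b : multinom n) (x : T) : T :=
  foldr (fun j y => iter (b j) (S j) y) x (enum 'I_n).

Hypothesis Scomm : forall j k x, S j (S k x) = S k (S j x).

Lemma iter_comm j p k q x : iter p (S j) (iter q (S k) x) = iter q (S k) (iter p (S j) x).
Proof.
have h m y : S j (iter m (S k) y) = iter m (S k) (S j y).
  by elim: m => //= m ih; rewrite Scomm ih.
by elim: p => //= p ih; rewrite ih h.
Qed.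

Lemma opow0 x : opow (@mnm0 n) x = x.
Proof.
by rewrite /opow; elim: (enum _) => //= j s ->; rewrite mpoly.mnm0E.
Qed.

Lemma opowD b b' x : opow (mnm_add b b') x = opow b (opow b' x).
Proof.
rewrite /opow; elim: (enum _) => //= j s ->; rewrite mpoly.mnmDE iterD; congr iter.
by elim: s (foldr _ x s) => //= k s ih y; rewrite iter_comm ih.
Qed.

Lemma opow1 j x : opow (mnm1 j) x = S j x.
Proof.
rewrite /opow; have : uniq (enum 'I_n) by exact: enum_uniq.
have : j \in enum 'I_n by rewrite mem_enum.
elim: (enum _) => //= k s ih; rewrite inE mpoly.mnm1E => /orP[/eqP <-|js] /andP[ks us].
  rewrite eqxx /=; congr (S j _); elim: s ks {ih us} => //= l s ih.
  by rewrite inE negb_or => /andP[/negPf jl /ih ->]; rewrite mpoly.mnm1E jl.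
have -> : (j == k) = false by apply: contraNF ks => /eqP <-.
exact: ih.
Qed.

Lemma opow_comm b j x : opow b (S j x) = S j (opow b x).
Proof. by rewrite -[S j x]opow1 -opowD mpoly.addmC opowD opow1. Qed.

Lemma opow_iter b j k x : opow b (iter k (S j) x) = iter k (S j) (opow b x).
Proof. by elim: k => //= k ih; rewrite opow_comm ih. Qed.

End MultiPower.

Lemma opow_linear n (C : pzRingType) (U : lmodType C) (S : 'I_n -> {linear U -> U}) b a x y :
  opow S b (a *: x + y) = a *: opow S b x + opow S b y.
Proof.
rewrite /opow; elim: (enum _) => //= j s ->.
by elim: (b j) => //= k ->; rewrite linearP.
Qed.

(** * Free modules and semi-inner products defined by Gram matrices *)

Section FreeMap.
Variables (C : nzRingType) (X : choiceType) (M : lmodType C) (g : X -> M).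

Lemma fglift_zmod : zmod_morphism (fglift g : {freeg X / C} -> M).
Proof. exact: lift_is_additive. Qed.

HB.instance Definition _ :=
  GRing.isZmodMorphism.Build {freeg X / C} M (fglift g) fglift_zmod.

Lemma fgliftE (u : {freeg X / C}) : fglift g u = \sum_(x <- dom u) coeff x u *: g x.
Proof.
by rewrite -{1}[u]freeg_sumE raddf_sum; apply: eq_bigr => x _; exact: liftU.
Qed.

Lemma fglift_scal : scalable (fglift g : {freeg X / C} -> M).
Proof.
move=> a u; rewrite [in RHS]fgliftE scaler_sumr.
rewrite [a *: u]/GRing.scale /= /fgscale raddf_sum.
by apply: eq_bigr => x _; rewrite scalerA; exact: liftU.
Qed.

HB.instance Definition _ :=
  GRing.isScalable.Build C {freeg X / C} M *:%R (fglift g) fglift_scal.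

End FreeMap.

Section FreeMapKeys.
Variables (C : numClosedFieldType) (X : choiceType).
Local Notation F := {freeg X / C}.
Implicit Types (u : F).

Definition fgmap (t : X -> X) : F -> F := fglift (fun x => << t x >>).
HB.instance Definition _ t := GRing.Linear.on (fgmap t).

Lemma fgmapU t x : fgmap t << x >> = << t x >>.
Proof. by rewrite /fgmap liftU scale1r. Qed.

Lemma fglift_map (M : lmodType C) (g : X -> M) t u :
  fglift g (fgmap t u) = fglift (g \o t) u.
Proof.
rewrite /fgmap [X in fglift g X]fgliftE raddf_sum [RHS]fgliftE; apply: eq_bigr => x _.
by rewrite [LHS]fglift_scal; congr (_ *: _); exact: etrans (liftU _ _ _) (scale1r _).
Qed.

Lemma fgmap_comp t t' u : fgmap t (fgmap t' u) = fgmap (t \o t') u.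
Proof.
rewrite [LHS]fglift_map /fgmap; congr fglift.
Qed.

End FreeMapKeys.

Section FreeSemidot.
Variables (C : numClosedFieldType) (X : choiceType) (G : X -> X -> C).
Local Notation F := {freeg X / C}.
Implicit Types (u v w : F).
Hypothesis GC : forall x y, G y x = (G x y)^*.
Hypothesis G_ge0 : forall (m : nat) (c : 'I_m -> C) (x : 'I_m -> X),
  0 <= \sum_i \sum_j c i * (c j)^* * G (x i) (x j).

(** A lift is linear in its argument; lifting the conjugated entries and conjugating the result
    makes the form conjugate-linear in v. *)
Definition fsdot u v : C :=
  fglift (fun x => (fglift (fun y => (G x y)^* : C^o) v)^* : C^o) u.

Lemma fsdotE u v : fsdot u v =
  \sum_(x <- dom u) \sum_(y <- dom v) coeff x u * (coeff y v)^* * G x y.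
Proof.
rewrite /fsdot fgliftE; apply: eq_bigr => x _.
rewrite fgliftE rmorph_sum scaler_sumr; apply: eq_bigr => y _.
by rewrite [_ *: (G x y)^*]/GRing.scale /= rmorphM /= conjCK [LHS]mulrA.
Qed.

Lemma fsdotPl a u v w : fsdot (a *: u + v) w = a * fsdot u w + fsdot v w.
Proof. by rewrite /fsdot linearP. Qed.

Lemma fsdotC u v : fsdot v u = (fsdot u v)^*.
Proof.
rewrite !fsdotE rmorph_sum exchange_big; apply: eq_bigr => x _.
rewrite rmorph_sum; apply: eq_bigr => y _.
by rewrite !rmorphM /= conjCK GC [(coeff x u)^* * _]mulrC.
Qed.

Lemma fsdot_ge0 u : 0 <= fsdot u u.
Proof.
rewrite fsdotE; set s := dom u.
have [x0|[x1 s1]] : s = [::] \/ exists x : X, x \in s.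
- by case: s => [|x s]; [left|right; exists x; rewrite mem_head].
- by rewrite x0 big_nil.
have := G_ge0 (fun i : 'I_(size s) => coeff (nth x1 s i) u) (fun i => nth x1 s i).
congr (_ <= _); rewrite (big_nth x1) big_mkord; apply: eq_bigr => i _.
by rewrite (big_nth x1) big_mkord.
Qed.

Definition free_semidot := Semidot fsdotPl fsdotC fsdot_ge0.

Lemma fsdotU x y : fsdot << x >> << y >> = G x y.
Proof. by rewrite /fsdot !liftU !scale1r conjCK. Qed.

Lemma fsdot_map t t' u v : (forall x y, G (t x) y = G x (t' y)) ->
  fsdot (fgmap t u) v = fsdot u (fgmap t' v).
Proof.
move=> h; rewrite /fsdot fglift_map; congr (fglift _ u).
by apply/funext => x /=; rewrite fglift_map; congr ((fglift _ v)^*);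
   apply/funext => y /=; rewrite h.
Qed.

End FreeSemidot.

Section HalmosBramOperators.
Variables (C : completeClosedField) (U : lmodType C) (g : semidot U).
Variables (n : nat) (S : 'I_n -> {linear U -> U}) (c : 'I_n -> C).
Hypothesis Scomm : forall j k x, S j (S k x) = S k (S j x).
Hypothesis c0 : forall j, 0 <= c j.
Hypothesis Sbnd : forall j x, snorm g (S j x) <= c j * snorm g x.
Hypothesis Spos : forall (m : nat) (h : 'I_m -> U) (b : 'I_m -> multinom n),
  0 <= \sum_i \sum_j g (opow S (b j) (h i)) (opow S (b i) (h j)).
Local Notation X := (U * multinom n)%type.

(* (x, b) stands for the vector N'^b x of the extension space, N' being the adjoint of the normal
   extension N; since N' and N commute, <N'^b x, N'^d y> = <S^d x, S^b y>. *)
Definition hb_gram (x y : X) : C := g (opow S y.2 x.1) (opow S x.2 y.1).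

Lemma hb_gramC x y : hb_gram y x = (hb_gram x y)^*.
Proof. exact: sdotC. Qed.

Lemma opowZ b a x : opow S b (a *: x) = a *: opow S b x.
Proof.
have := opow_linear S b a x 0; rewrite addr0 => ->.
have := opow_linear S b 1 0 0; rewrite scale1r addr0 => h.
suff -> : opow S b 0 = 0 by rewrite addr0.
by move: h; rewrite scale1r -{1}[opow _ _ _]addr0 => /addrI.
Qed.

Lemma hb_gram_ge0 (m : nat) (a : 'I_m -> C) (x : 'I_m -> X) :
  0 <= \sum_i \sum_j a i * (a j)^* * hb_gram (x i) (x j).
Proof.
have := Spos (fun i => a i *: (x i).1) (fun i => (x i).2).
congr (_ <= _); apply: eq_bigr => i _; apply: eq_bigr => j _.
by rewrite !opowZ sdotZl sdotZr mulrA.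
Qed.

Definition hb_dot : semidot {freeg X / C} := free_semidot hb_gramC hb_gram_ge0.

(** On N'^b x the normal extension acts by N_j N'^b x = N'^b (S_j x), and its adjoint raises b. The
    two maps change different components, hence commute: this is where normality comes from. *)
Definition hb_shift j (x : X) : X := (S j x.1, x.2).
Definition hb_adj j (x : X) : X := (x.1, mnm_add (mnm1 j) x.2).

Lemma hb_gram_shift j x y : hb_gram (hb_shift j x) y = hb_gram x (hb_adj j y).
Proof.
rewrite /hb_gram /= mpoly.addmC opowD//; congr (g _ _).
by rewrite opow1.
Qed.

Lemma hb_gram_adj j x y : hb_gram (hb_adj j x) y = hb_gram x (hb_shift j y).
Proof. by rewrite hb_gramC -hb_gram_shift -hb_gramC. Qed.

Local Notation T j := (fgmap (C := C) (hb_shift j)).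
Local Notation T' j := (fgmap (C := C) (hb_adj j)).

Lemma hb_dot_shift j u v : hb_dot (T j u) v = hb_dot u (T' j v).
Proof. exact: (fsdot_map _ _ (hb_gram_shift j)). Qed.

Lemma hb_dot_adj j u v : hb_dot (T' j u) v = hb_dot u (T j v).
Proof. exact: (fsdot_map _ _ (hb_gram_adj j)). Qed.

Lemma hb_shift_adj j k u : T j (T' k u) = T' k (T j u).
Proof. by rewrite !fgmap_comp. Qed.

Lemma hb_shift_iter j k u :
  iter k (T j) u = fgmap (fun x => (iter k (S j) x.1, x.2)) u.
Proof.
elim: k => [|k ih] /=.
  rewrite /fgmap (_ : (fun x : X => _) = (fun x => << x >>)).
    rewrite fgliftE -[LHS]freeg_sumE; apply: eq_bigr => x _.
    by apply/eqP/freeg_eqP => y; rewrite coeffZ !coeffU mul1r.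
  by apply/funext => -[].
by rewrite ih fgmap_comp.
Qed.

(** The constant B depends on u and is not compared with |u|^2. Only the rate of growth matters:
    [geometric_bound] converts it into the bound c_j for a single step. *)
Lemma hb_shift_growth j u : exists B, forall k,
  hb_dot (iter k (T j) u) (iter k (T j) u) <= B * (c j ^+ 2) ^+ k.
Proof.
exists (\sum_(x <- dom u) \sum_(y <- dom u) `|coeff x u| * `|coeff y u| *
  (snorm g (opow S y.2 x.1) * snorm g (opow S x.2 y.1))) => k.
have itb x : snorm g (iter k (S j) x) <= c j ^+ k * snorm g x.
  elim: k => [|k ih]; first by rewrite mul1r.
  rewrite iterS (le_trans (Sbnd _ _))// exprS -mulrA.
  by rewrite ler_wpM2l.
rewrite (le_trans (real_ler_norm (ger0_real (sdot_ge0 _ _))))//.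
rewrite hb_shift_iter /= /fsdot fglift_map fgliftE mulr_suml.
rewrite (le_trans (ler_norm_sum _ _ _))//; apply: ler_sum => x _.
rewrite [_ *: _]/GRing.scale /= normrM norm_conjC fglift_map fgliftE mulr_suml.
apply: le_trans (ler_wpM2l (normr_ge0 _) (ler_norm_sum _ _ _)) _.
rewrite mulr_sumr; apply: ler_sum => y _.
rewrite [_ *: _]/GRing.scale /= normrM norm_conjC !mulrA -!mulrA.
do 2! apply: ler_wpM2l => //.
rewrite /hb_gram /= (opow_iter Scomm) (opow_iter Scomm).
rewrite (le_trans (cauchy_schwarz _ _ _))//.
apply: le_trans (ler_pM (snorm_ge0 _ _) (snorm_ge0 _ _) (itb _) (itb _)) _.
rewrite -exprM mulnC exprM le_eqVlt; apply/orP; left; apply/eqP;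
   move: (c j ^+ k) => d; ring.
Qed.

Lemma hb_adj_norm j u : hb_dot (T' j u) (T' j u) = hb_dot (T j u) (T j u).
Proof. by rewrite hb_dot_adj hb_dot_shift hb_shift_adj. Qed.

Lemma hb_shift_bounded j u : snorm hb_dot (T j u) <= c j * snorm hb_dot u.
Proof.
have [B hB] := hb_shift_growth j u.
rewrite -(@ler_pXn2r _ 2)// ?nnegrE ?mulr_ge0 ?snorm_ge0//.
rewrite exprMn !snormE.
apply: (@geometric_bound C (fun k => hb_dot (iter k (T j) u) (iter k (T j) u)) B) => //.
- exact: ccf_archi.
- by move=> k; exact: sdot_ge0.
- by rewrite exprn_ge0.
move=> k; set w := iter k (T j) u.
have -> : iter k.+1 (T j) u = T j w by [].
have -> : iter k.+2 (T j) u = T j (T j w) by [].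
(* Log-convexity of |T^k u|^2: one has |T w|^2 = <w, T' T w>, and |T' T w| = |T T w| because T and
   T' commute. *)
have := cauchy_schwarz_sq hb_dot w (T' j (T j w)).
by rewrite hb_adj_norm -hb_dot_shift ger0_norm ?sdot_ge0.
Qed.

Lemma hb_adj_bounded j u : snorm hb_dot (T' j u) <= c j * snorm hb_dot u.
Proof. by rewrite /snorm hb_adj_norm; exact: hb_shift_bounded. Qed.

Definition hb_op j := completion_op (hb_dot_shift j) (c0 j) (hb_shift_bounded j).
Definition hb_op' j := completion_op (hb_dot_adj j) (c0 j) (hb_adj_bounded j).
HB.instance Definition _ j := GRing.Linear.on (hb_op j).
HB.instance Definition _ j := GRing.Linear.on (hb_op' j).

Definition hb_inj (x : U) : completion hb_dot := cembed hb_dot << (x, @mnm0 n) >>.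

Lemma hb_inj_linear : linear hb_inj.
Proof.
move=> a x y; apply: val_inj; apply/funext => u /=.
rewrite /fsdot !liftU !scale1r.
rewrite [in RHS]/GRing.scale /= /GRing.add /= /GRing.scale /=.
rewrite !liftU !scale1r !fgliftE !rmorph_sum mulr_sumr -big_split /=.
apply: eq_bigr => z _; rewrite /GRing.scale /= !rmorphM /= !conjCK.
by rewrite /hb_gram /= (opow_linear S) sdotPl; ring.
Qed.

HB.instance Definition _ := GRing.isLinear.Build C U _ _ hb_inj hb_inj_linear.

Lemma hb_inj_isometry x y : cdot (hb_inj x) (hb_inj y) = g x y.
Proof. by rewrite cdot_cembed [LHS]fsdotU /hb_gram /= !opow0. Qed.

Lemma hb_op_inj j x : hb_op j (hb_inj x) = hb_inj (S j x).
Proof. by rewrite [LHS]completion_op_cembed; congr (cembed _ _); exact: fgmapU. Qed.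

Lemma hb_op_comm j k X : hb_op j (hb_op k X) = hb_op k (hb_op j X).
Proof.
apply: val_inj; apply/funext => u /=; congr (cfun X _).
rewrite !fgmap_comp; congr (fgmap _ u).
by apply/funext => x; rewrite /= /hb_adj /= !mpoly.addmA [mnm_add (mnm1 k) _]mpoly.addmC.
Qed.

Lemma hb_op_normal j X : hb_op j (hb_op' j X) = hb_op' j (hb_op j X).
Proof. by apply: val_inj; apply/funext => u /=; rewrite hb_shift_adj. Qed.

Lemma halmos_bram_extension :
  exists (K : completeNormedModType C) (dot : {dot K for Num.conj})
    (V : {linear U -> K}) (N N' : 'I_n -> {linear K -> K}),
    [/\ (forall x, dot x x = `|x| ^+ 2) /\
        (forall x y, dot (V x) (V y) = g x y),
        forall j x, `|N j x| <= c j * `|x|,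
        (forall j x y, dot (N j x) y = dot x (N' j y)) /\
        (forall j x, N j (N' j x) = N' j (N j x)),
        forall j k x, N j (N k x) = N k (N j x)
      & forall j x, N j (V x) = V (S j x)].
Proof.
exists (completion hb_dot), (@cdot C _ hb_dot), hb_inj, hb_op, hb_op'.
split.
- by split; [exact: cdotxx|exact: hb_inj_isometry].
- by move=> j X; exact: completion_op_bounded.
- split; first by move=> j X Y; exact: completion_op_adjoint.
  exact: hb_op_normal.
- exact: hb_op_comm.
- exact: hb_op_inj.
Qed.

End HalmosBramOperators.

Section HilbertSemidot.
Variables (R : realType) (H : hilbert R).

Lemma hdotP a (u v w : H) : hdot H (a *: u + v) w = a * hdot H u w + hdot H v w.
Proof. by rewrite linearPl. Qed.

Lemma hdotC (u v : H) : hdot H v u = Num.conj (hdot H u v).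
Proof. by rewrite hermC expr0 mul1r. Qed.

Lemma hdot_ge0 (u : H) : 0 <= hdot H u u.
Proof. exact: dnorm_ge0. Qed.

Definition hilbert_semidot : @semidot (complexF R) H := @Semidot (complexF R) H _ hdotP hdotC hdot_ge0.

Lemma hilbert_snorm (x : H) : snorm hilbert_semidot x = `|x|.
Proof. by rewrite /snorm /= hdotxx sqrCK. Qed.

Lemma hilbert_definite (x : H) : hilbert_semidot x x = 0 -> x = 0.
Proof. by rewrite /= hdotxx => /eqP; rewrite sqrf_eq0 normr_eq0 => /eqP. Qed.

End HilbertSemidot.

Theorem halmos_bram (R : realType) (n : nat) (H : hilbert R) (S : 'I_n -> {linear H -> H}) :
  (forall j, bounded_operator (S j)) ->
  (forall j k x, S j (S k x) = S k (S j x)) ->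
  (forall (m : nat) (h : 'I_m -> H) (b : 'I_m -> multinom n),
     0 <= \sum_i \sum_j hdot H (opow S (b j) (h i)) (opow S (b i) (h j))) ->
  jointly_subnormal S.
Proof.
move=> Sb Sc Sp.
pose g := hilbert_semidot H.
have gn (x : H) : snorm g x = `|x| by exact: hilbert_snorm.
have /choice[c hc] : forall j, exists c : R[i], 0 <= c /\ forall x, snorm g (S j x) <= c * snorm g x.
  (* The bound c is forced to be nonnegative only if the space has a nonzero vector; its absolute
     value works in every case. *)
  move=> j; have [c hc] := Sb j; exists `|c|; split=> // x; rewrite !gn.
  have [->|x0] := eqVneq x 0; first by rewrite linear0 !normr0 mulr0.
  have c0 : 0 <= c.
    by have := le_trans (normr_ge0 _) (hc x); rewrite pmulr_lge0 ?normr_gt0.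
  by rewrite ger0_norm.
have c0 j := (hc j).1; have cb j := (hc j).2.
have := @halmos_bram_extension (complexF R) H g n S c Sc c0 cb Sp.
move=> [K [dot [V [N [N' [[dotxx Viso] Nb [Nadj Nnorm] Ncomm NV]]]]]].
exists (@Hilbert R K dot dotxx), V, N; split=> //.
move=> j; split; first by exists (c j).
by exists (N' j); split.
Qed.

(** * Moments and positivity of Gram matrices *)

Section Staircase.
Variable n : nat.
Implicit Types g b : multinom n.

Definition stair b : multinom n := staircase (@mnm0 n) b.

Lemma staircaseE g b : staircase g b = mnm_add g (stair b).
Proof. by rewrite /stair /staircase mpoly.add0m. Qed.

Lemma stairE b i : stair b i = (\sum_(j < n | j <= i) b j)%N.
Proof.
rewrite /stair /staircase mpoly.add0m mpoly.mnm_sumE [RHS]big_mkcond.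
apply: eq_bigr => j _; rewrite mpoly.mulmnE mpoly.mnm_sumE.
under eq_bigr do rewrite mpoly.mnm1E.
rewrite big_mkcond (bigD1 i)//= eqxx big1 => [|k /negPf ki].
  by case: ifP; rewrite /= addn0 ?mul1n ?mul0n.
by rewrite ki; case: ifP.
Qed.

Lemma stairD b b' : stair (mnm_add b b') = mnm_add (stair b) (stair b').
Proof.
apply/mpoly.mnmP => i; rewrite mpoly.mnmDE !stairE -big_split /=.
by apply: eq_bigr => j _; rewrite mpoly.mnmDE.
Qed.

Lemma stair0 : stair (@mnm0 n) = @mnm0 n.
Proof.
by apply/mpoly.mnmP => i; rewrite stairE mpoly.mnm0E big1// => j _; rewrite mpoly.mnm0E.
Qed.

Lemma staircase0 g : staircase g (@mnm0 n) = g.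
Proof. by rewrite staircaseE stair0 mpoly.addm0. Qed.

Lemma staircaseD g b b' : staircase (staircase g b) b' = staircase g (mnm_add b b').
Proof. by rewrite !staircaseE stairD mpoly.addmA. Qed.

End Staircase.

Section MomentFunctional.
Variables (R : comNzRingType) (n : nat).
Local Notation "'X_ l" := (@mpolyX n R (mnm1 l)) (at level 8, l at level 2).
Implicit Types (a : multinom n -> R) (p q : {mpoly R[n]}).

(** The Riesz functional of the sequence a, which sends X^b to a b. *)
Definition mfun a q : R := freeg.fglift (a : multinom n -> R^o) (mpoly.mpoly_val q).

Lemma mfun_zmod a : zmod_morphism (mfun a).
Proof. move=> p q; exact: (fglift_zmod (a : multinom n -> R^o)). Qed.
HB.instance Definition _ a := GRing.isZmodMorphism.Build {mpoly R[n]} R (mfun a) (mfun_zmod a).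

Lemma mfunZ a c q : mfun a (c *: q) = c * mfun a q.
Proof. by rewrite /mfun -[RHS]/(c *: (_ : R^o)) -linearZ. Qed.

Lemma mfunE a q : mfun a q = \sum_(b <- msupp q) mcoeff b q * a b.
Proof. exact: (fgliftE (a : multinom n -> R^o)). Qed.

Lemma mfunX a b : mfun a (mpolyX R b) = a b.
Proof. by rewrite mfunE mpoly.msuppX big_seq1 mpoly.mcoeffX eqxx mul1r. Qed.

Lemma mfun_shift a b q : mfun a (mpolyX R b * q) = mfun (fun d => a (mnm_add b d)) q.
Proof.
rewrite [q]mpoly.mpolyE mulr_sumr !raddf_sum; apply: eq_bigr => d _.
by rewrite -scalerAr -mpoly.mpolyXD [LHS]mfunZ [RHS]mfunZ !mfunX.
Qed.

End MomentFunctional.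

Section MomentsPositivity.
Variables (R : realType) (n : nat) (a : multinom n -> R).
Local Notation Xm b := (@mpolyX n R b).
Local Notation L g := (mfun (fun b => a (staircase g b))).
(** [0, cb g]^n is meant to contain the support of a measure with moments a (staircase g b); [Lpos]
    is all that is retained of this measure. *)
Variable cb : multinom n -> R.
Hypothesis cb0 : forall g, 0 <= cb g.
Hypothesis Lpos : forall g (q : {mpoly R[n]}),
  (forall t : 'I_n -> R, (forall j, 0 <= t j <= cb g) -> 0 <= meval t q) -> 0 <= L g q.

(** The only relation used between the functionals attached to different indices: going up by sigma
    d amounts to multiplying by t^d. *)
Lemma L_stair g d q : L (staircase g d) q = L g (Xm d * q).
Proof.
rewrite mfun_shift; congr (mfun _ q); apply/funext => b.
by rewrite staircaseD.
Qed.

Section Fixed.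
Variables (m : nat) (c : 'I_m -> R) (g b : 'I_m -> multinom n).

Definition gram_eq i j := staircase (g i) (b j) == staircase (g j) (b i).

(* i and j interact only if g_i - stair (b_i) = g_j - stair (b_j); this is an equivalence relation. *)
Lemma gram_eqE i j k : gram_eq i j -> gram_eq i k = gram_eq j k.
Proof.
have h x y : gram_eq x y = (mnm_add (g x) (stair (b y)) == mnm_add (g y) (stair (b x))).
  by rewrite /gram_eq !staircaseE.
rewrite !h => /eqP e.
have eq3 (s t : multinom n) : (s == t) = [forall l, s l == t l].
  apply/eqP/forallP => [-> l //|st]; apply/mpoly.mnmP => l; exact/eqP/st.
rewrite !eq3; apply: eq_forallb => l.
move/(congr1 (fun s : multinom n => s l)) : e; rewrite !mpoly.mnmDE.
by move=> e; apply/eqP/eqP; lia.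
Qed.

Lemma gram_eq_sym i j : gram_eq i j = gram_eq j i.
Proof. by rewrite /gram_eq eq_sym. Qed.

Lemma gram_eq_refl i : gram_eq i i.
Proof. exact: eqxx. Qed.

Variables (c0 : R) (D : nat).
Hypothesis c0_gt0 : 0 < c0.
Hypothesis c0_ge : forall i, cb (staircase (g i) (b i)) <= c0.
Hypothesis c0_ge' : forall i j l, cb (staircase (g j) (mnm_sub (b i) (mnm1 l))) <= c0.
Hypothesis D_ge : forall i l, (2 * b i l <= D)%N.

Definition ypoly l : {mpoly R[n]} := c0^-1 *: Xm (mnm1 l).
Definition rpoly k l : {mpoly R[n]} := \sum_(i < k) (1 - ypoly l) ^+ i.
(** With y = t_l / c0 in [0, 1], the base 1 - (1 - y)^k vanishes at y = 0 and tends to 1 for y > 0;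
    its quotient by y is [rpoly]. The power D supplies the divisibility by t_l^D. *)
Definition ppoly k l : {mpoly R[n]} := (1 - (1 - ypoly l) ^+ k) ^+ D.
(* A partition of unity on [0, c0]^n: as k grows, chi k J concentrates on {t | t_l = 0 iff l \in J}; it is
   divisible by t_l^D for l \notin J. *)
Definition chi k (J : {set 'I_n}) : {mpoly R[n]} :=
  \prod_l (if l \in J then 1 - ppoly k l else ppoly k l).

Lemma chi_sum k : \sum_(J : {set 'I_n}) chi k J = 1.
Proof.
rewrite -(@bigA_distr _ _ _ _ _ _ (fun l => 1 - ppoly k l) (ppoly k)).
by rewrite big1// => l _; exact: subrK.
Qed.

Lemma ppolyE k l : ppoly k l = (c0^-1) ^+ D *: (Xm (mnm1 l) ^+ D * rpoly k l ^+ D).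
Proof.
have -> : ppoly k l = (ypoly l * rpoly k l) ^+ D.
  congr (_ ^+ D); have := subrX1 (1 - ypoly l) k.
  rewrite -/(rpoly k l) => h.
  have -> : 1 - (1 - ypoly l) ^+ k = - ((1 - ypoly l) ^+ k - 1) by rewrite opprB.
  by rewrite h addrAC subrr add0r mulNr opprK.
by rewrite exprMn /ypoly exprZn -scalerAl.
Qed.

Section Eval.
Variable t : 'I_n -> R.
Hypothesis t0 : forall j, 0 <= t j <= c0.

Let yv l := t l / c0.

Lemma yv01 l : 0 <= yv l <= 1.
Proof.
by have /andP[h1 h2] := t0 l; rewrite /yv divr_ge0 ?(ltW c0_gt0)//= ler_pdivrMr// mul1r.
Qed.

Lemma meval_ypoly l : meval t (ypoly l) = yv l.
Proof. by rewrite mpoly.mevalZ mpoly.mevalXU mulrC. Qed.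

Lemma meval_ppoly k l : meval t (ppoly k l) = (1 - (1 - yv l) ^+ k) ^+ D.
Proof. by rewrite !(rmorphXn, rmorphB, rmorph1) /= meval_ypoly. Qed.

Lemma meval_ppoly01 k l : 0 <= meval t (ppoly k l) <= 1.
Proof.
have /andP[h1 h2] := yv01 l.
rewrite meval_ppoly; apply/andP; split.
  by rewrite exprn_ge0// subr_ge0 exprn_ile1 ?subr_ge0// gerBl.
rewrite exprn_ile1 ?subr_ge0 ?exprn_ile1 ?subr_ge0 ?gerBl//.
by rewrite exprn_ge0// subr_ge0.
Qed.

Lemma meval_rpoly_ge0 k l : 0 <= meval t (rpoly k l).
Proof.
have /andP[h1 h2] := yv01 l.
rewrite rmorph_sum sumr_ge0// => i _.
by rewrite !(rmorphXn, rmorphB, rmorph1) /= meval_ypoly exprn_ge0// subr_ge0.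
Qed.

Lemma meval_chi k J : meval t (chi k J) =
  \prod_l (if l \in J then 1 - meval t (ppoly k l) else meval t (ppoly k l)).
Proof.
rewrite rmorph_prod; apply: eq_bigr => l _.
by case: ifP => _ //; rewrite rmorphB rmorph1.
Qed.

Lemma meval_chi01 k J : 0 <= meval t (chi k J) <= 1.
Proof.
rewrite meval_chi; apply/andP; split.
  by apply: prodr_ge0 => l _; have /andP[? ?] := meval_ppoly01 k l; case: ifP; rewrite ?subr_ge0.
apply: prodr_ile1 => l _; have /andP[? ?] := meval_ppoly01 k l.
by case: ifP => _; rewrite ?subr_ge0 ?gerBl; apply/andP.
Qed.

(** Put y = t_l / c0 and z = (1 - y)^k. Then chi <= 1 - (1 - z)^D <= D z, while (k + 1) y z <= y (1
    + (1 - y) + ... + (1 - y)^k) = 1 - (1 - y)^(k+1) <= 1. *)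
Lemma meval_chi_small k (J : {set 'I_n}) l : l \in J ->
  t l * meval t (chi k J) <= c0 * D%:R / k.+1%:R.
Proof.
move=> lJ; have /andP[y0 y1] := yv01 l.
have /andP[tl0 tl1] := t0 l.
have h1 : meval t (chi k J) <= 1 - meval t (ppoly k l).
  rewrite meval_chi (bigD1 l)//= lJ ler_piMr//.
    by have /andP[? ?] := meval_ppoly01 k l; rewrite subr_ge0.
  apply: prodr_ile1 => l' _; have /andP[? ?] := meval_ppoly01 k l'.
  by case: ifP => _; rewrite ?subr_ge0 ?gerBl; apply/andP.
set z := (1 - yv l) ^+ k.
have z01 : 0 <= z <= 1 by rewrite exprn_ge0 ?exprn_ile1 ?subr_ge0 ?gerBl.
have /andP[z0 z1] := z01.
have h2 : 1 - meval t (ppoly k l) <= D%:R * z.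
  rewrite meval_ppoly -/z.
  have -> : 1 - (1 - z) ^+ D = - ((1 - z) ^+ D - 1) by rewrite opprB.
  rewrite subrX1 addrAC subrr add0r mulNr opprK mulrC ler_wpM2r//.
  rewrite -[D in leRHS]card_ord -sumr_const ler_sum// => i _.
  by rewrite exprn_ile1 ?subr_ge0 ?gerBl.
have h3 : yv l * z <= k.+1%:R^-1.
  rewrite -[leRHS]mul1r ler_pdivlMr ?ltr0n//.
  have e : 1 - (1 - yv l) ^+ k.+1 = yv l * \sum_(i < k.+1) (1 - yv l) ^+ i.
    have := subrX1 (1 - yv l) k.+1; rewrite addrAC subrr add0r mulNr => /(congr1 -%R).
    by rewrite opprB opprK.
  apply: le_trans (_ : 1 - (1 - yv l) ^+ k.+1 <= _); last first.
    by rewrite gerBl exprn_ge0 ?subr_ge0.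
  rewrite e -mulrA ler_wpM2l// mulr_natr -[k.+1 in leLHS]card_ord -sumr_const.
  apply: ler_sum => i _; rewrite /z ler_wiXn2l ?subr_ge0 ?gerBl//.
  by rewrite -ltnS.
have te : t l = c0 * yv l by rewrite /yv mulrC divfK ?gt_eqF.
apply: le_trans (ler_wpM2l tl0 (le_trans h1 h2)) _.
have -> : t l * (D%:R * z) = c0 * D%:R * (yv l * z).
  by rewrite te; move: (yv l) => y; ring.
by rewrite ler_wpM2l// mulr_ge0// ltW.
Qed.

End Eval.

Lemma Lpos' i0 q : cb i0 <= c0 ->
  (forall t : 'I_n -> R, (forall j, 0 <= t j <= c0) -> 0 <= meval t q) -> 0 <= L i0 q.
Proof.
move=> hc h; apply: Lpos => t ht; apply: h => j.
by have /andP[h1 h2] := ht j; rewrite h1 (le_trans h2).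
Qed.

Lemma L_one i0 : L i0 1 = a i0.
Proof. by rewrite -mpoly.mpolyX0 mfunX staircase0. Qed.

(** Since b_i contains eps_l, the index g_j + sigma b_i is sigma_l above a smaller nonnegative
    index. Moving down to it produces a factor t_l, and t_l chi is O(1/k) on the cube because l is
    in J. *)
Lemma chi_bad k (J : {set 'I_n}) i j l : l \in J -> b i l != 0%N -> gram_eq i j ->
  `|L (staircase (g i) (b j)) (chi k J)| <=
  c0 * D%:R / k.+1%:R * a (staircase (g j) (mnm_sub (b i) (mnm1 l))).
Proof.
move=> lJ bil /eqP ->.
set g' := staircase (g j) (mnm_sub (b i) (mnm1 l)).
have -> : staircase (g j) (b i) = staircase g' (mnm1 l).
  by rewrite staircaseD mpoly.submK// mpoly.lep1mP.
rewrite L_stair ger0_norm; last first.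
  apply: (Lpos' (c0_ge' i j l)) => t t0; rewrite rmorphM /= mpoly.mevalXU.
  by have /andP[? _] := t0 l; have /andP[? _] := meval_chi01 t0 k J; rewrite mulr_ge0.
rewrite -L_one -mfunZ -subr_ge0 -raddfB.
apply: (Lpos' (c0_ge' i j l)) => t t0; rewrite rmorphB rmorphM /= mpoly.mevalXU mpoly.mevalZ rmorph1.
by rewrite mulr1 subr_ge0 meval_chi_small.
Qed.

Definition gooddeg (J : {set 'I_n}) i := [forall l in J, b i l == 0%N].

Definition chi_quot k (J : {set 'I_n}) i0 : {mpoly R[n]} :=
  \prod_l (if l \in J then 1 - ppoly k l
           else (c0^-1) ^+ D *: (Xm (mnm1 l) ^+ (D - 2 * b i0 l) * rpoly k l ^+ D)).

Lemma chi_quotE k J i0 : gooddeg J i0 ->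
  chi k J = Xm (mnm_add (b i0) (b i0)) * chi_quot k J i0.
Proof.
move=> /forall_inP gd.
rewrite mpoly.mpolyXE_id -big_split /=; apply: eq_bigr => l _.
rewrite mpoly.mnmDE addnn -mul2n.
case: ifPn => lJ; first by rewrite (eqP (gd l lJ)) muln0 expr0 mul1r.
by rewrite ppolyE -{2}(subnKC (D_ge i0 l)) exprD -scalerAr mulrA.
Qed.

(** Here chi contains t^(2 b_i0). Pulling this factor into the index gives g_i + sigma b_j + 2 sigma
    b_i0 = g0 + sigma (b_i + b_j) with g0 = g_i0 + sigma b_i0 nonnegative, so the form is L_g0 of a
    square times a polynomial nonnegative on the cube. *)
Lemma chi_good k J i0 (P : pred 'I_m) : gooddeg J i0 ->
  (forall i, P i -> gram_eq i0 i) ->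
  0 <= \sum_(i | P i) \sum_(j | P j) c i * c j * L (staircase (g i) (b j)) (chi k J).
Proof.
move=> gd hP; set g0 := staircase (g i0) (b i0).
have e i j : P i -> P j -> L (staircase (g i) (b j)) (chi k J) =
    L g0 (Xm (mnm_add (b i) (b j)) * chi_quot k J i0).
  move=> /hP /eqP ii0 /hP jj0; rewrite (chi_quotE _ gd) -!L_stair.
  suff -> : staircase (staircase (g i) (b j)) (mnm_add (b i0) (b i0)) =
            staircase g0 (mnm_add (b i) (b j)) by [].
  apply/mpoly.mnmP => l.
  move/(congr1 (fun s : multinom n => s l)) : ii0.
  rewrite /g0 !staircaseE !stairD !mpoly.mnmDE; lia.
have -> : \sum_(i | P i) \sum_(j | P j) c i * c j * L (staircase (g i) (b j)) (chi k J)
   = L g0 ((\sum_(i | P i) c i *: Xm (b i)) ^+ 2 * chi_quot k J i0).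
  rewrite expr2 mulr_suml mulr_suml raddf_sum; apply: eq_bigr => i Pi.
  rewrite mulr_sumr mulr_suml raddf_sum; apply: eq_bigr => j Pj.
  have -> : c i *: Xm (b i) * (c j *: Xm (b j)) * chi_quot k J i0 =
    (c i * c j) *: (Xm (mnm_add (b i) (b j)) * chi_quot k J i0).
    by rewrite -scalerAl -scalerAr -!scalerAl scalerA mpoly.mpolyXD.
  by rewrite e// [RHS]mfunZ.
apply: (Lpos' (c0_ge i0)) => t t0; rewrite rmorphM rmorphXn mulr_ge0 ?sqr_ge0//.
rewrite rmorph_prod prodr_ge0// => l _; case: ifP => _.
  by have /andP[? ?] := meval_ppoly01 t0 k l; rewrite rmorphB rmorph1 subr_ge0.
have /andP[? _] := t0 l.
rewrite [X in 0 <= X]mpoly.mevalZ rmorphM !rmorphXn /= mpoly.mevalXU.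
rewrite mulr_ge0 ?exprn_ge0 ?invr_ge0 ?(ltW c0_gt0)//.
by rewrite mulr_ge0 ?exprn_ge0// meval_rpoly_ge0.
Qed.

(** Instead of choosing class representatives, one sums over all i0 with weight the inverse of the
    size of the class of i0; each related pair (i, j) is then counted with total weight 1. *)
Lemma gram_class_sum (P : pred 'I_m) (F : 'I_m -> 'I_m -> R) :
  (forall i0, P i0 -> 0 <= \sum_(i | P i && gram_eq i0 i) \sum_(j | P j && gram_eq i0 j) F i j) ->
  0 <= \sum_(i | P i) \sum_(j | P j) (gram_eq i j)%:R * F i j.
Proof.
move=> h; pose N i : R := #|[pred k | P k && gram_eq i k]|%:R.
have NE i j : gram_eq i j -> N i = N j.
  move=> ij; rewrite /N; congr (_%:R); apply: eq_card => k; rewrite !inE.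
  by rewrite (gram_eqE _ ij).
have N0 i : P i -> N i != 0.
  move=> Pi; rewrite /N pnatr_eq0 -lt0n; apply/card_gt0P; exists i.
  by rewrite inE Pi gram_eq_refl.
have -> : \sum_(i | P i) \sum_(j | P j) (gram_eq i j)%:R * F i j =
    \sum_(i0 | P i0) (N i0)^-1 *
      \sum_(i | P i && gram_eq i0 i) \sum_(j | P j && gram_eq i0 j) F i j.
  have inner i0 : \sum_(i | P i && gram_eq i0 i) \sum_(j | P j && gram_eq i0 j) F i j =
      \sum_(i | P i) \sum_(j | P j) (gram_eq i0 i)%:R * (gram_eq i0 j)%:R * F i j.
    rewrite big_mkcondr; apply: eq_bigr => i Pi; case: ifP => _; last first.
      by rewrite big1// => j _; rewrite !mul0r.
    rewrite big_mkcondr; apply: eq_bigr => j Pj.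
    by case: ifP; rewrite ?mul1r ?mul0r.
  under [RHS]eq_bigr => i0 _.
    rewrite inner mulr_sumr; under eq_bigr do rewrite mulr_sumr; over.
  rewrite [RHS]exchange_big; apply: eq_bigr => i Pi; rewrite [RHS]exchange_big; apply: eq_bigr => j Pj.
  under [RHS]eq_bigr do rewrite mulrA.
  rewrite -mulr_suml; congr (_ * _).
  case ij : (gram_eq i j); last first.
    rewrite big1// => i0 _; case i0i : (gram_eq i0 i); last by rewrite mul0r mulr0.
    by rewrite (gram_eqE _ i0i) ij mulr0 mulr0.
  transitivity (\sum_(i0 | P i0 && gram_eq i i0) (N i)^-1).
    by rewrite sumr_const -[RHS]mulr_natl; exact/esym/mulfV/N0.
  rewrite big_mkcondr; apply: eq_bigr => i0 Pi0.
  rewrite gram_eq_sym; case i0i : (gram_eq i0 i); last by rewrite mul0r mulr0.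
  by rewrite (gram_eqE _ i0i) ij !mulr1 (NE _ _ i0i).
apply: sumr_ge0 => i0 Pi0; rewrite mulr_ge0 ?h//.
by rewrite invr_ge0 ler0n.
Qed.

Hypothesis a0 : forall d, 0 <= a d.

(** Insert 1 = sum of the chi k J. For each J the pairs of good indices contribute a nonnegative
    amount, and every related pair with a bad index contributes O(1/k), uniformly because the data
    are finite. *)
Lemma gram_ge0_approx : exists B : R, forall k,
  - (B / k.+1%:R) <= \sum_i \sum_j c i * c j * (gram_eq i j)%:R * a (staircase (g i) (b j)).
Proof.
(* M majorizes the values of a produced by [chi_bad], whichever of the two indices is the bad
   one. *)
pose M i j := \sum_l (a (staircase (g j) (mnm_sub (b i) (mnm1 l))) +
                      a (staircase (g i) (mnm_sub (b j) (mnm1 l)))).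
have M0 i j l : a (staircase (g j) (mnm_sub (b i) (mnm1 l))) <= M i j.
  by rewrite /M (bigD1 l)//= -!addrA lerDl addr_ge0// sumr_ge0// => ? _; rewrite addr_ge0.
have MC i j : M i j = M j i by apply: eq_bigr => l _; rewrite addrC.
pose B1 := \sum_i \sum_j `|c i * c j| * (c0 * D%:R * M i j).
exists (#|{set 'I_n}|%:R * B1) => k.
have -> : \sum_i \sum_j c i * c j * (gram_eq i j)%:R * a (staircase (g i) (b j)) =
   \sum_(J : {set 'I_n}) \sum_i \sum_j
     (gram_eq i j)%:R * (c i * c j * L (staircase (g i) (b j)) (chi k J)).
  rewrite [RHS]exchange_big; apply: eq_bigr => i _.
  rewrite [RHS]exchange_big; apply: eq_bigr => j _.
  rewrite -!mulr_sumr -raddf_sum chi_sum.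
  by rewrite -[a _]L_one mulrAC mulrC.
rewrite -mulrA mulr_natl -mulNrn -sumr_const; apply: ler_sum => J _.
set F := fun i j => c i * c j * L (staircase (g i) (b j)) (chi k J).
have good : 0 <= \sum_(i | gooddeg J i) \sum_(j | gooddeg J j) (gram_eq i j)%:R * F i j.
  apply: gram_class_sum => i0 gd; by apply: (@chi_good k J i0) => // i /andP[].
rewrite -subr_ge0 opprK; apply: le_trans good _.
rewrite big_mkcond /B1 mulr_suml -big_split /=; apply: ler_sum => i _.
have bad j : ~~ (gooddeg J i && gooddeg J j) ->
    0 <= (gram_eq i j)%:R * F i j + `|c i * c j| * (c0 * D%:R * M i j) / k.+1%:R.
  move=> bd; case ij : (gram_eq i j); last first.
    rewrite mul0r add0r divr_ge0// mulr_ge0// mulr_ge0//.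
      by rewrite mulr_ge0// ltW.
    by rewrite sumr_ge0// => ? _; rewrite addr_ge0.
  rewrite mul1r -[F i j]opprK addrC subr_ge0.
  apply: le_trans (ler_norm _) _; rewrite normrN /F normrM -mulrA ler_wpM2l//.
  move: bd; rewrite negb_and => /orP[] /forall_inPn [l lJ bl].
    apply: le_trans (chi_bad k lJ bl ij) _.
    rewrite [leRHS]mulrAC ler_wpM2l// divr_ge0// mulr_ge0// ltW//.
  have := ij; rewrite /gram_eq => /eqP ->; rewrite gram_eq_sym in ij.
  apply: le_trans (chi_bad k lJ bl ij) _.
  by rewrite MC [leRHS]mulrAC ler_wpM2l// divr_ge0// mulr_ge0// ltW.
rewrite mulr_suml; case: ifP => gi; last first.
  rewrite -big_split /=; apply: sumr_ge0 => j _; apply: bad; by rewrite gi.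
rewrite big_mkcond -big_split; apply: ler_sum => j _; case: ifP => gj.
  rewrite lerDl divr_ge0// mulr_ge0// mulr_ge0//; first by rewrite mulr_ge0// ltW.
  by rewrite sumr_ge0// => ? _; rewrite addr_ge0.
by apply: bad; rewrite gi gj.
Qed.

End Fixed.

Lemma gram_ge0 (m : nat) (c : 'I_m -> R) (g b : 'I_m -> multinom n) :
  (forall d, 0 <= a d) ->
  0 <= \sum_i \sum_j c i * c j * (gram_eq g b i j)%:R * a (staircase (g i) (b j)).
Proof.
move=> a0.
pose e1 i := cb (staircase (g i) (b i)).
pose e2 (x : 'I_m * 'I_m * 'I_n) := cb (staircase (g x.1.2) (mnm_sub (b x.1.1) (mnm1 x.2))).
have s1 : 0 <= \sum_i e1 i by apply: sumr_ge0 => i _; exact: cb0.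
have s2 : 0 <= \sum_x e2 x by apply: sumr_ge0 => i _; exact: cb0.
have single (I : finType) (F : I -> R) i : (forall i, 0 <= F i) -> F i <= \sum_i F i.
  by move=> F0; rewrite (bigD1 i)//= lerDl sumr_ge0.
(* One cube for all the functionals involved: c0 dominates the finitely many sides that occur, and
   the summand 1 makes it positive. *)
pose c0 := 1 + \sum_i e1 i + \sum_x e2 x.
have h0 : 0 < c0 by rewrite /c0 -addrA ltr_pwDl// addr_ge0.
have h1 i : cb (staircase (g i) (b i)) <= c0.
  apply: le_trans (single _ e1 i _) _ => [x|]; first exact: cb0.
  by rewrite /c0 -addrA addrCA lerDl addr_ge0.
have h2 i j l : cb (staircase (g j) (mnm_sub (b i) (mnm1 l))) <= c0.
  apply: le_trans (single _ e2 (i, j, l) _) _ => [x|]; first exact: cb0.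
  by rewrite /c0 lerDr addr_ge0.
have h3 i l : (2 * b i l <= 2 * \sum_i \sum_l b i l)%N.
  by rewrite leq_mul2l/= (bigD1 i)//= (bigD1 l)//= -!addnA leq_addr.
have [B hB] := @gram_ge0_approx m c g b c0 _ h0 h1 h2 h3 a0.
rewrite leNgt; apply/negP; set T := \sum_i _ in hB * => T0.
have B0 : 0 < B.
  rewrite ltNge; apply/negP => Bn; have := hB 0%N; rewrite divr1 => h.
  by have := le_lt_trans h T0; rewrite oppr_lt0 => /lt_le_trans/(_ Bn); rewrite ltxx.
have /ltr_add_invr[k] : 0 < - T / B by rewrite divr_gt0// oppr_gt0.
rewrite add0r ltr_pdivlMr// => hk.
rewrite mulrC in hk.
by have := hB k; rewrite lerNl leNgt hk.
Qed.

End MomentsPositivity.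

(** * Fuglede's theorem *)

Section RootsOfUnity.
Variable C : numClosedFieldType.

Lemma prim_root_exists M : (0 < M)%N -> exists w : C, M.-primitive_root w.
Proof.
move=> M0; pose p : {poly C} := 'X^M - 1.
have [r Dp] := closed_field_poly_normal p.
move: Dp; rewrite (monicP _) ?monicXnsubC // scale1r => Dp.
have rn1 : all M.-unity_root r by apply/allP => z; rewrite -root_prod_XsubC -Dp.
have sz_r : (M < (size r).+1)%N.
  by rewrite -(size_prod_XsubC r id) -Dp size_XnsubC.
have [|z] := hasP (has_prim_root M0 rn1 _ sz_r); last by exists z.
rewrite -separable_prod_XsubC -Dp separable_Xn_sub_1 // pnatr_eq0 -lt0n//.
Qed.

Variables (M : nat) (w : C).
Hypothesis wM : M.-primitive_root w.

Lemma prim_root_norm k : `|w ^+ k| = 1.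
Proof.
rewrite normrX (_ : `|w| = 1) ?expr1n//.
have M0 := prim_order_gt0 wM.
apply: (@pexpIrn _ M) => //; rewrite ?nnegrE//.
by rewrite -normrX (prim_expr_order wM) normr1 expr1n.
Qed.

Lemma root_of_unity_sum a b :
  \sum_(s < M) (w ^+ s) ^+ a * ((w ^+ s)^* ) ^+ b =
  if a == b %[mod M] then M%:R else 0.
Proof.
have M0 := prim_order_gt0 wM.
have ww k : w ^+ k * (w ^+ k)^* = 1 by rewrite -normCK prim_root_norm expr1n.
pose v := w ^+ a * (w ^+ b)^*.
have -> : \sum_(s < M) (w ^+ s) ^+ a * ((w ^+ s)^* ) ^+ b = \sum_(s < M) v ^+ s.
  apply: eq_bigr => s _; rewrite /v exprMn -!rmorphXn -!exprM.
  by rewrite [(s * a)%N]mulnC [(s * b)%N]mulnC.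
have v1 : (v == 1) = (a == b %[mod M]).
  rewrite -(eq_prim_root_expr wM); apply/eqP/eqP => [h|].
    by rewrite -[LHS]mulr1 -(ww b) mulrCA -/v h mulr1.
  by rewrite /v => ->; exact: ww.
rewrite -v1; case: eqVneq => [->|v1'].
  by under eq_bigr do rewrite expr1n; rewrite sumr_const card_ord.
have : (v - 1) * \sum_(s < M) v ^+ s = 0.
  rewrite -subrX1 /v exprMn -rmorphXn -!exprM ![(_ * M)%N]mulnC !exprM.
  by rewrite (prim_expr_order wM) !expr1n rmorph1 mulr1 subrr.
by move/eqP; rewrite mulf_eq0 subr_eq0 (negPf v1') => /eqP.
Qed.

(** Averaging p(r w^s) times the conjugate of w^s over s extracts r p_1 exactly: since p has at most
    M coefficients, no other exponent is congruent to 1 modulo M. *)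
Lemma cauchy_estimate (p : {poly C}) (r B : C) : (1 < M)%N -> (size p <= M)%N ->
  0 <= r -> (forall z, `|z| = r -> `|p.[z]| <= B) -> `|p`_1| * r <= B.
Proof.
move=> M1 pM r0 hB.
have M0 : 0 < M%:R :> C by rewrite ltr0n ltnW.
have e : \sum_(s < M) p.[r * w ^+ s] * (w ^+ s)^* = M%:R * (p`_1 * r).
  under eq_bigr do rewrite (horner_coef_wide _ pM) mulr_suml.
  rewrite exchange_big /= (bigD1 (Ordinal M1))//= [X in _ + X]big1 => [|i i1].
    under eq_bigr do rewrite expr1 -mulrA -mulrA.
    rewrite -!mulr_sumr.
    have := root_of_unity_sum 1 1; rewrite eqxx; under eq_bigr do rewrite !expr1.
    by move=> ->; rewrite addr0; ring.
  under eq_bigr do rewrite exprMn -!mulrA.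
  rewrite -!mulr_sumr.
  have := root_of_unity_sum i 1; under eq_bigr do rewrite !expr1.
  move=> ->; case: ifP; rewrite ?mulr0// !modn_small// => /eqP i1'.
  by move: i1; rewrite -val_eqE /= i1'.
rewrite -(ler_pM2l M0) -[X in X * (_ * _)]ger0_norm ?ler0n// -[X in _ * (_ * X)]ger0_norm//.
rewrite -!normrM -e (le_trans (ler_norm_sum _ _ _))//.
rewrite mulr_natl -[M in leRHS]card_ord -sumr_const; apply: ler_sum => s _.
by rewrite normrM norm_conjC prim_root_norm mulr1 hB// normrM prim_root_norm mulr1 ger0_norm.
Qed.

End RootsOfUnity.

Lemma iterC (T : Type) (F G : T -> T) p q x : (forall y, F (G y) = G (F y)) ->
  iter p F (iter q G x) = iter q G (iter p F x).
Proof.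
move=> h; have h1 m y : F (iter m G y) = iter m G (F y).
  by elim: m => //= m ih; rewrite h ih.
by elim: p => //= p ih; rewrite ih h1.
Qed.

Lemma iter_compC (T : Type) (F G : T -> T) k x : (forall y, F (G y) = G (F y)) ->
  iter k F (iter k G x) = iter k (F \o G) x.
Proof.
move=> h; elim: k => //= k <-; congr F.
exact: (iterC k 1 _ h).
Qed.

Section Fuglede.
Variables (C : completeClosedField) (U : lmodType C) (g : semidot U).
Variables (N N' T : {linear U -> U}) (c d : C).
Hypothesis adjN : forall u v, g (N u) v = g u (N' v).
Hypothesis normN : forall u, N (N' u) = N' (N u).
Hypothesis commT : forall u, T (N u) = N (T u).
Hypothesis (c0 : 0 <= c) (d0 : 0 <= d).
Hypothesis bndN : forall u, snorm g (N u) <= c * snorm g u.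
Hypothesis bndT : forall u, snorm g (T u) <= d * snorm g u.

Let adjN' u v : g (N' u) v = g u (N v).
Proof. by rewrite sdotC -adjN -sdotC. Qed.

Let bndN' u : snorm g (N' u) <= c * snorm g u.
Proof.
suff -> : snorm g (N' u) = snorm g (N u) by [].
by rewrite /snorm adjN' adjN normN.
Qed.

Definition oneP (A : U -> U) (w : C) u := u + w *: A u.

Lemma oneP_comm (A B : {linear U -> U}) w v u : (forall x, A (B x) = B (A x)) ->
  oneP A w (oneP B v u) = oneP B v (oneP A w u).
Proof.
move=> h; rewrite /oneP (linearD A) (linearD B) (linearZ_LR A) (linearZ_LR B) /= h.
rewrite !scalerDr !scalerA [v * w]mulrC.
by rewrite !addrA; congr (_ + _); rewrite addrAC.
Qed.

Lemma iter_bnd (A : U -> U) b k u : 0 <= b ->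
  (forall u, snorm g (A u) <= b * snorm g u) -> snorm g (iter k A u) <= b ^+ k * snorm g u.
Proof.
move=> b0 h; elim: k => [|k ih]; first by rewrite mul1r.
by rewrite iterS (le_trans (h _))// exprS -mulrA ler_wpM2l.
Qed.

Lemma oneP_bnd (A : U -> U) w b : (forall u, snorm g (A u) <= b * snorm g u) ->
  forall u, snorm g (oneP A w u) <= (1 + `|w| * b) * snorm g u.
Proof.
move=> h u; rewrite (le_trans (snormD _ _ _))// mulrDl mul1r lerD2l snormZ.
by rewrite -mulrA ler_wpM2l.
Qed.

Lemma oneP_binomial (A : {linear U -> U}) w k u :
  iter k (oneP A w) u = \sum_(i < k.+1) ('C(k, i)%:R * w ^+ i) *: iter i A u.
Proof.
elim: k => [|k ih].
  by rewrite big_ord_recl big_ord0 /= expr0 mulr1 scale1r addr0.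
rewrite iterS ih /oneP linear_sum scaler_sumr.
rewrite [in RHS]big_ord_recl /= bin0 expr0 mulr1 scale1r.
under [X in _ = _ + X]eq_bigr do rewrite /bump /= add1n binS natrD mulrDl scalerDl.
rewrite big_split /= addrA; congr (_ + _).
  rewrite big_ord_recl /= bin0 expr0 mulr1 scale1r; congr (_ + _).
  rewrite [RHS]big_ord_recr /= bin_small// mul0r scale0r addr0.
  by apply: eq_bigr => i _; rewrite /bump /= add1n.
apply: eq_bigr => i _; rewrite linearZ /= scalerA.
by rewrite exprS; congr (_ *: _); ring.
Qed.

Lemma oneP_pow_sub1 (A : {linear U -> U}) w b k u : 0 <= b ->
  (forall u, snorm g (A u) <= b * snorm g u) ->
  snorm g (iter k (oneP A w) u - u) <= ((1 + `|w| * b) ^+ k - 1) * snorm g u.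
Proof.
move=> b0 h; have wb : 0 <= 1 + `|w| * b by rewrite addr_ge0// mulr_ge0.
elim: k => [|k ih]; first by rewrite subrr snorm0 expr0 subrr mul0r.
rewrite iterS {1}/oneP addrAC (le_trans (snormD _ _ _))//.
have -> : ((1 + `|w| * b) ^+ k.+1 - 1) * snorm g u =
  ((1 + `|w| * b) ^+ k - 1) * snorm g u + `|w| * (b * ((1 + `|w| * b) ^+ k * snorm g u)).
  by rewrite exprS; ring.
rewrite lerD// snormZ ler_wpM2l// (le_trans (h _))// ler_wpM2l//.
by apply: iter_bnd => //; exact: oneP_bnd.
Qed.

(** The two bounds feed each other: as long as (1 + e)^k <= 2, a further factor adds at most 2 e. *)
Lemma inv_bernoulli (e : C) k : 0 <= e -> k%:R * e <= 2^-1 ->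
  (1 + e) ^+ k <= 2 /\ (1 + e) ^+ k - 1 <= 2 * (k%:R * e).
Proof.
move=> e0; elim: k => [|k ih] he.
  by rewrite expr0 subrr mul0r mulr0 lexx ler1n.
have /ih [h1 h2] : k%:R * e <= 2^-1.
  by apply: le_trans he; rewrite ler_wpM2r// ler_nat.
have h : (1 + e) ^+ k.+1 - 1 <= 2 * (k.+1%:R * e).
  have -> : (1 + e) ^+ k.+1 - 1 = ((1 + e) ^+ k - 1) + e * (1 + e) ^+ k by rewrite exprS; ring.
  apply: le_trans (lerD h2 (ler_wpM2l e0 h1)) _.
  rewrite -[k.+1]addn1 natrD.
  by rewrite le_eqVlt; apply/orP; left; apply/eqP; move: (k%:R) => x; ring.
split=> //; rewrite -[_ ^+ _](subrK 1) -[leRHS]/(1 + 1) lerD2r (le_trans h)//.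
by rewrite -ler_pdivlMl// mulr1.
Qed.

Section Approx.
Variables (k : nat) (z : C) (m : nat).
Let w := z / (k.+1)%:R.
Let e := `|w| ^+ 2 * c ^+ 2.

Let P := oneP N' w.
Let Pm := oneP N' (- w).
Let Q := oneP N (- w^*).
Let Q' := oneP N w^*.

(* A polynomial substitute for exp(z N') T exp(- z N'), with exp(a) replaced by (1 + a / (k + 1))^(k + 1):
   bounded uniformly in z as k grows, with z-coefficient of order one given by N' T - T N'. *)
Definition fuglede_fun x y := g (iter k.+1 P (T (iter k.+1 Pm x))) y.

Let E := oneP (N \o N) (- (w^* ^+ 2)).

Let QQ' u : Q (Q' u) = E u.
Proof.
rewrite /Q /Q' /E /oneP /= linearD linearZ /= !scalerDr !scalerA.
rewrite -!addrA; congr (_ + _); rewrite addrA scaleNr subrr add0r.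
by rewrite mulNr expr2.
Qed.

Let E_bnd u : snorm g (E u) <= (1 + e) * snorm g u.
Proof.
have := @oneP_bnd (N \o N) (- (w^* ^+ 2)) (c ^+ 2) _ u.
rewrite normrN normrX norm_conjC; apply=> v /=.
by rewrite (le_trans (bndN _))// expr2 -mulrA ler_wpM2l.
Qed.

(** P Q stands for the unitary operator exp((z N' - z^* N) / (k + 1)). The adjoints of P, Q, Q' are
    Q', Pm, P, and all four factors commute, so P Q has the same seminorms as Q Q' = E = 1 - w^*^2
    N^2, which differs from the identity only by O(1/k^2). *)
Let PQ_snorm u : snorm g (P (Q u)) = snorm g (E u).
Proof.
rewrite /snorm -QQ'.
have aP a b : g (P a) b = g a (Q' b).
  by rewrite /P /Q' /oneP sdotDl sdotDr sdotZl sdotZr conjCK adjN'.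
have aQ a b : g (Q a) b = g a (Pm b).
  by rewrite /Q /Pm /oneP sdotDl sdotDr sdotZl sdotZr adjN rmorphN.
have aQ' a b : g (Q' a) b = g a (P b).
  by rewrite /Q' /P /oneP sdotDl sdotDr sdotZl sdotZr adjN.
rewrite aP aQ [in RHS]aQ [in RHS]aQ'; congr (sqrtC (g u _)).
have cPP x : N' (N' x) = N' (N' x) by [].
have cQQ x : N (N x) = N (N x) by [].
rewrite /P /Pm /Q /Q'.
rewrite (oneP_comm (A := N) (B := N') _ _ _ normN).
rewrite (oneP_comm (A := N') (B := N') _ _ _ cPP).
by congr (oneP _ _ (oneP _ _ _)); rewrite (oneP_comm (A := N) (B := N) _ _ _ cQQ).
Qed.

Let QPm_snorm u : snorm g (Q' (Pm u)) = snorm g (E u).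
Proof.
rewrite /snorm -QQ'.
have aQ a b : g (Q a) b = g a (Pm b).
  by rewrite /Q /Pm /oneP sdotDl sdotDr sdotZl sdotZr adjN rmorphN.
have aPm a b : g (Pm a) b = g a (Q b).
  by rewrite /Q /Pm /oneP sdotDl sdotDr sdotZl sdotZr adjN' rmorphN /= conjCK.
have aQ' a b : g (Q' a) b = g a (P b).
  by rewrite /Q' /P /oneP sdotDl sdotDr sdotZl sdotZr adjN.
rewrite aQ' aPm [in RHS]aQ [in RHS]aQ'; congr (sqrtC (g u _)).
have cNN' x : N' (N x) = N (N' x) by [].
have cPP x : N' (N' x) = N' (N' x) by [].
rewrite /P /Pm /Q /Q'.
rewrite (oneP_comm (A := N) (B := N') _ _ _ normN); congr oneP.
rewrite (oneP_comm (A := N) (B := N') _ _ _ normN) //.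
by rewrite (oneP_comm (A := N) (B := N') _ _ _ normN).
Qed.

(** T commutes with N, hence with Q'. Therefore P^(k+1) E^(k+1) T Pm^(k+1) equals (P Q)^(k+1) T (Q'
    Pm)^(k+1), of norm at most 2 d 2 since the outer factors are nearly unitary. Dropping E^(k+1)
    costs 2 (k + 1) e times the crude bound 2^m for each of P^(k+1) and Pm^(k+1); m depends on z but
    not on k. *)
Lemma fuglede_fun_bound x y : k.+1%:R * e <= 2^-1 -> (0 < m)%N -> (m %| k.+1)%N ->
  `|z| * c / m%:R <= 2^-1 ->
  `|fuglede_fun x y| <=
    (4 + 4 ^+ m * (2 * (k.+1%:R * e))) * d * snorm g x * snorm g y.
Proof.
move=> ke m0 mk zm.
have e0 : 0 <= e by rewrite mulr_ge0 ?exprn_ge0.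
have [b1 b2] := inv_bernoulli e0 ke.
pose v := iter k.+1 Pm x.
have eq1 : iter k.+1 P (iter k.+1 E (T v)) =
    iter k.+1 (P \o Q) (T (iter k.+1 (Q' \o Pm) x)).
  rewrite -(iter_compC (F := Q') (G := Pm)); last by move=> u; exact: oneP_comm.
  have TQ' j u : T (iter j Q' u) = iter j Q' (T u).
    elim: j => //= j ih; rewrite {1}/Q' /oneP linearD linearZ /= commT ih.
    by [].
  rewrite TQ' -(iter_compC (F := P) (G := Q)); last first.
    by move=> u; apply: oneP_comm.
  congr (iter _ P _); rewrite (iter_compC (F := Q) (G := Q')); last first.
    by move=> u; apply: oneP_comm.
  by apply: eq_iter => u; rewrite /= QQ'.
have n1 : snorm g (iter k.+1 P (iter k.+1 E (T v))) <= 4 * d * snorm g x.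
  rewrite eq1.
  have h1 u : snorm g (iter k.+1 (P \o Q) u) <= 2 * snorm g u.
    apply: le_trans (iter_bnd k.+1 u (b := 1 + e) _ _) _ => //.
    - by rewrite addr_ge0.
    - by move=> a /=; rewrite PQ_snorm.
    - by rewrite ler_wpM2r ?snorm_ge0.
  have h2 u : snorm g (iter k.+1 (Q' \o Pm) u) <= 2 * snorm g u.
    apply: le_trans (iter_bnd k.+1 u (b := 1 + e) _ _) _ => //.
    - by rewrite addr_ge0.
    - by move=> a /=; rewrite QPm_snorm.
    - by rewrite ler_wpM2r ?snorm_ge0.
  apply: le_trans (h1 _) _.
  apply: le_trans (ler_wpM2l (ler0n _ 2) (bndT _)) _.
  apply: le_trans (ler_wpM2l (ler0n _ 2) (ler_wpM2l d0 (h2 _))) _.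
  by rewrite le_eqVlt; apply/orP; left; apply/eqP; ring.
pose r := 1 + `|w| * c.
have r0 : 0 <= r by rewrite addr_ge0// mulr_ge0.
(* The k + 1 factors are grouped into m blocks, each of product at most 2 by [inv_bernoulli]. *)
have rm : r ^+ k.+1 <= 2 ^+ m.
  rewrite -(divnK mk) exprM ler_pXn2r ?nnegrE ?exprn_ge0//.
  apply: (proj1 (@inv_bernoulli (`|w| * c) _ _ _)); first by rewrite mulr_ge0.
  apply: le_trans zm.
  have mn0 : m%:R != 0 :> C by rewrite pnatr_eq0 -lt0n.
  rewrite /w normrM normfV normr_nat -[in X in _ / X](divnK mk) natrM invfM.
  have q0 : (k.+1 %/ m)%:R != 0 :> C.
    by rewrite pnatr_eq0 -lt0n divn_gt0// dvdn_leq.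
  rewrite le_eqVlt; apply/orP; left; apply/eqP.
  by field; rewrite mn0 q0.
have hP u : snorm g (iter k.+1 P u) <= 2 ^+ m * snorm g u.
  apply: le_trans (iter_bnd k.+1 u (b := r) r0 _) _; last by rewrite ler_wpM2r ?snorm_ge0.
  exact: oneP_bnd.
have hPm u : snorm g (iter k.+1 Pm u) <= 2 ^+ m * snorm g u.
  apply: le_trans (iter_bnd k.+1 u (b := r) r0 _) _; last by rewrite ler_wpM2r ?snorm_ge0.
  by have := oneP_bnd (- w) bndN'; rewrite normrN.
have linP j u u' : iter j P (u - u') = iter j P u - iter j P u'.
  elim: j => //= j ->; rewrite /P /oneP linearB scalerBr opprD addrACA //.
have n2 : snorm g (iter k.+1 P (T v) - iter k.+1 P (iter k.+1 E (T v))) <=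
    4 ^+ m * (2 * (k.+1%:R * e)) * d * snorm g x.
  rewrite -linP (le_trans (hP _))// snormBC.
  have hE : snorm g (iter k.+1 E (T v) - T v) <= (2 * (k.+1%:R * e)) * snorm g (T v).
    have hNN : forall u, snorm g ((N \o N) u) <= c ^+ 2 * snorm g u.
      by move=> u /=; rewrite (le_trans (bndN _))// expr2 -mulrA ler_wpM2l.
    have := @oneP_pow_sub1 (N \o N) (- (w^* ^+ 2)) (c ^+ 2) k.+1 (T v) (exprn_ge0 _ c0) hNN.
    rewrite normrN normrX norm_conjC -/e => /le_trans; apply.
    by rewrite ler_wpM2r ?snorm_ge0.
  have hT : snorm g (T v) <= d * (2 ^+ m * snorm g x).
    by rewrite (le_trans (bndT _))// ler_wpM2l// hPm.
  have ke0 : 0 <= 2 * (k.+1%:R * e) by rewrite !mulr_ge0.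
  apply: le_trans (ler_wpM2l (exprn_ge0 _ (ler0n _ 2)) (le_trans hE (ler_wpM2l ke0 hT))) _.
  have -> : (4 : C) = 2 * 2 by rewrite -natrM.
  rewrite exprMn le_eqVlt; apply/orP; left; apply/eqP.
  by move: (2 ^+ m) (k.+1%:R * e) => a b; ring.
rewrite /fuglede_fun -/v (le_trans (cauchy_schwarz _ _ _))// ler_wpM2r ?snorm_ge0//.
rewrite -[iter _ P (T v)](subrK (iter k.+1 P (iter k.+1 E (T v)))).
rewrite (le_trans (snormD _ _ _))// addrC 2!mulrDl lerD//.
Qed.

End Approx.

Definition fuglede_poly k x y : {poly C} :=
  \sum_(i < k.+2) \sum_(j < k.+2)
    ('C(k.+1, i)%:R * (k.+1%:R^-1) ^+ i * ('C(k.+1, j)%:R * (- k.+1%:R^-1) ^+ j) *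
     g (iter i N' (T (iter j N' x))) y) *: 'X^(i + j).

Lemma fuglede_polyE k x y z : (fuglede_poly k x y).[z] = fuglede_fun k z x y.
Proof.
rewrite /fuglede_fun [in RHS]oneP_binomial sdot_suml horner_sum.
apply: eq_bigr => i _; rewrite horner_sum sdotZl.
rewrite [in RHS]oneP_binomial linear_sum.
have itsum (I : finType) (F : I -> U) j : iter j N' (\sum_i F i) = \sum_i iter j N' (F i).
  by elim: j => //= j ->; rewrite linear_sum.
have itZ a u j : iter j N' (a *: u) = a *: iter j N' u.
  by elim: j => //= j ->; rewrite linearZ.
rewrite itsum sdot_suml mulr_sumr; apply: eq_bigr => j _.
rewrite hornerZ hornerXn linearZ itZ sdotZl exprD.
rewrite ![(_ * _^-1) ^+ _]exprMn -mulrN exprMn.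
by move: (g _ _) => G; ring.
Qed.

Lemma fuglede_poly_coef1 k x y :
  (fuglede_poly k x y)`_1 = g (N' (T x)) y - g (T (N' x)) y.
Proof.
have coef (K : nat -> nat -> C) :
    \sum_(i < k.+2) \sum_(j < k.+2) K i j * (1 == (i + j)%N)%:R = K 0%N 1%N + K 1%N 0%N.
  rewrite big_ord_recl big_ord_recl /= [X in _ + (_ + X)]big1 => [|i _]; last first.
    by rewrite big1// => j _; rewrite /bump /= mulr0.
  rewrite [X in X + _]big_ord_recl [X in _ + X + _]big_ord_recl /=.
  rewrite [X in _ + (_ + X) + _]big1 => [|i _]; last by rewrite /bump /= mulr0.
  rewrite [X in _ + (X + _)]big_ord_recl /= [X in _ + (_ + X + _)]big1 => [|i _]; last first.
    by rewrite /bump /= mulr0.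
  by rewrite /bump /= mulr0 !mulr1 !add0r !addr0.
rewrite coef_sum; under eq_bigr => i _.
  rewrite coef_sum; under eq_bigr do rewrite coefZ coefXn; over.
rewrite (coef (fun i j => 'C(k.+1, i)%:R * (k.+1%:R^-1) ^+ i *
   ('C(k.+1, j)%:R * (- k.+1%:R^-1) ^+ j) * g (iter i N' (T (iter j N' x))) y)).
have kn : k.+1%:R != 0 :> C by rewrite pnatr_eq0.
rewrite !bin0 !bin1 !expr0 !expr1 /= mulrN !divff//.
by rewrite !mul1r !mulN1r addrC.
Qed.

Lemma fuglede_bound x y (r : C) : 0 < r ->
  `|g (N' (T x)) y - g (T (N' x)) y| * r <= 5 * d * snorm g x * snorm g y.
Proof.
move=> r0; set B := d * snorm g x * snorm g y.
have B0 : 0 <= B by rewrite !mulr_ge0 ?snorm_ge0.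
pose c1 := c + 1; have c10 : 0 < c1 by rewrite ltr_wpDl.
have cc1 : c <= c1 by rewrite lerDl.
have rc0 : 0 < r * c1 by rewrite mulr_gt0.
have i20 : 0 < 2^-1 :> C by rewrite invr_gt0.
have [m' hm'] := @ccf_archi C _ (divr_gt0 i20 rc0).
(* With (k + 1) e <= dl the error term 4^m * (2 * dl) is at most 1, which gives the constant 5 = 4 +
   1. Then k + 1 is taken as a large multiple of m; c1 replaces c to permit division. *)
pose m := m'.+1; pose dl : C := (2 * 4 ^+ m)^-1.
have dl0 : 0 < dl by rewrite invr_gt0 mulr_gt0// exprn_gt0.
have rc20 : 0 < (r * c1) ^+ 2 by rewrite exprn_gt0.
have [q hq] := @ccf_archi C _ (divr_gt0 dl0 rc20).
pose k := (m * q.+1).-1; have kE : k.+1 = (m * q.+1)%N by rewrite /k prednK// muln_gt0.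
have kpos : 0 < k.+1%:R :> C by rewrite ltr0n.
have hk : k.+1%:R * ((r / k.+1%:R) ^+ 2 * c ^+ 2) <= dl.
  apply: le_trans (_ : (r * c1) ^+ 2 / q.+1%:R <= _).
    have -> : k.+1%:R * ((r / k.+1%:R) ^+ 2 * c ^+ 2) = (r * c) ^+ 2 / k.+1%:R.
      by field; rewrite gt_eqF.
    rewrite ler_pM// ?invr_ge0 ?exprn_ge0 ?mulr_ge0 ?(ltW r0)//.
      by rewrite ler_pXn2r ?nnegrE ?mulr_ge0 ?(ltW r0) ?(ltW c10)// ler_pM2l.
    by rewrite lef_pV2 ?posrE ?ltr0n// ler_nat kE leq_pmull.
  by rewrite mulrC -ler_pdivlMr// ltW.
have dl2 : dl <= 2^-1.
  rewrite /dl lef_pV2 ?posrE ?mulr_gt0 ?exprn_gt0// -[leLHS]mulr1 ler_pM2l//.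
  by rewrite exprn_ege1// ler1n.
(* The polynomial has degree at most 2 (k + 1), so this order excludes aliasing in the Cauchy
   estimate. *)
have [w wM] := @prim_root_exists C (2 * k.+1).+2 (ltn0Sn _).
rewrite -(fuglede_poly_coef1 k).
apply: (cauchy_estimate wM) => //.
- apply: leq_trans (size_sum _ _ _) _; apply/bigmax_leqP => i _.
  apply: leq_trans (size_sum _ _ _) _; apply/bigmax_leqP => j _.
  apply: leq_trans (size_scale_leq _ _) _; rewrite size_polyXn.
  by rewrite ltnS (leq_trans (leq_add (leq_ord i) (leq_ord j)))// addnn -mul2n leqnSn.
- exact: ltW.
move=> z zr; rewrite fuglede_polyE.
have zw : `|z / k.+1%:R| = r / k.+1%:R by rewrite normrM normfV zr normr_nat.
apply: le_trans (@fuglede_fun_bound k z m x y _ _ _ _) _ => //.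
- by rewrite zw (le_trans hk).
- by rewrite kE dvdn_mulr.
- rewrite zr; apply: le_trans (_ : r * c1 / m%:R <= _).
    by rewrite ler_pM2r ?invr_gt0 ?ltr0n// ler_pM2l.
  by rewrite mulrC -ler_pdivlMr// ltW.
rewrite !ler_wpM2r ?snorm_ge0// zw.
have -> : (5 : C) = 4 + 1 by rewrite -[RHS](natrD _ 4 1).
rewrite lerD2l; apply: le_trans (_ : 4 ^+ m * (2 * dl) <= _).
  by rewrite !ler_wpM2l// exprn_ge0.
by rewrite /dl mulrA [4 ^+ m * 2]mulrC divff// mulf_neq0 ?expf_neq0 ?pnatr_eq0.
Qed.

Hypothesis gdef : forall u, g u u = 0 -> u = 0.

(** Liouville's argument: [fuglede_bound] bounds r times the commutator independently of r. *)
Lemma fuglede x : T (N' x) = N' (T x).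
Proof.
apply/eqP; rewrite eq_sym -subr_eq0; apply/eqP/gdef; set y := _ - _.
rewrite {1}/y sdotBl; set D := _ - _.
have [/eqP//|D0] := boolP (D == 0).
have nD : 0 < `|D| by rewrite normr_gt0.
set B := 5 * d * snorm g x * snorm g y.
have B0 : 0 <= B by rewrite !mulr_ge0 ?snorm_ge0.
have := fuglede_bound x y (divr_gt0 (ltr_wpDl B0 ltr01) nD).
rewrite -/D mulrC divfK ?gt_eqF// -/B => h.
by have := lt_le_trans (ltr_pwDr ltr01 (lexx B)) h; rewrite ltxx.
Qed.

End Fuglede.

(** * Complete monotonicity *)

Section ContractionCone.
Variables (R : realFieldType) (C : completeClosedField) (h : {rmorphism R -> C}).
Hypothesis h_ge0 : forall x, 0 <= h x -> 0 <= x.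
Hypothesis h_mono : forall x, 0 < x -> 0 < h x.
Variables (U : lmodType C) (g : semidot U) (n : nat) (N N' : 'I_n -> {linear U -> U}).
Hypothesis adjN : forall j u v, g (N j u) v = g u (N' j v).
Hypothesis commN : forall j k u, N j (N k u) = N k (N j u).
Hypothesis commN' : forall j k u, N j (N' k u) = N' k (N j u).
Hypothesis contrN : forall j u, g (N j u) (N j u) <= g u u.

(* With T = 1 - N' N one has T_0 = T, T_(i+1) = T_i - T_i^2, hence T = \sum_i T_i^2 strongly: differences of
   the moments |N^b u|^2 are limits of sums of such moments, without using square roots of operators. *)
Fixpoint defect j i (u : U) : U :=
  if i is i'.+1 then defect j i' u - defect j i' (defect j i' u)
  else u - N' j (N j u).

Lemma defectB j i u v : defect j i (u - v) = defect j i u - defect j i v.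
Proof.
elim: i u v => [|i ih] u v /=.
  rewrite (linearB (N j)) (linearB (N' j)) /= opprB [in RHS]opprB.
  by rewrite addrACA [RHS]addrACA; congr (_ + _); exact: addrC.
rewrite !ih opprB [in RHS]opprB.
by rewrite addrACA [RHS]addrACA; congr (_ + _); exact: addrC.
Qed.

Lemma defect_adj j i u v : g (defect j i u) v = g u (defect j i v).
Proof.
have adjN' w x : g (N' j w) x = g w (N j x) by rewrite sdotC -adjN -sdotC.
elim: i u v => [|i ih] u v /=; rewrite sdotBl sdotBr; last by rewrite !ih.
by rewrite adjN' adjN.
Qed.

Lemma defect_comm j i k u : defect j i (N k u) = N k (defect j i u).
Proof.
elim: i u => [|i ih] u /=; last by rewrite !ih linearB.
by rewrite linearB commN' commN.
Qed.

(** The order relation 0 <= T_i <= 1 is inherited by T_i - T_i^2 = T_i (1 - T_i) T_i + (1 - T_i) T_i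
    (1 - T_i), both terms being nonnegative. *)
Lemma defect_bounds j i u : 0 <= g (defect j i u) u <= g u u.
Proof.
elim: i u => [|i ih] u /=.
  rewrite sdotBl (_ : g (N' j (N j u)) u = g (N j u) (N j u)); last first.
    by rewrite sdotC -adjN -sdotC.
  by rewrite subr_ge0 contrN gerBl sdot_ge0.
set S := defect j i in ih *.
have e : g (S u - S (S u)) u = (g (S u) (S u) - g (S (S u)) (S u)) + g (S (u - S u)) (u - S u).
  rewrite /S defectB -/S !sdotBl !sdotBr -!(defect_adj j i) -/S.
  by ring.
have /andP[h1 h2] := ih (S u); have /andP[h3 h4] := ih (u - S u).
have /andP[h5 h6] := ih u.
rewrite e addr_ge0 ?subr_ge0// -e sdotBl.
have -> : g (S (S u)) u = g (S u) (S u) by rewrite /S defect_adj.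
by rewrite lerBlDr (le_trans h6)// lerDl sdot_ge0.
Qed.

Lemma defect_telescope j m u :
  \sum_(i < m) g (defect j i u) (defect j i u) = g (defect j 0%N u) u - g (defect j m u) u.
Proof.
elim: m => [|m ih]; first by rewrite big_ord0 subrr.
rewrite big_ord_recr ih /= [in RHS](sdotBl g (defect j m u)) opprB.
have -> : g (defect j m (defect j m u)) u = g (defect j m u) (defect j m u).
  by rewrite defect_adj.
by rewrite !addrA addrAC.
Qed.

(** The numbers <T_i u, u> decrease in i, their squares are at most |u|^2 |T_i u|^2, and the |T_i
    u|^2 telescope to a sum of at most |u|^2. This gives a rate of convergence depending only on
    |u|. *)
Lemma defect_decay j m u : m%:R * g (defect j m u) u ^+ 2 <= g u u ^+ 2.
Proof.
have dec i : g (defect j i.+1 u) u <= g (defect j i u) u.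
  rewrite /= sdotBl gerBl.
  have -> : g (defect j i (defect j i u)) u = g (defect j i u) (defect j i u).
    by rewrite defect_adj.
  exact: sdot_ge0.
have decl i : (i <= m)%N -> g (defect j m u) u <= g (defect j i u) u.
  move=> /subnK <-; elim: (m - i)%N => // k; apply: le_trans; exact: dec.
apply: le_trans (_ : \sum_(i < m) g u u * g (defect j i u) (defect j i u) <= _).
  have -> : m%:R * g (defect j m u) u ^+ 2 = \sum_(i < m) g (defect j m u) u ^+ 2.
    by rewrite sumr_const card_ord mulr_natl.
  apply: ler_sum => i _.
  have /andP[b1 _] := defect_bounds j m u; have /andP[b2 _] := defect_bounds j i u.
  apply: le_trans (_ : g (defect j i u) u ^+ 2 <= _).
    by rewrite ler_pXn2r ?nnegrE// decl// ltnW.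
  by have := cauchy_schwarz_sq g (defect j i u) u; rewrite ger0_norm// mulrC.
rewrite -mulr_sumr defect_telescope expr2 ler_wpM2l ?sdot_ge0//.
have /andP[b1 _] := defect_bounds j m u; have /andP[_ b2] := defect_bounds j 0 u.
by rewrite (le_trans _ b2)// gerBl.
Qed.

Definition sqpow b u := g (opow N b u) (opow N b u).

Lemma defect_opow j i b u : defect j i (opow N b u) = opow N b (defect j i u).
Proof.
rewrite /opow; elim: (enum _) => //= k s <-.
by elim: (b k) => //= p <-; rewrite defect_comm.
Qed.

Lemma sqpow_split j u (B : seq (multinom n)) (e : C) : 0 < e -> exists zs : seq U,
  forall b, b \in B ->
    `|sqpow b u - sqpow (mnm_add b (mnm1 j)) u - \sum_(z <- zs) sqpow b z| <= e.
Proof.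
move=> e0; pose V := \sum_(b <- B) sqpow b u ^+ 2.
have V0 : 0 <= V by apply: sumr_ge0 => b _; rewrite exprn_ge0// sdot_ge0.
(* V collects the norms for all b in B, so that a single m makes every remainder at most e. *)
have [m hm] := ccf_archi (divr_gt0 (exprn_gt0 2 e0) (ltr_wpDl V0 ltr01)).
exists [seq defect j i u | i <- iota 0%N m.+1] => b bB.
set v := opow N b u.
have -> : \sum_(z <- [seq defect j i u | i <- iota 0%N m.+1]) sqpow b z =
    g (defect j 0%N v) v - g (defect j m.+1 v) v.
  rewrite -defect_telescope big_map -[iota 0%N m.+1]/(index_iota 0%N m.+1) big_mkord.
  by apply: eq_bigr => i _; rewrite /sqpow -defect_opow.
have -> : sqpow b u - sqpow (mnm_add b (mnm1 j)) u = g (defect j 0%N v) v.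
  rewrite /= sdotBl (_ : g (N' j (N j v)) v = g (N j v) (N j v)); last first.
    by rewrite sdotC -adjN -sdotC.
  by rewrite /sqpow mpoly.addmC opowD// opow1.
rewrite opprB addrC subrK.
have /andP[b1 _] := defect_bounds j m.+1 v; rewrite ger0_norm//.
rewrite -(@ler_pXn2r _ 2)// ?nnegrE ?(ltW e0)//.
have m0 : 0 < m.+1%:R :> C by rewrite ltr0n.
rewrite -(ler_pM2l m0) (le_trans (defect_decay _ _ _))//.
apply: le_trans (_ : V + 1 <= _).
  rewrite ler_wpDr// /V (big_rem b)//= lerDl sumr_ge0// => b' _.
  by rewrite exprn_ge0// sdot_ge0.
have V1 : 0 < V + 1 by rewrite ltr_wpDl.
move: hm; rewrite ltr_pdivlMr// mulrC ltr_pdivrMr// => /ltW.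
by rewrite mulrC.
Qed.

(** The pointwise closure of the cone generated by the sequences |N^b y|^2. Closure is needed
    because a difference of such sequences is an infinite sum of them. *)
Definition cone (f : multinom n -> R) := forall (B : seq (multinom n)) (e : C), 0 < e ->
  exists ys : seq U, forall b, b \in B -> `|h (f b) - \sum_(y <- ys) sqpow b y| <= e.

Lemma cone_ge0 f b : cone f -> 0 <= f b.
Proof.
move=> fc.
have hr : h (f b) \is Num.real.
  have [f0|f0] := leP 0 (f b).
    by move: f0; rewrite le0r => /orP[/eqP ->|/h_mono/ltW/ger0_real//]; rewrite rmorph0 rpred0.
  by rewrite -rpredN ger0_real// -rmorphN ltW// h_mono// oppr_gt0.
apply: h_ge0; rewrite real_leNgt ?rpred0//; apply/negP => hf0.
have e0 : 0 < - h (f b) / 2 by rewrite divr_gt0// oppr_gt0.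
have [ys /(_ b (mem_head b [::]))] := fc [:: b] _ e0.
set s := \sum_(y <- ys) _; have s0 : 0 <= s by apply: sumr_ge0 => y _; exact: sdot_ge0.
rewrite distrC ger0_norm; last by rewrite addr_ge0// oppr_ge0 ltW.
move=> hs; have := le_trans (lerD s0 (lexx (- h (f b)))) hs; rewrite add0r.
have p : 0 < - h (f b) by rewrite oppr_gt0.
by rewrite ler_pdivlMr// -subr_le0 mulrC -{2}[- h (f b)]mul1r -mulrBl (_ : 2 - 1 = 1) ?mul1r ?leNgt; [rewrite real_leNgt ?rpred0 ?p//; rewrite ger0_real// ltW|rewrite -[2]/(1+1) addrK].
Qed.

Lemma cone_sqpow f u : (forall b, h (f b) = sqpow b u) -> cone f.
Proof.
move=> fu B e e0; exists [:: u] => b _.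
by rewrite big_seq1 fu subrr normr0 ltW.
Qed.

Lemma cone_shift f j : cone f -> cone (fun b => f (mnm_add (mnm1 j) b)).
Proof.
move=> fc B e e0; have [ys hys] := fc [seq mnm_add (mnm1 j) b | b <- B] e e0.
exists [seq N j y | y <- ys] => b bB; rewrite big_map.
have := hys _ (map_f _ bB); congr (`|_ - _| <= _).
by apply: eq_bigr => y _; rewrite /sqpow mpoly.addmC opowD// opow1.
Qed.

Lemma cone_nabla f j : cone f -> cone (fun b => f b - f (mnm_add (mnm1 j) b)).
Proof.
move=> fc B e e0; have e30 : 0 < e / 3 by rewrite divr_gt0.
have [ys hys] := fc (B ++ [seq mnm_add (mnm1 j) b | b <- B]) (e / 3) e30.
have ex : exists zs : seq U, forall b, b \in B ->
    `|\sum_(y <- ys) (sqpow b y - sqpow (mnm_add (mnm1 j) b) y) - \sum_(z <- zs) sqpow b z| <= e / 3.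
  elim: ys (e / 3) e30 {hys} => [|y ys ih] d d0.
    by exists [::] => b _; rewrite !big_nil subrr normr0 ltW.
  have d20 : 0 < d / 2 by rewrite divr_gt0.
  have [z1 hz1] := ih _ d20; have [z2 hz2] := sqpow_split j y B d20.
  exists (z2 ++ z1) => b bB; rewrite big_cons big_cat /= opprD addrACA.
  rewrite [d]splitr (le_trans (ler_normD _ _))// lerD ?hz1//.
  by have := hz2 b bB; rewrite [mnm_add b _]mpoly.addmC.
have [zs hzs] := ex; exists zs => b bB.
have hb := hys b; rewrite mem_cat bB in hb.
have hb' := hys (mnm_add (mnm1 j) b); rewrite mem_cat (map_f _ bB) orbT in hb'.
have hz := hzs b bB; rewrite sumrB in hz.
rewrite rmorphB.
set s := \sum_(y <- ys) sqpow b y in hb hz; set s' := \sum_(y <- ys) sqpow _ y in hb' hz.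
set t := \sum_(z <- zs) _ in hz *.
have -> : h (f b) - h (f (mnm_add (mnm1 j) b)) - t =
  (h (f b) - s) - (h (f (mnm_add (mnm1 j) b)) - s') + (s - s' - t) by ring.
have -> : e = e / 3 + e / 3 + e / 3 by field.
rewrite (le_trans (ler_normD _ _))// lerD// (le_trans (ler_normB _ _))// lerD//.
  exact: hb.
exact: hb'.
Qed.

Local Notation Xm b := (@mpolyX n R b).

(** Quantifying over the whole cone makes this property stable under multiplication by X_l and 1 -
    X_l, which act on f as the shift and the difference. *)
Definition cone_pos (q : {mpoly R[n]}) := forall f, cone f -> 0 <= mfun f q.

Lemma cone_pos1 : cone_pos 1.
Proof. by move=> f fc; rewrite -mpoly.mpolyX0 mfunX cone_ge0. Qed.

Lemma cone_posX l q : cone_pos q -> cone_pos (Xm (mnm1 l) * q).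
Proof. by move=> hq f fc; rewrite mfun_shift; apply/hq/cone_shift. Qed.

Lemma cone_posB l q : cone_pos q -> cone_pos ((1 - Xm (mnm1 l)) * q).
Proof.
move=> hq f fc; rewrite mulrBl mul1r raddfB /= [X in _ - X]mfun_shift.
have := hq _ (cone_nabla l fc); congr (_ <= _).
by rewrite !mfunE -sumrB; apply: eq_bigr => b _; rewrite mulrBr.
Qed.

Lemma cone_pos_bernstein (i k : 'I_n -> nat) :
  cone_pos (\prod_l (Xm (mnm1 l) ^+ i l * (1 - Xm (mnm1 l)) ^+ k l)).
Proof.
elim: (index_enum _) => [|l s ih]; first by rewrite big_nil; exact: cone_pos1.
rewrite big_cons -mulrA; elim: (i l) => [|p ihp].
  rewrite expr0 mul1r; elim: (k l) => [|p ihp]; first by rewrite expr0 mul1r.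
  by rewrite exprS -mulrA; exact: cone_posB.
by rewrite exprS -mulrA; exact: cone_posX.
Qed.

End ContractionCone.

(** * The Hausdorff moment problem *)

(** The factorial moments of the binomial law. They are exact, so the Bernstein weights reproduce
    factorial moments exactly and ordinary moments up to O(1/K). *)
Lemma bernstein_ffact (A : comNzRingType) (x : A) K b :
  \sum_(i < K.+1) (i ^_ b)%:R * ('C(K, i)%:R * (x ^+ i * (1 - x) ^+ (K - i))) =
  (K ^_ b)%:R * x ^+ b.
Proof.
elim: b K => [|b ih] K.
  have -> : (K ^_ 0)%:R * x ^+ 0 = (1 - x + x) ^+ K.
    by rewrite ffactn0 expr0 mulr1 subrK expr1n.
  rewrite exprDn.
  apply: eq_bigr => i _; rewrite ffactn0 mul1r [x ^+ i * _]mulrC.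
  by rewrite mulr_natl.
case: K => [|K].
  by rewrite big_ord_recl big_ord0 /= ffact0n !mul0r addr0.
rewrite big_ord_recl /= ffact0n mul0r add0r ffactSS natrM exprS.
have -> : K.+1%:R * (K ^_ b)%:R * (x * x ^+ b) = K.+1%:R * x * ((K ^_ b)%:R * x ^+ b) by ring.
rewrite -ih mulr_sumr; apply: eq_bigr => i _.
rewrite /bump /= add1n ffactSS subSS exprS natrM.
have := congr1 (fun m => m%:R : A) (mul_bin_diag K.+1 i); rewrite !natrM /= => h.
have -> : i.+1%:R * (i ^_ b)%:R * ('C(K.+1, i.+1)%:R * (x * x ^+ i * (1 - x) ^+ (K - i))) =
  (i.+1%:R * 'C(K.+1, i.+1)%:R) * ((i ^_ b)%:R * (x * x ^+ i * (1 - x) ^+ (K - i))) by ring.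
by rewrite -h; ring.
Qed.

Lemma prod_dist (R : realFieldType) (I : Type) (r : seq I) (x y : I -> R) :
  (forall i, 0 <= x i <= 1) -> (forall i, 0 <= y i <= 1) ->
  `|\prod_(i <- r) x i - \prod_(i <- r) y i| <= \sum_(i <- r) `|x i - y i|.
Proof.
move=> hx hy; elim: r => [|i r ih]; first by rewrite !big_nil subrr normr0.
rewrite !big_cons; set p := \prod_(i <- r) x i in ih *; set q := \prod_(i <- r) y i in ih *.
have -> : x i * p - y i * q = (x i - y i) * q + x i * (p - q) by ring.
have q01 : 0 <= q <= 1.
  by rewrite prodr_ile1// prodr_ge0// => j _; have /andP[] := hy j.
have /andP[q0 q1] := q01; have /andP[x0 x1] := hx i.
rewrite (le_trans (ler_normD _ _))// lerD//.
  by rewrite normrM (ger0_norm q0) ler_piMr.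
by rewrite normrM (ger0_norm x0) (le_trans (ler_piMl _ x1)).
Qed.

Lemma expr_dist (R : realFieldType) (x y : R) b :
  0 <= x <= 1 -> 0 <= y <= 1 -> `|x ^+ b - y ^+ b| <= b%:R * `|x - y|.
Proof.
move=> hx hy; have := @prod_dist R _ (index_enum 'I_b) (fun=> x) (fun=> y) (fun=> hx) (fun=> hy).
by rewrite !prodr_const sumr_const !card_ord mulr_natl.
Qed.

Lemma monomial_dist (R : realFieldType) n (b : 'I_n -> nat) (x y : 'I_n -> R) :
  (forall i, 0 <= x i <= 1) -> (forall i, 0 <= y i <= 1) ->
  `|\prod_l x l ^+ b l - \prod_l y l ^+ b l| <= \sum_l (b l)%:R * `|x l - y l|.
Proof.
move=> hx hy; apply: le_trans (prod_dist _ _ _) _.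
- by move=> i; have /andP[h1 h2] := hx i; rewrite exprn_ge0// exprn_ile1.
- by move=> i; have /andP[h1 h2] := hy i; rewrite exprn_ge0// exprn_ile1.
- by apply: ler_sum => i _; exact: expr_dist.
Qed.

Lemma ffact_dist (R : realFieldType) K i b : (b <= K)%N -> (0 < K)%N -> (i <= K)%N ->
  `|(i%:R / K%:R) ^+ b - (i ^_ b)%:R / (K ^_ b)%:R| <= (b ^ 2)%:R / K%:R :> R.
Proof.
move=> bK K0 iK.
have K0' : 0 < K%:R :> R by rewrite ltr0n.
have -> : (i ^_ b)%:R / (K ^_ b)%:R = \prod_(r < b) ((i - r)%:R / (K - r)%:R) :> R.
  by rewrite !ffact_prod !natr_prod -prodf_div.
have -> : (i%:R / K%:R) ^+ b = \prod_(r < b) (i%:R / K%:R) :> R.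
  by rewrite prodr_const card_ord.
have rK (r : 'I_b) : (0 < K - r)%N by rewrite subn_gt0 (leq_trans (ltn_ord r)).
apply: le_trans (prod_dist _ _ _) _.
- by move=> r; rewrite divr_ge0// ler_pdivrMr// mul1r ler_nat.
- move=> r; have ? : 0 < (K - r)%:R :> R by rewrite ltr0n.
  by rewrite divr_ge0//= ler_pdivrMr// mul1r ler_nat leq_sub2r.
apply: le_trans (_ : \sum_(r < b) b%:R / K%:R <= _); last first.
  by rewrite sumr_const card_ord -[leLHS]mulr_natl natrX expr2 mulrA.
apply: ler_sum => r _; apply: le_trans (_ : r%:R / K%:R <= _); last first.
  by rewrite ler_pM2r ?invr_gt0// ler_nat ltnW.
have Kr0 : 0 < (K - r)%:R :> R by rewrite ltr0n.
have [ir|ri] := leqP i r.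
  rewrite (_ : (i - r)%N = 0%N); last by apply/eqP; rewrite subn_eq0.
  by rewrite mul0r subr0 ger0_norm ?divr_ge0// ler_pM2r ?invr_gt0// ler_nat.
have rK' : (r <= K)%N by rewrite (leq_trans (ltnW ri)).
have e : i%:R / K%:R - (i - r)%:R / (K - r)%:R = (r%:R / K%:R) * ((K - i)%:R / (K - r)%:R) :> R.
  rewrite !natrB ?(ltnW ri)//; rewrite natrB// in Kr0.
  by field; rewrite !gt_eqF.
rewrite e ger0_norm ?mulr_ge0 ?divr_ge0// ler_piMr ?divr_ge0//.
by rewrite ler_pdivrMr// mul1r ler_nat leq_sub2l// ltnW.
Qed.

Section BernsteinWeights.
Variables (R : realType) (n : nat) (a : multinom n -> R).
Local Notation Xm b := (@mpolyX n R b).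
Hypothesis a_pos : forall i k : 'I_n -> nat,
  0 <= mfun a (\prod_l (Xm (mnm1 l) ^+ i l * (1 - Xm (mnm1 l)) ^+ k l)).

Let mfun_natl m q : mfun a (m%:R * q) = m%:R * mfun a q.
Proof. by rewrite mulr_natl raddfMn /= mulr_natl. Qed.

(** The functional applied to a Bernstein basis polynomial; it serves as the mass at the grid point
    i / K. *)
Definition bwt K (i : {ffun 'I_n -> 'I_K.+1}) : R :=
  mfun a (\prod_l ('C(K, i l)%:R * (Xm (mnm1 l) ^+ i l * (1 - Xm (mnm1 l)) ^+ (K - i l)))).

Lemma bwt_ge0 K i : 0 <= @bwt K i.
Proof.
rewrite /bwt big_split /= -natr_prod mulr_natl raddfMn.
by rewrite mulrn_wge0// (a_pos (fun l => i l) (fun l => K - i l)%N).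
Qed.

Lemma bwt_ffact K (b : multinom n) :
  \sum_i bwt i * \prod_l ((i l : 'I_K.+1) ^_ (b l))%:R = (\prod_l (K ^_ (b l))%:R) * a b.
Proof.
have -> : (\prod_l (K ^_ (b l))%:R) * a b =
   mfun a (\prod_l \sum_(i < K.+1) (i ^_ (b l))%:R *
     ('C(K, i)%:R * (Xm (mnm1 l) ^+ i * (1 - Xm (mnm1 l)) ^+ (K - i)))).
  under [in RHS]eq_bigr do rewrite bernstein_ffact.
  by rewrite big_split /= -mpoly.mpolyXE_id -!natr_prod mfun_natl mfunX.
rewrite bigA_distr_bigA /= raddf_sum; apply: eq_bigr => i _.
by rewrite big_split /= -!natr_prod mulrC -mfun_natl.
Qed.

Lemma bwt_sum K : \sum_i @bwt K i = a (@mnm0 n).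
Proof.
have := bwt_ffact K (@mnm0 n); rewrite [X in _ = X * _]big1 ?mul1r => [<-|l _].
  by apply: eq_bigr => i _; rewrite big1 ?mulr1// => l _; rewrite mpoly.mnm0E ffactn0.
by rewrite mpoly.mnm0E ffactn0.
Qed.

Definition bpt K (i : {ffun 'I_n -> 'I_K.+1}) (l : 'I_n) : R := (i l)%:R / K%:R.

Lemma bpt01 K i l : (0 < K)%N -> 0 <= @bpt K i l <= 1.
Proof.
move=> K0; rewrite /bpt divr_ge0//= ler_pdivrMr ?ltr0n// mul1r ler_nat.
by rewrite -ltnS.
Qed.

Lemma bwt_moment K (b : multinom n) : (0 < K)%N -> (forall l, (b l <= K)%N) ->
  `|\sum_i @bwt K i * \prod_l bpt i l ^+ b l - a b| <=
  a (@mnm0 n) * (\sum_l (b l ^ 2)%:R) / K%:R.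
Proof.
move=> K0 bK; have K0' : 0 < K%:R :> R by rewrite ltr0n.
have f0 l : (K ^_ (b l))%:R != 0 :> R by rewrite pnatr_eq0 -lt0n ffact_gt0.
have p0 : \prod_l (K ^_ (b l))%:R != 0 :> R by apply/prodf_neq0.
have -> : a b = \sum_i @bwt K i * \prod_l ((i l ^_ (b l))%:R / (K ^_ (b l))%:R).
  under eq_bigr do rewrite prodf_div mulrA.
  by rewrite -mulr_suml bwt_ffact mulrAC mulfV// mul1r.
rewrite -sumrB (le_trans (ler_norm_sum _ _ _))//.
rewrite -(bwt_sum K) -mulrA mulr_suml; apply: ler_sum => i _.
rewrite -mulrBr normrM (ger0_norm (bwt_ge0 _)) ler_wpM2l ?bwt_ge0//.
rewrite mulr_suml; apply: le_trans (prod_dist _ _ _) _.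
- by move=> l; have /andP[h1 h2] := bpt01 i l K0; rewrite exprn_ge0// exprn_ile1.
- move=> l; rewrite divr_ge0//= ler_pdivrMr ?ltr0n ?ffact_gt0// mul1r ler_nat.
  rewrite !ffact_prod; apply: leq_prod => r _; rewrite leq_sub2r//.
  by rewrite -ltnS.
- by apply: ler_sum => l _; apply: ffact_dist; rewrite // -ltnS.
Qed.

End BernsteinWeights.

(** * Consistent masses as lengths of nested intervals *)

Section IntervalTree.
Variables (R : realType) (W : seq bool -> R).
Hypothesis W_ge0 : forall s, 0 <= W s.
Hypothesis W_split : forall s, W s = W (false :: s) + W (true :: s).

(* Bits are listed from the last one: c :: s is a child of s. *)
Fixpoint left_end (s : seq bool) : R :=
  if s is c :: s' then left_end s' + (if c then W (false :: s') else 0) else 0.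

Fixpoint address L (x : R) : seq bool :=
  if L is L'.+1 then
    let s := address L' x in (left_end s + W (false :: s) <= x) :: s
  else [::].

Definition cell s : set R := `[left_end s, left_end s + W s[%classic.

Lemma size_address L x : size (address L x) = L.
Proof. by elim: L => //= L ->. Qed.

Lemma addressP s x : x \in `[0, W [::][ ->
  (address (size s) x == s) = (x \in `[left_end s, left_end s + W s[).
Proof.
move=> x0; elim: s => [|c s ih]; first by rewrite /= add0r x0 eqxx.
rewrite /= eqseq_cons andbC.
have [e|ne] := eqVneq (address (size s) x) s; last first.
  move: ih; rewrite (negPf ne) /= => ih; apply/esym/negbTE.
  apply/negP; rewrite in_itv /= => /andP[h1 h2].
  move: ih; rewrite in_itv /= => /esym/negbT; rewrite negb_and -!ltNge => /orP[h|h].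
    have : left_end s <= x by apply: le_trans h1; rewrite lerDl; case: c {h2} => //; exact: W_ge0.
    by rewrite leNgt h.
  suff hh : x < left_end s + W s by rewrite hh in h.
  apply: lt_le_trans h2 _; rewrite -addrA lerD2l [W s]W_split.
  by case: c {h1}; rewrite ?add0r ?lerDl.
rewrite e eqxx in ih *; rewrite /= in_itv /=.
move/esym: ih; rewrite in_itv /= => /andP[h1 h2].
case: c => /=.
  have -> : left_end s + W (false :: s) + W (true :: s) = left_end s + W s.
    by rewrite -addrA -W_split.
  by rewrite h2 andbT; case: (_ <= x).
by rewrite addr0 h1 /= ltNge; case: (_ <= x).
Qed.

Lemma left_end_ge0 s : 0 <= left_end s.
Proof. by elim: s => //= c s ih; rewrite addr_ge0//; case: c. Qed.

Lemma right_end_le s : left_end s + W s <= W [::].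
Proof.
elim: s => [|c s ih] /=; first by rewrite add0r.
apply: le_trans ih; rewrite -addrA lerD2l [W s]W_split.
by case: c; rewrite ?add0r ?lerDl.
Qed.

Lemma cell_sub s : cell s `<=` `[0, W [::][%classic.
Proof.
move=> x; rewrite /cell /= !in_itv /= => /andP[h1 h2].
by rewrite (le_trans (left_end_ge0 s))//= (lt_le_trans h2)// right_end_le.
Qed.

Lemma measurable_address L s : measurable [set x : R | address L x = s].
Proof.
elim: L s => [|L ih] s /=.
  have [->|sn] := eqVneq s [::].
    by rewrite (_ : [set _ | _] = setT)//; apply/seteqP; split.
  rewrite (_ : [set _ | _] = set0)//; apply/seteqP; split=> // x /= h.
  by move: sn; rewrite -h.
case: s => [|c s]; first by rewrite (_ : [set _ | _] = set0)//; apply/seteqP; split.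
rewrite (_ : [set _ | _] = [set x | address L x = s] `&`
   (if c then `[left_end s + W (false :: s), +oo[%classic
    else `]-oo, left_end s + W (false :: s)[%classic)).
  by apply: measurableI => //; case: c.
apply/seteqP; split=> x /=.
  move=> [h1 h2]; split=> //; rewrite -h2 in h1 *.
  by case: c h1 => h1; rewrite /= in_itv /= ?andbT ?h1// ltNge h1.
move=> [h1 h2]; rewrite h1; congr (_ :: _).
by case: c h2; rewrite /= in_itv /= ?andbT// ltNge => /negbTE.
Qed.

Lemma measurable_fun_address d (T : measurableType d) (f : seq bool -> T) L :
  measurable_fun setT (fun x : R => f (address L x)).
Proof.
move=> _ Y mY; rewrite setTI.
rewrite (_ : _ @^-1` _ = \bigcup_s (if `[< Y (f s) >] then
    [set x : R | address L x = s] else set0)).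
  apply: countable_bigcupT_measurable; first exact: countableP.
  by move=> s; case: ifP => _ //; exact: measurable_address.
apply/seteqP; split=> x /=; last by move=> [s _]; case: ifP => // /asboolP h /= e; rewrite e.
by move=> h; exists (address L x) => //; rewrite ifT//; apply/asboolP.
Qed.

Definition lebesgue_root :=
  mrestr (@lebesgue_measure R) (measurable_itv `[0, W [::][ : measurable `[0, W [::][%classic).

(** A function of the first L bits is a step function on the cells of level L, whose lengths are the
    W s. *)
Lemma integral_address (f : seq bool -> R) L : (forall s, 0 <= f s) ->
  (\int[lebesgue_root]_(x in `[0%R, W [::][) (f (address L x))%:E =
   (\sum_(s : L.-tuple bool) W s * f s)%:E)%E.
Proof.
move=> f0.
transitivity (\int[lebesgue_root]_(x in `[0%R, W [::][)
    (\sum_(s : L.-tuple bool) (f s * \1_(cell s) x)%:E))%E.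
  apply: eq_integral => x; rewrite inE /= => x0.
  have sz := size_address L x.
  pose s0 : L.-tuple bool := tcast sz (in_tuple (address L x)).
  have s0E : (s0 : seq bool) = address L x by rewrite /s0 val_tcast.
  rewrite (bigD1 s0)//= big1 ?adde0.
    rewrite s0E indicE mem_set ?mulr1// /cell /= -addressP// sz eqxx //.
  move=> s ss0; rewrite indicE memNset ?mulr0//.
  rewrite /cell /= -addressP// size_tuple => /eqP h; move/eqP: ss0; apply.
  by apply: val_inj; rewrite /= s0E h.
rewrite ge0_integral_sum//; last 2 first.
- move=> s; apply/measurable_EFinP; apply: measurable_funM => //.
  by apply: measurable_indic; exact: measurable_itv.
- by move=> s x _; rewrite lee_fin mulr_ge0.
rewrite -sumEFin; apply: eq_bigr => s _.
under eq_integral do rewrite EFinM.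
rewrite ge0_integralZl//; last 2 first.
- by apply/measurable_EFinP; apply: measurable_indic; exact: measurable_itv.
- by rewrite lee_fin.
have mc : measurable (cell s) by exact: measurable_itv.
rewrite integral_indic//.
rewrite (setIidl (@cell_sub s)).
have e := @lebesgue_measure_itv R `[left_end s, left_end s + W s[.
rewrite [X in (_ * X)%E](_ : _ = lebesgue_measure `[left_end s, left_end s + W s[%classic); last first.
  by rewrite /= /lebesgue_root /mrestr (setIidl (@cell_sub s)).
rewrite e /= lte_fin ltrDl {mc e}.
case: ltP => [Ws|Ws]; first by rewrite -EFinB addrAC subrr add0r -EFinM mulrC.
by rewrite (_ : W s = 0) ?mul0r ?mule0//; apply/eqP; rewrite eq_le Ws W_ge0.
Qed.

End IntervalTree.

(** * Dyadic boxes and the digits of a point *)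

Section DyadicDigits.
Variables (R : realType) (n : nat).
Hypothesis n_gt0 : (0 < n)%N.

Definition coord L : 'I_n := Ordinal (ltn_pmod L n_gt0).
(* The digits are dealt cyclically to the n coordinates; ndigits L j of the first L bits go to j. *)
Definition ndigits L (j : 'I_n) : nat := (L %/ n + (j < L %% n))%N.
(** The side in direction j of a box of level L. The factor 2 comes from subdividing [0, 2)^n rather
    than the unit cube, so that half-open boxes also contain points with a coordinate equal to 1. *)
Definition slack L (j : 'I_n) : R := 2 * 2^-1 ^+ ndigits L j.

Lemma ndigitsS L j : ndigits L.+1 j = (ndigits L j + (j == coord L))%N.
Proof.
rewrite /ndigits -val_eqE /= {1 2}(divn_eq L n) -addnS divnMDl// modnMDl.
have := ltn_pmod L n_gt0; move: (L %/ n)%N (L %% n)%N => q r rn.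
have jn := ltn_ord j; have [rn'|rn'] := ltnP r.+1 n.
  by rewrite divn_small// modn_small//; case: ltngtP; lia.
have -> : r.+1 = n by apply/eqP; rewrite eqn_leq rn.
by rewrite divnn n_gt0 modnn; case: ltngtP; lia.
Qed.

Lemma slackS L j : slack L.+1 j = if j == coord L then slack L j / 2 else slack L j.
Proof.
rewrite /slack ndigitsS; case: ifP => _; last by rewrite addn0.
by rewrite addn1 exprSr; ring.
Qed.

Lemma slack_ge0 L j : 0 <= slack L j.
Proof. by rewrite /slack mulr_ge0// exprn_ge0. Qed.

Fixpoint corner (s : seq bool) (j : 'I_n) : R :=
  if s is c :: s' then
    corner s' j + (if c && (j == coord (size s')) then slack (size s') j / 2 else 0)
  else 0.

Lemma corner_le c s j : corner s j <= corner (c :: s) j.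
Proof. by rewrite /= lerDl; case: ifP => // _; rewrite divr_ge0// slack_ge0. Qed.

Lemma corner_slack_le c s j :
  corner (c :: s) j + slack (size s).+1 j <= corner s j + slack (size s) j.
Proof.
rewrite /= -addrA lerD2l slackS; have := slack_ge0 (size s) j.
by case: c; case: (j == _) => /= h; lra.
Qed.

Lemma corner_ge0 s j : 0 <= corner s j.
Proof. by elim: s => // c s ih; apply: le_trans ih (corner_le _ _ _). Qed.

Lemma corner_slack2 s j : corner s j + slack (size s) j <= 2.
Proof.
elim: s => [|c s ih]; last exact: le_trans (corner_slack_le _ _ _) ih.
by rewrite /= add0r /slack /ndigits div0n mod0n ltn0 expr0 mulr1.
Qed.

Lemma slack_small (e : R) : 0 < e -> exists L0, forall L j, (L0 <= L)%N -> slack L j <= e.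
Proof.
move=> e0; have e20 : 0 < e / 2 by rewrite divr_gt0.
have [q hq] := ltr_add_invr e20; rewrite add0r in hq.
exists (n * q.+1)%N => L j hL.
have h : (q.+1 <= ndigits L j)%N.
  by rewrite /ndigits (leq_trans _ (leq_addr _ _))// leq_divRL// mulnC.
rewrite /slack -ler_pdivlMl// mulrC (le_trans _ (ltW hq))//.
apply: le_trans (_ : 2^-1 ^+ q.+1 <= _).
  by rewrite ler_wiXn2l// ?invr_ge0// invf_le1// ler1n.
rewrite exprVn lef_pV2 ?posrE ?exprn_gt0 ?ltr0n// -natrX ler_nat.
by rewrite ltnW// ltn_expl.
Qed.

Fixpoint code L (t : 'I_n -> R) : seq bool :=
  if L is L'.+1 then
    let s := code L' t in
    (corner s (coord L') + slack L' (coord L') / 2 <= t (coord L')) :: s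
  else [::].

Lemma size_code L t : size (code L t) = L.
Proof. by elim: L => //= L ->. Qed.

Lemma codeP L t j : (forall j, 0 <= t j < 2) ->
  corner (code L t) j <= t j < corner (code L t) j + slack L j.
Proof.
move=> ht; elim: L => [|L ih].
  by rewrite /= add0r /slack /ndigits div0n mod0n ltn0 expr0 mulr1.
rewrite /= size_code slackS; have [jL|jL] := eqVneq j (coord L); last first.
  by rewrite andbF addr0.
move: ih; rewrite andbT -jL; set c := corner _ _; set e := slack _ _ => /andP[h1 h2].
case: (leP (c + e / 2) (t j)) => h; apply/andP; split; lra.
Qed.

End DyadicDigits.

Lemma ultra_bounded_cvg (R : realType) (F : set_system nat) (u : nat -> R) M :
  UltraFilter F -> (forall k, 0 <= u k <= M) -> exists l : R, u k @[k --> F] --> l.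
Proof.
move=> FU hu.
have cpt := @segment_compact R 0 M.
have [|p [_ clp]] := cpt (u @ F) _.
  suff : (u @^-1` `[0, M]%classic) = setT by move=> h; rewrite /fmap /= h; exact: filterT.
  by apply/seteqP; split=> // k _; rewrite /= in_itv /=; exact: hu.
exists p => B nB.
have [//|nFB] := in_ultra_setVsetC (u @^-1` B) FU.
have [x [/= nBx Bx]] := clp (~` B) B nFB nB.
by [].
Qed.

Section LimitMasses.
Variables (R : realType) (n : nat) (a : multinom n -> R).
Hypothesis n_gt0 : (0 < n)%N.
Variables (I : nat -> finType) (w : forall K, I K -> R) (p : forall K, I K -> 'I_n -> R).
Hypothesis w_ge0 : forall K i, 0 <= @w K i.
Hypothesis w_sum : forall K, \sum_i @w K i = a (@mnm0 n).
Hypothesis p01 : forall K i l, 0 <= @p K i l <= 1.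
Hypothesis w_moment : forall b : multinom n,
  \sum_i @w K i * \prod_l p i l ^+ b l @[K --> \oo] --> a b.

Let p02 K i l : 0 <= @p K i l < 2.
Proof. by have /andP[-> /le_lt_trans->]//= := p01 i l; rewrite ltr1n. Qed.

Definition pmass K s : R := \sum_i @w K i * (code n_gt0 (size s) (p i) == s)%:R.

Lemma pmass_ge0 K s : 0 <= pmass K s.
Proof. by apply: sumr_ge0 => i _; rewrite mulr_ge0. Qed.

Lemma pmass_split K s : pmass K s = pmass K (false :: s) + pmass K (true :: s).
Proof.
rewrite /pmass -big_split /=; apply: eq_bigr => i _; rewrite -mulrDr; congr (_ * _).
rewrite !eqseq_cons; case: (_ <= _) => /=; rewrite -natrD ?addn0 //.
Qed.

Lemma pmass_nil K : pmass K [::] = a (@mnm0 n).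
Proof. by rewrite -(w_sum K); apply: eq_bigr => i _; rewrite eqxx mulr1. Qed.

Lemma pmass_le K s : pmass K s <= a (@mnm0 n).
Proof.
rewrite -(w_sum K); apply: ler_sum => i _.
by rewrite -[leRHS]mulr1 ler_wpM2l// lern1 leq_b1.
Qed.

Lemma pmass_corner K L (f : seq bool -> R) :
  \sum_(s : L.-tuple bool) pmass K s * f s = \sum_i @w K i * f (code n_gt0 L (p i)).
Proof.
under eq_bigr do rewrite mulr_suml; rewrite exchange_big /=; apply: eq_bigr => i _.
pose s0 : L.-tuple bool := tcast (size_code n_gt0 L (p i)) (in_tuple _).
have s0E : (s0 : seq bool) = code n_gt0 L (p i) by rewrite /s0 val_tcast.
rewrite (bigD1 s0)//= big1 ?addr0; first by rewrite s0E size_code eqxx mulr1.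
move=> s ss0; rewrite size_tuple; case: eqP => [h|]; last by rewrite mulr0 mul0r.
by case/eqP: ss0; apply: val_inj; rewrite /= s0E.
Qed.

(** Moving a point to the lower corner of its box changes coordinate l by at most the slack. The
    bound does not involve K, so it survives the limit in K. *)
Lemma pmass_moment K L (b : multinom n) :
  `|\sum_(s : L.-tuple bool) pmass K s * \prod_l corner R n_gt0 s l ^+ b l -
    \sum_i @w K i * \prod_l p i l ^+ b l| <=
  a (@mnm0 n) * \sum_l (b l)%:R * slack R L l.
Proof.
rewrite (@pmass_corner K L (fun s => \prod_l corner R n_gt0 s l ^+ b l)) -sumrB.
rewrite -(w_sum K) mulr_suml; apply: le_trans (ler_norm_sum _ _ _) _.
apply: ler_sum => i _; rewrite -mulrBr normrM (ger0_norm (w_ge0 i)) ler_wpM2l//.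
have cp l := codeP n_gt0 L l (p02 i).
apply: le_trans (monomial_dist b _ (p01 i)) _.
  move=> l; rewrite corner_ge0 /=; have /andP[/le_trans-> //] := cp l.
  by have /andP[] := p01 i l.
apply: ler_sum => l _; rewrite ler_wpM2l//.
have /andP[h1 h2] := cp l; rewrite distrC ger0_norm ?subr_ge0//.
by rewrite lerBlDl ltW.
Qed.

(* The masses of the countably many dyadic boxes converge simultaneously along an ultrafilter, which replaces
   a weak-* compactness argument. *)
Lemma limit_masses : exists W : seq bool -> R, [/\ forall s, 0 <= W s,
  forall s, W s = W (false :: s) + W (true :: s), W [::] = a (@mnm0 n) &
  forall b : multinom n,
    \sum_(s : L.-tuple bool) W s * \prod_l corner R n_gt0 s l ^+ b l @[L --> \oo] --> a b].
Proof.
have [U [UU Uoo]] := ultraFilterLemma (eventually_filter : ProperFilter \oo).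
have cU s : exists l : R, pmass K s @[K --> U] --> l.
  by apply: (@ultra_bounded_cvg _ U _ (a (@mnm0 n))) => K; rewrite pmass_ge0 pmass_le.
have [W cW] := boolp.choice cU.
have uoo (u : nat -> R) l : u @ \oo --> l -> u @ U --> l.
  by move=> h; apply: cvg_trans h; exact: cvg_app.
exists W; split.
- by move=> s; apply: (cvgr_to_ge (cW s)); apply: nearW => K; exact: pmass_ge0.
- move=> s; apply: (cvg_unique _ (cW s)) => //.
  have -> : pmass ^~ s = fun K => pmass K (false :: s) + pmass K (true :: s).
    by apply/funext => K; exact: pmass_split.
  exact: cvgD.
- apply: (cvg_unique _ (cW [::])) => //.
  have -> : pmass ^~ [::] = fun=> a (@mnm0 n) by apply/funext => K; exact: pmass_nil.
  exact: cvg_cst.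
move=> b.
have a0 : 0 <= a (@mnm0 n) by rewrite -(w_sum 0) sumr_ge0.
have est L : `|\sum_(s : L.-tuple bool) W s * \prod_l corner R n_gt0 s l ^+ b l - a b| <=
    a (@mnm0 n) * \sum_l (b l)%:R * slack R L l.
  have h : `|\sum_(s : L.-tuple bool) pmass K s * \prod_l corner R n_gt0 s l ^+ b l -
      \sum_i @w K i * \prod_l p i l ^+ b l| @[K --> U] -->
    `|\sum_(s : L.-tuple bool) W s * \prod_l corner R n_gt0 s l ^+ b l - a b|.
    apply: cvg_norm; apply: cvgB; last exact: uoo.
    apply: cvg_big => [|s _]; first exact: add_continuous.
    by apply: cvgM => //; exact: cvg_cst.
  by apply: (cvgr_to_le h); apply: nearW => K; exact: pmass_moment.
have B0 : 0 <= \sum_l (b l)%:R :> R by apply: sumr_ge0.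
apply/cvgrPdist_le => e e0.
have d0 : 0 < e / (a (@mnm0 n) * (\sum_l (b l)%:R) + 1).
  by rewrite divr_gt0// ltr_wpDl// mulr_ge0.
have [L0 hL0] := slack_small n_gt0 d0.
exists L0 => // L /= hL; rewrite distrC; apply: le_trans (est L) _.
apply: le_trans (_ : a (@mnm0 n) * ((\sum_l (b l)%:R) * (e / (a (@mnm0 n) * (\sum_l (b l)%:R) + 1))) <= _).
  rewrite ler_wpM2l// mulr_suml; apply: ler_sum => l _.
  by rewrite ler_wpM2l// hL0.
move: (\sum_l _) B0 d0 {hL0} => B B0 d0; have aB : 0 <= a (@mnm0 n) * B by rewrite mulr_ge0.
rewrite !mulrA ler_pdivrMr ?ltr_wpDl// mulrDr mulr1 mulrC lerDl.
exact: ltW.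
Qed.

End LimitMasses.

Section FiniteMeasure.
Variables (d : measure_display) (T : measurableType d) (R : realType).
Variables (m : {measure set T -> \bar R}) (mT : (m setT < +oo)%E).

Definition total_finite : set T -> \bar R := m.

Let fin_num_total_finite : fin_num_fun total_finite.
Proof.
move=> A mA; rewrite ge0_fin_numE ?measure_ge0//; apply: le_lt_trans mT.
by apply: le_measure => //; rewrite inE.
Qed.

HB.instance Definition _ := Measure.on total_finite.
HB.instance Definition _ := Measure_isFinite.Build _ _ _ total_finite fin_num_total_finite.

Lemma finite_measureP :
  exists mu : {finite_measure set T -> \bar R}, mu = m :> (set T -> \bar R).
Proof. by exists total_finite. Qed.

End FiniteMeasure.

Section BorelRV.
Variables (R : realType) (n : nat).

Lemma measurable_coord (j : 'I_n) :
  measurable_fun setT (fun t : borel_rV R n => (t : 'rV[R]_n) ord0 j).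
Proof.
apply: (measurability _ (RGenOpens.measurableE R)).
move=> _ [_ [x [y ->]] <-]; rewrite setTI; apply: sub_sigma_algebra.
by apply: open_comp => [t _|]; [exact: coord_continuous|exact: interval_open].
Qed.

Lemma measurable_cube (a : 'rV[R]_n) s : measurable (cube a s : set (borel_rV R n)).
Proof.
rewrite (_ : cube a s = \bigcap_(j in [set: 'I_n])
   ((fun t : borel_rV R n => (t : 'rV[R]_n) ord0 j) @^-1` `[a ord0 j, a ord0 j + s])).
  apply: fin_bigcap_measurable => // j _; rewrite -[X in measurable X]setTI.
  by apply: measurable_coord => //; exact: measurable_itv.
by apply/seteqP; split=> t /= h j => [_|]; have := h j; rewrite /= in_itv /= ?[True -> _]/=; auto.
Qed.

Lemma measurable_monomial (b : multinom n) :
  measurable_fun setT (fun t : borel_rV R n => \prod_l (t : 'rV[R]_n) ord0 l ^+ b l).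
Proof. by apply: measurable_prod => l _; apply: measurable_funX; exact: measurable_coord. Qed.

End BorelRV.

Section DigitMap.
Variables (R : realType) (n : nat) (W : seq bool -> R).
Hypothesis n_gt0 : (0 < n)%N.
Hypothesis W_ge0 : forall s, 0 <= W s.
Hypothesis W_split : forall s, W s = W (false :: s) + W (true :: s).

Definition digits L x j := corner R n_gt0 (address W L x) j.
(** The bits locating x in the interval tree are read as the dyadic digits of a point, so a cell is
    sent into the closed box with the same string. *)
Definition dpoint x : 'rV[R]_n := \row_j limn (fun L => digits L x j).

Lemma digits_nd x j : nondecreasing_seq (fun L => digits L x j).
Proof. by apply/nondecreasing_seqP => L; rewrite /digits /=; exact: corner_le. Qed.

Lemma digits_slack_le L L' x j : (L <= L')%N ->
  digits L' x j + slack R L' j <= digits L x j + slack R L j.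
Proof.
move/subnKC <-; elim: (L' - L)%N => [|k ih]; first by rewrite addn0.
apply: le_trans ih; rewrite addnS /digits.
have := corner_slack_le R n_gt0 (left_end W (address W (L + k) x) + W (false :: address W (L + k) x) <= x) (address W (L + k) x) j.
by rewrite size_address.
Qed.

Lemma digits_le2 L x j : digits L x j <= 2.
Proof.
apply: le_trans (corner_slack2 R n_gt0 (address W L x) j).
by rewrite lerDl slack_ge0.
Qed.

Lemma digits_cvg x j : digits L x j @[L --> \oo] --> dpoint x ord0 j.
Proof.
rewrite mxE; apply: nondecreasing_is_cvgn; first exact: digits_nd.
by exists 2 => _ [L _ <-]; exact: digits_le2.
Qed.

Lemma dpoint_ge L x j : digits L x j <= dpoint x ord0 j.
Proof.
apply: (cvgr_to_ge (@digits_cvg x j)).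
by exists L => // L' /= h; exact: digits_nd.
Qed.

Lemma dpoint_le L x j : dpoint x ord0 j <= digits L x j + slack R L j.
Proof.
apply: (cvgr_to_le (@digits_cvg x j)).
exists L => // L' /= h; apply: le_trans (digits_slack_le _ _ h).
by rewrite lerDl slack_ge0.
Qed.

Lemma dpoint02 x j : 0 <= dpoint x ord0 j <= 2.
Proof.
apply/andP; split; first exact: le_trans (dpoint_ge 0 x j).
by apply: (cvgr_to_le (@digits_cvg x j)); apply: nearW => L; exact: digits_le2.
Qed.

(** The preimage of an open set V is the union, over the countably many strings whose closed box
    lies in V, of the sets of x with that address. Closed boxes are used since the limit of the
    corners may lie on an upper face. *)
Lemma measurable_dpoint (f : 'rV[R]_n -> 'rV[R]_n) : continuous f ->
  measurable_fun setT (f \o dpoint : measurableTypeR R -> borel_rV R n).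
Proof.
move=> cf; apply: (@measurability _ _ (measurableTypeR R) (borel_rV R n) setT _ (@open 'rV[R]_n)) => //.
move=> _ [U oU <-]; rewrite setTI.
have {oU} : open (f @^-1` U) by apply: open_comp => // x _; exact: cf.
rewrite -[X in measurable X]/(dpoint @^-1` (f @^-1` U)).
move: (f @^-1` U) => V oV.
pose box s := [set y : 'rV[R]_n | forall j,
  corner R n_gt0 s j <= y ord0 j <= corner R n_gt0 s j + slack R (size s) j].
rewrite (_ : _ @^-1` _ = \bigcup_s (if `[< box s `<=` V >] then
    [set x : R | address W (size s) x = s] else set0)).
  apply: countable_bigcupT_measurable; first exact: countableP.
  by move=> s; case: ifP => _ //; exact: measurable_address.
apply/seteqP; split=> x /=; last first.
  move=> [s _]; case: ifP => // /asboolP h /= e; apply: h => j.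
  have := dpoint_ge (size s) x j; have := dpoint_le (size s) x j.
  by rewrite /digits e => -> ->.
move=> xV; have : nbhs (dpoint x) V by move: oV; rewrite openE => /(_ _ xV).
rewrite -nbhs_ballE => -[e /= e0 he].
have [L0 hL0] := slack_small n_gt0 (divr_gt0 e0 (ltr0n _ 2)).
exists (address W L0 x) => //=; rewrite size_address ifT//; apply/asboolP.
move=> y hy; apply: he; split=> // i j; rewrite !ord1 /ball /=.
have := hy j; rewrite size_address => /andP[h1 h2].
have := dpoint_ge L0 x j; have := dpoint_le L0 x j; rewrite /digits => h3 h4.
have h5 := hL0 L0 j (leqnn _).
by rewrite ltr_norml; apply/andP; split; lra.
Qed.

Variable a : multinom n -> R.
Hypothesis W_moment : forall b : multinom n,
    \sum_(s : L.-tuple bool) W s * \prod_l corner R n_gt0 s l ^+ b l @[L --> \oo] --> a b.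

(** The corners increase with the level, so monotone convergence applies; at level L the integral is
    the finite sum over strings of length L, which tends to a b. *)
Lemma integral_dpoint (b : multinom n) :
  (\int[lebesgue_root W]_(x in `[0%R, W [::][) (\prod_l dpoint x ord0 l ^+ b l)%:E = (a b)%:E)%E.
Proof.
have -> : (\int[lebesgue_root W]_(x in `[0%R, W [::][) (\prod_l dpoint x ord0 l ^+ b l)%:E =
  \int[lebesgue_root W]_(x in `[0%R, W [::][)
    limn (fun L => (\prod_l digits L x l ^+ b l)%:E))%E.
  apply: eq_integral => x _; apply/esym/cvg_lim => //.
  apply/fine_cvgP; split; first exact: nearW.
  apply: cvg_big => [|l _]; first exact: mul_continuous.
  exact: (cvg_comp _ _ (@digits_cvg x l) (@exprn_continuous _ (b l) _)).
have d0 L x l : 0 <= digits L x l by exact: corner_ge0.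
rewrite monotone_convergence//.
- apply/cvg_lim => //.
  rewrite (_ : (fun _ => _) = fun L =>
    (\sum_(s : L.-tuple bool) W s * \prod_l corner R n_gt0 s l ^+ b l)%:E).
    by apply/fine_cvgP; split; [exact: nearW|exact: W_moment].
  apply/funext => L; apply: (@integral_address _ _ W_ge0 W_split
    (fun s => \prod_l corner R n_gt0 s l ^+ b l)) => s.
  by apply: prodr_ge0 => l _; rewrite exprn_ge0// corner_ge0.
- move=> L; apply: measurable_funTS; apply/measurable_EFinP.
  exact: (@measurable_fun_address _ W _ _ (fun s => \prod_l corner R n_gt0 s l ^+ b l)).
- by move=> L x _; rewrite lee_fin prodr_ge0// => l _; rewrite exprn_ge0.
- move=> x _ L L' h; rewrite lee_fin; apply: ler_prod => l _.
  by rewrite exprn_ge0//= lerXn2r ?nnegrE// digits_nd.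
Qed.

Lemma moments_have_measure (c : R) : 0 < c ->
  exists mu : {finite_measure set borel_rV R n -> \bar R},
    mu (~` cube (0 : 'rV[R]_n) (2 * c)) = 0%E /\
    forall b : multinom n, (\int[mu]_(t in cube (0 : 'rV[R]_n) (2 * c))
      (\prod_l (t : 'rV[R]_n) ord0 l ^+ b l)%:E = (c ^+ mdeg b * a b)%:E)%E.
Proof.
move=> c0; pose Y := (fun t : 'rV[R]_n => c *: t) \o dpoint : measurableTypeR R -> borel_rV R n.
have mY : measurable_fun setT Y.
  by apply: measurable_dpoint; exact: scaler_continuous.
have Ycube x : cube (0 : 'rV[R]_n) (2 * c) (Y x).
  move=> j; have /andP[h1 h2] := dpoint02 x j; rewrite /Y /=.
  have e1 : (0 : 'rV[R]_n) ord0 j = 0 by rewrite mxE.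
  have e2 : (c *: dpoint x) ord0 j = c * dpoint x ord0 j by rewrite !mxE.
  rewrite e1 e2 add0r.
  by rewrite mulr_ge0 ?(ltW c0)//= mulrC ler_wpM2r// ltW.
pose m : {measure set borel_rV R n -> \bar R} :=
  measure_function_pushforward__canonical__measure_function_Measure (lebesgue_root W) mY.
have mT : (m setT < +oo)%E.
  rewrite /m /= /pushforward /lebesgue_root /mrestr preimage_setT setTI.
  by rewrite lebesgue_measure_itv; case: ifP => _ //=; rewrite oppr0 addr0 ltry.
have [mu muE] := finite_measureP mT; exists mu; rewrite muE; split.
  rewrite /m /= /pushforward (_ : _ @^-1` _ = set0) ?measure0//.
  by apply/seteqP; split=> // x; apply.
move=> b; etransitivity.
  apply: (@ge0_integral_pushforward _ _ _ _ R Y mY (lebesgue_root W)).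
  - exact: measurable_cube.
  - by apply: measurable_funTS; apply/measurable_EFinP; exact: measurable_monomial.
  - move=> t; rewrite inE => h; rewrite lee_fin; apply: prodr_ge0 => l _; rewrite exprn_ge0//.
    by have /andP[] := h l; rewrite mxE.
have -> : Y @^-1` cube 0 (2 * c) = setT by apply/seteqP; split=> x _ //; exact: Ycube.
have mf : measurable_fun setT (fun x : measurableTypeR R => (\prod_l dpoint x ord0 l ^+ b l)%:E).
  apply/measurable_EFinP; apply: (measurableT_comp (measurable_monomial b)).
  by apply: (@measurable_dpoint (fun t => t)) => t.
have f0 x : 0 <= \prod_l dpoint x ord0 l ^+ b l.
  by apply: prodr_ge0 => l _; rewrite exprn_ge0//; have /andP[] := dpoint02 x l.
have cb : 0 <= c ^+ mdeg b by rewrite exprn_ge0// ltW.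
etransitivity.
  (* The image measure integrates over the whole line, but [lebesgue_root] gives no mass to the
     complement of the root interval. *)
  apply: (@ge0_negligible_integral _ (measurableTypeR R) R (lebesgue_root W) setT
    (~` `[0, W [::][%classic)) => //.
  - by apply: measurableC; exact: measurable_itv.
  - apply: (measurableT_comp _ mY); apply/measurable_EFinP; exact: measurable_monomial.
  - move=> x _; rewrite lee_fin; apply: prodr_ge0 => l _; rewrite exprn_ge0//.
    by have /andP[] := Ycube x l; rewrite mxE.
  - by rewrite /= /lebesgue_root /mrestr setICl measure0.
rewrite setTD setCK EFinM -integral_dpoint -ge0_integralZl//; last 2 first.
- exact: measurable_funTS.
- by move=> x _; rewrite lee_fin.
apply: eq_integral => x _; rewrite -EFinM; congr (_%:E).
rewrite /Y /= mpoly.mdegE -prodrXr -big_split /=; apply: eq_bigr => l _.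
by rewrite mxE exprMn.
Qed.

End DigitMap.

(** * Regularity of finite Borel measures *)

Section Regularity.
Variables (R : realType) (n : nat) (mu : {finite_measure set borel_rV R n -> \bar R}).
Implicit Types B F U : set 'rV[R]_n.

(** Sets squeezed in this way between a closed and an open set form a sigma-algebra containing the
    closed sets, hence all Borel sets. *)
Definition approximable B := forall e : R, 0 < e -> exists F U,
  [/\ closed F, open U, F `<=` B, B `<=` U & (mu (U `\` F) <= e%:E)%E].

Lemma measurable_open U : open U -> measurable (U : set (borel_rV R n)).
Proof. by move=> oU; exact: sub_sigma_algebra. Qed.

Lemma measurable_closed F : closed F -> measurable (F : set (borel_rV R n)).
Proof.
move=> cF; rewrite -[F]setCK; apply: measurableC; apply: measurable_open.
exact: closed_openC.
Qed.

Lemma measure_small (D : nat -> set (borel_rV R n)) (e : R) : 0 < e ->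
  (forall k, measurable (D k)) -> nonincreasing_seq D ->
  (mu (\bigcap_k D k) < e%:E)%E -> exists k, (mu (D k) <= e%:E)%E.
Proof.
move=> e0 mD nD h.
have mT : (mu (D 0%N) < +oo)%E by rewrite -ge0_fin_numE ?fin_num_measure.
have c := nonincreasing_cvg_mu mT mD (bigcapT_measurable mD) nD.
apply: contrapT => /forallNP hn.
have : (e%:E <= mu (\bigcap_k D k))%E.
  apply: (cvge_to_ge c); apply: nearW => k; rewrite leNgt; apply/negP => /ltW; exact: hn.
by rewrite leNgt h.
Qed.

Lemma approximable_closed F : closed F -> approximable F.
Proof.
move=> cF e e0.
pose U k : set 'rV[R]_n := \bigcup_(y in F) (ball y (k.+1%:R^-1 : R))^°.
have oU k : open (U k) by apply: bigcup_open => y _; exact: open_interior.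
have FU k : F `<=` U k by move=> y Fy; exists y => //; exact: nbhsx_ballx.
have UF : \bigcap_k U k `<=` F.
  move=> x Ux; apply: cF => B; rewrite -nbhs_ballE => -[d /= d0 dB].
  have [k] := ltr_add_invr d0; rewrite add0r => hk.
  have [y Fy /interior_subset xy] := Ux k I.
  exists y; split=> //; apply: dB; apply: ball_sym.
  exact: le_ball (ltW hk) _ xy.
have [k|k l kl||k hk] := @measure_small (fun k => U k `\` F) e e0 _ _ _.
- by apply: measurableD; [exact: measurable_open|exact: measurable_closed].
- apply/subsetPset; apply: setSD => x [y Fy xy]; exists y => //.
  apply: filterS xy; apply: le_ball.
  by rewrite lef_pV2 ?posrE ?ltr0n// ler_nat ltnS.
- rewrite (_ : \bigcap_k _ = set0) ?measure0 ?lte_fin//.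
  apply/seteqP; split=> // x h; have [_ nF] := h 0%N I; apply: nF; apply: UF => k _.
  by have [] := h k I.
by exists F, (U k); split.
Qed.

Lemma approximable_setC B : approximable B -> approximable (~` B).
Proof.
move=> aB e e0; have [F [U [cF oU FB BU h]]] := aB e e0.
exists (~` U), (~` F); split.
- exact: open_closedC.
- exact: closed_openC.
- exact: subsetC.
- exact: subsetC.
- by rewrite (_ : _ `\` _ = U `\` F)// setDE setCK setIC.
Qed.

Lemma approximable_bigcup (B : nat -> set 'rV[R]_n) :
  (forall k, approximable (B k)) -> approximable (\bigcup_k B k).
Proof.
move=> aB e e0.
have e40 : 0 < e / 4 by rewrite divr_gt0.
have ek0 k : 0 < e / 4 / (2 ^ k.+1)%:R by rewrite divr_gt0// ltr0n expn_gt0.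
have [F hF] := boolp.choice (fun k => aB k _ (ek0 k)).
have {hF}[U hU] := boolp.choice hF.
(* Only finite unions of the closed sets F k are known to be closed; continuity from above provides
   the cut-off N. *)
pose V := \bigcup_k U k; pose G N := \bigcup_(k < N) F k.
have mF k : measurable (F k : set (borel_rV R n)).
  by apply: measurable_closed; have [] := hU k.
have mU k : measurable (U k : set (borel_rV R n)).
  by apply: measurable_open; have [] := hU k.
have mV : measurable (V : set (borel_rV R n)) by exact: bigcupT_measurable.
have [N|k l kl||N hN] := @measure_small (fun N => V `\` G N) e e0 _ _ _.
- apply: measurableD => //; exact: bigcup_measurable.
- apply/subsetPset; apply: setDS => x [i /= ik Fx]; exists i => //=.
  exact: leq_trans ik kl.
- apply: (@le_lt_trans _ _ (\sum_(k <oo) mu (U k `\` F k))%E).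
    apply: measure_sigma_subadditive => //.
    + by move=> k; exact: measurableD.
    + apply: bigcapT_measurable => k; apply: measurableD => //; exact: bigcup_measurable.
    + move=> x h; have [[k _ Uk] _] := h 0%N I; exists k => //; split=> // Fk.
      by have [_] := h k.+1 I; apply; exists k => /=.
  apply: (@le_lt_trans _ _ (e / 4)%:E).
    apply: le_trans (@epsilon_trick0 R (e / 4) xpredT (ltW e40)).
    by apply: lee_nneseries => // k _; have [] := hU k.
  by rewrite lte_fin ltr_pdivrMr// ltr_pMr// ltr1n.
exists (G N), V; split=> //.
- by apply: closed_bigcup => [|k _]; [exact: finite_II|have [] := hU k].
- by apply: bigcup_open => k _; have [] := hU k.
- by move=> x [k _ Fk]; exists k => //; have [_ _ h _ _] := hU k; exact: h.
- by move=> x [k _ Bk]; exists k => //; have [_ _ _ h _] := hU k; exact: h.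
Qed.

Lemma approximable_measurable (B : set (borel_rV R n)) : measurable B -> approximable B.
Proof.
move: B; apply: smallest_sub.
  split.
  - apply: approximable_closed; exact: closed0.
  - by move=> B aB; rewrite setTD; exact: approximable_setC.
  - exact: approximable_bigcup.
move=> U oU; rewrite -[U]setCK; apply: approximable_setC; apply: approximable_closed.
exact: open_closedC.
Qed.

Lemma cube_compact (a : 'rV[R]_n) s : compact (cube a s).
Proof.
have -> : cube a s = [set v : 'rV[R]_n | forall j, `[a ord0 j, a ord0 j + s]%classic (v ord0 j)].
  by apply/seteqP; split=> t h j; have := h j; rewrite /= in_itv.
by apply: (@rV_compact R n (fun j => `[a ord0 j, a ord0 j + s]%classic)) => j; exact: segment_compact.
Qed.

(** Approximation from inside by closed sets becomes approximation by compact sets after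
    intersecting with the cube, whose complement is null. *)
Lemma finite_measure_regular (a : 'rV[R]_n) s :
  mu (~` cube a s) = 0%E -> regular_measure mu.
Proof.
move=> mu0 B mB; split; apply/eqP; rewrite eq_le; apply/andP; split.
- apply: le_ereal_inf_tmp => _ [U [oU BU] <-].
  by apply: le_measure; rewrite ?inE//; exact: measurable_open.
- apply/lee_addgt0Pr => e e0; have [F [U [cF oU FB BU h]]] := approximable_measurable mB e0.
  have mU := measurable_open oU; have mF := measurable_closed cF.
  apply: (@le_trans _ _ (mu U)); first by apply: ereal_inf_lbound; exists U.
  have {1}-> : U = B `|` (U `\` B) by rewrite setDUK.
  apply: le_trans (measureU2 _ mB (measurableD mU mB)) _.
  rewrite leeD2l//; apply: le_trans h; apply: le_measure.
  + by rewrite inE; exact: measurableD.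
  + by rewrite inE; exact: measurableD.
  + exact: setDS.
- apply/lee_addgt0Pr => e e0; have [F [U [cF oU FB BU h]]] := approximable_measurable mB e0.
  have mU := measurable_open oU; have mF := measurable_closed cF.
  have mC := measurable_cube a s.
  have mK := measurableI _ _ mC mF.
  have mUF := measurableD mU mF.
  apply: (@le_trans _ _ (mu (cube a s `&` F) + e%:E)%E); last first.
    rewrite leeD2r//; apply: ereal_sup_ubound; exists (cube a s `&` F) => //; split.
      by apply: compact_closedI => //; exact: cube_compact.
    by move=> x [_ Fx]; exact: FB.
  apply: (@le_trans _ _ (mu ((cube a s `&` F) `|` ((U `\` F) `|` ~` cube a s)))).
    apply: le_measure; rewrite ?inE//.
      by apply: measurableU => //; apply: measurableU => //; exact: measurableC.
    move=> x Bx; have [Cx|] := pselect (cube a s x); last by right; right.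
    have [Fx|] := pselect (F x); first by left.
    by right; left; split=> //; exact: BU.
  apply: le_trans (measureU2 _ mK _) _; first by apply: measurableU => //; exact: measurableC.
  rewrite leeD2l//; apply: le_trans (measureU2 _ mUF (measurableC mC)) _.
  by rewrite [X in (_ + X)%E](_ : _ = 0%E) ?adde0//; exact: mu0.
- apply: ge_ereal_sup => _ [K [cK KB] <-].
  apply: le_measure; rewrite ?inE//; apply: measurable_closed.
  by apply: compact_closed => //; exact: pseudo_metric_hausdorff.
Qed.

End Regularity.

Lemma bwt_moment_cvg (R : realType) (n : nat) (a : multinom n -> R)
  (a_pos : forall i k : 'I_n -> nat,
    0 <= mfun a (\prod_l (@mpolyX n R (mnm1 l) ^+ i l * (1 - @mpolyX n R (mnm1 l)) ^+ k l)))
  (b : multinom n) :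
  \sum_i @bwt R n a K.+1 i * \prod_l bpt R i l ^+ b l @[K --> \oo] --> a b.
Proof.
set S := \sum_l (b l ^ 2)%:R : R.
have C0 : 0 <= a (@mnm0 n) * S.
  rewrite mulr_ge0//; last by apply: sumr_ge0.
  by rewrite -(bwt_sum a 0) sumr_ge0// => i _; exact: bwt_ge0.
apply/cvgrPdist_le => e e0.
have d0 : 0 < e / (a (@mnm0 n) * S + 1) by rewrite divr_gt0// ltr_wpDl.
have [q hq] := ltr_add_invr d0; rewrite add0r in hq.
exists (maxn q (\sum_l b l)) => // K /=; rewrite geq_max => /andP[qK bK].
rewrite distrC; apply: le_trans (bwt_moment a_pos _ _) _ => //.
  by move=> l; apply: leq_trans (leqW bK); rewrite (bigD1 l)//= leq_addr.
rewrite -/S ler_pdivrMr ?ltr0n//.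
have h : (K.+1%:R)^-1 <= e / (a (@mnm0 n) * S + 1) :> R.
  by apply: le_trans (ltW hq); rewrite lef_pV2 ?posrE ?ltr0n// ler_nat.
have C1 : 0 < a (@mnm0 n) * S + 1 by rewrite ltr_wpDl.
move: h; rewrite ler_pdivlMr// mulrC ler_pdivrMr ?ltr0n// => h.
by apply: le_trans h; rewrite lerDl.
Qed.

(** Division by c^|b| moves the problem to the unit cube, where Bernstein polynomials live; the
    digit map is then scaled by c. *)
Lemma hausdorff_of_bernstein (R : realType) (n : nat) (a : multinom n -> R) (c : R) :
  (0 < n)%N -> 0 < c -> (forall b, 0 < a b) ->
  (forall i k : 'I_n -> nat, 0 <= mfun (fun b => a b / c ^+ mdeg b)
    (\prod_l (@mpolyX n R (mnm1 l) ^+ i l * (1 - @mpolyX n R (mnm1 l)) ^+ k l))) ->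
  hausdorff_moment a.
Proof.
move=> n0 c0 a0 a_pos; split=> //.
pose a' b := a b / c ^+ mdeg b.
have [W [W0 WS Wn Wm]] := @limit_masses R n a' n0 (fun K => {ffun 'I_n -> 'I_K.+2})
  (fun K => @bwt R n a' K.+1) (fun K => @bpt R n K.+1)
  (fun K i => bwt_ge0 a_pos i) (fun K => bwt_sum a' K.+1)
  (fun K i l => @bpt01 R n K.+1 i l isT) (bwt_moment_cvg a_pos).
have [mu [mu0 mu_m]] := moments_have_measure W0 WS Wm c0.
exists mu, 0, (2 * c); split=> //.
- exact: finite_measure_regular mu0.
- by split=> [|j]; [rewrite mulr_gt0|rewrite mxE].
- by move=> b; rewrite mu_m /a' mulrCA divff ?mulr1// expf_neq0// gt_eqF.
Qed.

(** * Torus averages of kernel functions *)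

Section UnorderedSums.
Variables (C : numClosedFieldType) (T : choiceType).
Implicit Types (a b : T -> C) (s : C) (J : seq T).

Definition hassum a s := forall e : C, 0 < e -> exists J0, forall J,
  uniq J -> {subset J0 <= J} -> `|\sum_(t <- J) a t - s| <= e.

Lemma hassum_ext a b s : a =1 b -> hassum a s -> hassum b s.
Proof. by move=> ab ha e e0; have [J0 h] := ha e e0; exists J0 => J u i; rewrite -(eq_bigr _ (fun t _ => ab t)) h. Qed.

Lemma hassum0 : hassum (fun=> 0) 0.
Proof. by move=> e e0; exists [::] => J _ _; rewrite big1// subr0 normr0 ltW. Qed.

Lemma hassumD a b s t : hassum a s -> hassum b t -> hassum (fun x => a x + b x) (s + t).
Proof.
move=> ha hb e e0; have e20 : 0 < e / 2 by rewrite divr_gt0.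
have [J0 h0] := ha _ e20; have [J1 h1] := hb _ e20.
exists (J0 ++ J1) => J uJ sJ; rewrite big_split /= opprD addrACA.
apply: le_trans (ler_normD _ _) _; rewrite [leRHS](splitr e); apply: lerD.
  by apply: h0 => // x xJ; apply: sJ; rewrite mem_cat xJ.
by apply: h1 => // x xJ; apply: sJ; rewrite mem_cat xJ orbT.
Qed.

Lemma hassumZ c a s : hassum a s -> hassum (fun x => c * a x) (c * s).
Proof.
move=> ha e e0; have c1 : 0 < `|c| + 1 by rewrite ltr_wpDl.
have [J0 h0] := ha _ (divr_gt0 e0 c1); exists J0 => J uJ sJ.
rewrite -mulr_sumr -mulrBr normrM; have := h0 J uJ sJ; rewrite ler_pdivlMr// => h.
by apply: le_trans h; rewrite mulrC ler_wpM2l// lerDl.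
Qed.

Lemma hassum_lincomb (I : Type) (r : seq I) (c : I -> C) (a : I -> T -> C) (s : I -> C) :
  (forall i, hassum (a i) (s i)) ->
  hassum (fun x => \sum_(i <- r) c i * a i x) (\sum_(i <- r) c i * s i).
Proof.
move=> h; elim: r => [|i r ih].
  by rewrite big_nil; apply: hassum_ext hassum0 => x; rewrite big_nil.
rewrite big_cons; apply: hassum_ext (hassumD (hassumZ (c i) (h i)) ih) => x.
by rewrite big_cons.
Qed.

Lemma hassum_tail a s e : hassum a s -> 0 < e -> exists J0 : seq T, forall J,
  uniq J -> (forall t, t \in J -> t \notin J0) -> `|\sum_(t <- J) a t| <= e.
Proof.
move=> ha e0; have [J0 h0] := ha _ (divr_gt0 e0 (ltr0n _ 2)).
exists J0 => J uJ dJ; have uU : uniq (undup J0 ++ J).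
  rewrite cat_uniq undup_uniq uJ andbT /=; apply/hasPn => t /dJ.
  by rewrite mem_undup.
rewrite [e]splitr.
have -> : \sum_(t <- J) a t = (\sum_(t <- undup J0 ++ J) a t - s) - (\sum_(t <- undup J0) a t - s).
  by rewrite big_cat /=; ring.
apply: le_trans (ler_normB _ _) _; apply: lerD; apply: h0 => //.
- by move=> t tJ; rewrite mem_cat mem_undup tJ.
- exact: undup_uniq.
- by move=> t; rewrite mem_undup.
Qed.

(* Only finitely many terms of the series matter, and [c] keeps none of those except [t0]. *)
Lemma hassum_restrict a s e : hassum a s -> 0 < e -> exists J0 : seq T,
  forall (c : pred T) t0 l, (forall t, t \in J0 -> c t -> t = t0) ->
    hassum (fun t => (c t)%:R * a t) l -> `|l - (c t0)%:R * a t0| <= e.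
Proof.
move=> ha e0; have e20 := divr_gt0 e0 (ltr0n C 2).
have [J0 h0] := hassum_tail ha e20; exists J0 => c t0 l hc hl.
have [J1 h1] := hl _ e20.
pose J := undup (t0 :: J1).
have tJ : t0 \in J by rewrite mem_undup mem_head.
have uJ : uniq J by exact: undup_uniq.
have hJ : `|\sum_(t <- J) (c t)%:R * a t - l| <= e / 2.
  by apply: h1 => // t tJ1; rewrite mem_undup inE tJ1 orbT.
rewrite (bigD1_seq t0)//= in hJ.
have hK : `|\sum_(t <- J | t != t0) (c t)%:R * a t| <= e / 2.
  rewrite (eq_bigr (fun t => if c t then a t else 0)); last by move=> t _; case: (c t); rewrite ?mul1r ?mul0r.
  rewrite -big_mkcondr -big_filter; apply: h0; first exact: filter_uniq.
  move=> t; rewrite mem_filter => /andP[/andP[tt0 ct] _]; apply/negP => /hc/(_ ct) h.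
  by rewrite h eqxx in tt0.
set x := \sum_(t <- J | _) _ in hJ hK.
have -> : l - (c t0)%:R * a t0 = x - ((c t0)%:R * a t0 + x - l) by ring.
by apply: le_trans (ler_normB _ _) _; rewrite [e]splitr lerD.
Qed.

End UnorderedSums.

Section TorusAverages.
Variables (C : numClosedFieldType) (n : nat).
Implicit Types (x y : 'I_n -> C) (b d : multinom n).

Definition mon x b : C := \prod_j x j ^+ b j.
Definition pmul x y : 'I_n -> C := fun j => x j * y j.
Definition pconj x : 'I_n -> C := fun j => (x j)^*.

Lemma mon_pmul x y b : mon (pmul x y) b = mon x b * mon y b.
Proof. by rewrite -big_split /=; apply: eq_bigr => j _; rewrite exprMn. Qed.

Lemma mon_pconj x b : mon (pconj x) b = (mon x b)^*.
Proof. by rewrite rmorph_prod; apply: eq_bigr => j _; rewrite /pconj rmorphXn. Qed.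

Lemma monD x b d : mon x (mnm_add b d) = mon x b * mon x d.
Proof. by rewrite -big_split /=; apply: eq_bigr => j _; rewrite mpoly.mnmDE exprD. Qed.

Definition prim_root K : C := projT1 (cid (@prim_root_exists C K.+1 isT)).

Lemma prim_rootP K : K.+1.-primitive_root (prim_root K).
Proof. by rewrite /prim_root; case: cid. Qed.

Definition tor K (s : {ffun 'I_n -> 'I_K.+1}) : 'I_n -> C := fun j => prim_root K ^+ s j.

Lemma tor_norm K (s : {ffun 'I_n -> 'I_K.+1}) j : `|tor s j| = 1.
Proof. exact: prim_root_norm (prim_rootP K) _. Qed.

(** Averages over roots of unity of order K + 1 see exponents only modulo K + 1; [cong_eq] says when
    no aliasing occurs. *)
Definition cong K b d := [forall j, b j == d j %[mod K.+1]].

Lemma tor_sum K b d :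
  (K.+1%:R ^+ n)^-1 * \sum_(s : {ffun 'I_n -> 'I_K.+1}) mon (tor s) b * mon (pconj (tor s)) d
  = (cong K b d)%:R.
Proof.
under eq_bigr do rewrite -big_split /=.
rewrite -(bigA_distr_bigA (fun j (k : 'I_K.+1) =>
  (prim_root K ^+ k) ^+ b j * ((prim_root K ^+ k)^*) ^+ d j)).
under eq_bigr do rewrite root_of_unity_sum ?prim_rootP//.
rewrite /cong; case: (boolP [forall j, _]) => [/forallP h|/forallPn[j hj]].
  rewrite (eq_bigr (fun=> K.+1%:R)) => [|j _]; last by rewrite h.
  by rewrite prodr_const card_ord mulVf// expf_neq0// pnatr_eq0.
by rewrite (bigD1 j)//= (negPf hj) mul0r mulr0.
Qed.

Lemma cong_eq K b d : (\sum_j b j <= K)%N -> (\sum_j d j <= K)%N -> cong K b d -> b = d.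
Proof.
move=> bK dK /forallP h; apply/mpoly.mnmP => j; have := h j.
have le (e : multinom n) : (\sum_j e j <= K -> e j < K.+1)%N.
  by move=> eK; rewrite ltnS (leq_trans _ eK)// (bigD1 j)//= leq_addr.
by rewrite !modn_small ?le// => /eqP.
Qed.

Lemma cong_refl K b : cong K b b.
Proof. exact/forallP. Qed.

End TorusAverages.

(** * Coefficientwise order and truncations of the kernel *)

Section CoefficientOrder.
Variables (C : numDomainType) (n : nat).
Implicit Types p q : {mpoly C[n]}.

Definition coefle p q := forall b, mcoeff b p <= mcoeff b q.

Lemma coefle_refl p : coefle p p. Proof. by []. Qed.

Lemma coefle_trans q p r : coefle p q -> coefle q r -> coefle p r.
Proof. by move=> h1 h2 b; apply: le_trans (h1 b) (h2 b). Qed.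

Lemma coefleD p p' q q' : coefle p q -> coefle p' q' -> coefle (p + p') (q + q').
Proof. by move=> h h' b; rewrite !mpoly.mcoeffD lerD. Qed.

Lemma coefle0M p q : coefle 0 p -> coefle 0 q -> coefle 0 (p * q).
Proof.
move=> h h' b; rewrite mpoly.mcoeff0 mpoly.mcoeffM; apply: sumr_ge0 => k _.
by have := h k.1; have := h' k.2; rewrite !mpoly.mcoeff0 => *; rewrite mulr_ge0.
Qed.

Lemma coefleB0 p q : coefle p q <-> coefle 0 (q - p).
Proof.
by split=> h b; have := h b; rewrite mpoly.mcoeff0 mpoly.mcoeffB subr_ge0.
Qed.

Lemma coefleM p p' q q' : coefle 0 p -> coefle 0 p' ->
  coefle p q -> coefle p' q' -> coefle (p * p') (q * q').
Proof.
move=> p0 p'0 h h'; apply/coefleB0.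
have -> : q * q' - p * p' = (q - p) * p' + q * (q' - p') by ring.
rewrite -[X in coefle X _]addr0; apply: coefleD; apply: coefle0M => //.
- exact: (coefleB0 _ _).1.
- exact: coefle_trans p0 h.
- exact: (coefleB0 _ _).1.
Qed.

Lemma coefle01 : coefle 0 1.
Proof. by move=> b; rewrite mpoly.mcoeff0 mpoly.mcoeff1 ler0n. Qed.

Lemma coefle_prod (I : Type) (r : seq I) (p q : I -> {mpoly C[n]}) :
  (forall i, coefle 0 (p i)) -> (forall i, coefle (p i) (q i)) ->
  coefle 0 (\prod_(i <- r) p i) /\ coefle (\prod_(i <- r) p i) (\prod_(i <- r) q i).
Proof.
move=> h0 h; elim: r => [|i r [ih0 ih]]; first by rewrite !big_nil; split=> //; exact: coefle01.
by rewrite !big_cons; split; [exact: coefle0M|exact: coefleM].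
Qed.

Lemma coefle_prod_le (I : Type) (r : seq I) (p q : I -> {mpoly C[n]}) :
  (forall i, coefle 0 (p i)) -> (forall i, coefle (p i) (q i)) ->
  coefle (\prod_(i <- r) p i) (\prod_(i <- r) q i).
Proof. by move=> h0 h; have [] := coefle_prod r h0 h. Qed.

Lemma coefleX p q k : coefle 0 p -> coefle p q -> coefle (p ^+ k) (q ^+ k).
Proof.
move=> p0 pq; have := (coefle_prod (index_enum 'I_k) (fun=> p0) (fun=> pq)).2.
by rewrite !prodr_const card_ord.
Qed.

Lemma coefle0X p k : coefle 0 p -> coefle 0 (p ^+ k).
Proof.
move=> p0; elim: k => [|k ih]; first exact: coefle01.
by rewrite exprS; exact: coefle0M.
Qed.

Lemma coefle0_sum (I : Type) (r : seq I) (Q : pred I) (p : I -> {mpoly C[n]}) :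
  (forall i, coefle 0 (p i)) -> coefle 0 (\sum_(i <- r | Q i) p i).
Proof.
move=> h; elim/big_ind: _ => // x y hx hy.
by rewrite -[X in coefle X _]addr0; exact: coefleD.
Qed.

Lemma coefle_addr p q : coefle 0 q -> coefle p (p + q).
Proof. by move=> h; rewrite -[X in coefle X _]addr0; apply: coefleD. Qed.

End CoefficientOrder.

Section Truncations.
Variables (C : completeClosedField) (n : nat).
Variables (P : 'I_n -> {mpoly C[n]}) (m : 'I_n -> nat).
Hypothesis P_ge0 : forall j, coefle 0 (P j).
Hypothesis P_lin : forall j, 0 < mcoeff (mnm1 j) (P j).
Hypothesis m_gt0 : forall j, (0 < m j)%N.

Definition trunc k : {mpoly C[n]} := \prod_j (\sum_(i < k) P j ^+ i) ^+ m j.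
Definition kerfun (x : 'I_n -> C) : C := \prod_j (1 - meval x (P j)) ^- m j.

Let geo_ge0 k j : coefle 0 (\sum_(i < k) P j ^+ i).
Proof.
by apply: coefle0_sum => i; exact: coefle0X.
Qed.

Lemma trunc_ge0 k : coefle 0 (trunc k).
Proof.
by have [] := @coefle_prod C n _ (index_enum 'I_n) _ (fun j => (\sum_(i < k) P j ^+ i) ^+ m j)
  (fun j => coefle0X (m j) (geo_ge0 k j)) (fun j => @coefle_refl _ _ _).
Qed.

Lemma trunc_nd k k' : (k <= k')%N -> coefle (trunc k) (trunc k').
Proof.
move/subnK => <-; elim: (k' - k)%N => // d; rewrite addSn; move/coefle_trans; apply.
apply: coefle_prod_le => j; first exact: coefle0X.
apply: coefleX => //; rewrite big_ord_recr /=.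
by apply: coefle_addr; exact: coefle0X.
Qed.

(** Coefficientwise, (a_j X_j)^(b_j) is below P_j^(b_j), which is one term of the geometric sum, and
    this sum is below its m_j-th power because m_j >= 1. *)
Lemma trunc_gt0 (b : multinom n) k : (forall j, b j < k)%N -> 0 < mcoeff b (trunc k).
Proof.
move=> bk; pose a j := mcoeff (mnm1 j) (P j).
have aP j : coefle (a j *: mpolyX C (mnm1 j)) (P j).
  move=> d; rewrite mpoly.mcoeffZ mpoly.mcoeffX; case: eqVneq => [<-|_]; first by rewrite mulr1.
  by rewrite mulr0; have := P_ge0 j d; rewrite mpoly.mcoeff0.
have aX0 j : coefle 0 (a j *: mpolyX C (mnm1 j)).
  by move=> d; rewrite mpoly.mcoeff0 mpoly.mcoeffZ mpoly.mcoeffX mulr_ge0// ltW// /a.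
have geo1 j : coefle (P j ^+ b j) (\sum_(i < k) P j ^+ i).
  rewrite (bigD1 (Ordinal (bk j)))//=; apply: coefle_addr.
  by apply: coefle0_sum => i; exact: coefle0X.
have geo2 j : coefle (\sum_(i < k) P j ^+ i) ((\sum_(i < k) P j ^+ i) ^+ m j).
  rewrite -(prednK (m_gt0 j)) exprS -[X in coefle X _]mulr1.
  apply: coefleM => //; first exact: coefle01.
  rewrite -[X in coefle X _](expr1n _ (m j).-1); apply: coefleX; first exact: coefle01.
  have k0 : (0 < k)%N by exact: leq_trans (bk j).
  rewrite (bigD1 (Ordinal k0))//= expr0; apply: coefle_addr.
  by apply: coefle0_sum => i; exact: coefle0X.
have h : coefle (\prod_j (a j *: mpolyX C (mnm1 j)) ^+ b j) (trunc k).
  apply: coefle_prod_le => j; first exact: coefle0X.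
  apply: coefle_trans (geo2 j); apply: coefle_trans (geo1 j).
  exact: coefleX.
apply: lt_le_trans (h b).
under eq_bigr do rewrite exprZn.
rewrite scaler_prod -mpoly.mpolyXE_id mpoly.mcoeffZ mpoly.mcoeffX eqxx mulr1.
by apply: prodr_gt0 => j _; rewrite exprn_gt0 // /a.
Qed.

Lemma meval_coefle p q (x : 'I_n -> C) : (forall j, 0 <= x j) -> coefle p q ->
  meval x p <= meval x q.
Proof.
move=> x0 /coefleB0 h; rewrite -subr_ge0 -mpoly.mevalB mpoly.mevalE; apply: sumr_ge0 => b _.
have := h b; rewrite mpoly.mcoeff0 => hb; rewrite mulr_ge0// prodr_ge0// => j _.
exact: exprn_ge0.
Qed.

Lemma meval_norm p (x : 'I_n -> C) : coefle 0 p ->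
  `|meval x p| <= meval (fun j => `|x j|) p.
Proof.
move=> h; rewrite !mpoly.mevalE; apply: le_trans (ler_norm_sum _ _ _) _.
apply: ler_sum => b _; have := h b; rewrite mpoly.mcoeff0 => hb.
rewrite normrM (ger0_norm hb) normr_prod ler_wpM2l//.
by under eq_bigr do rewrite normrX.
Qed.

Lemma tends_geometric (q : C) : `|q| < 1 -> tends (fun k => \sum_(i < k) q ^+ i) (1 - q)^-1.
Proof.
move=> q1; have q1' : 1 - q != 0.
  by rewrite subr_eq0; apply: contraTneq q1 => <-; rewrite normr1 ltxx.
suff h : tends (fun k => q ^+ k) 0.
  apply: tends_ext (_ : tends (fun k => (1 - q)^-1 * (1 - q ^+ k)) _) => [k|].
    apply: (mulfI q1'); rewrite mulrA mulfV// mul1r -[LHS]opprK opprB subrX1 -mulNr opprB.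
    by [].
  rewrite -[X in tends _ X]mulr1 -[X in tends _ (_ * X)]subr0.
  by apply: tendsZ; apply: tendsB => //; exact: tends_cst.
have [->|q0] := eqVneq q 0.
  by move=> e e0; exists 1%N => -[//|k] _; rewrite expr0n subrr normr0.
have nq0 : 0 < `|q| by rewrite normr_gt0.
move=> e e0; pose t := `|q|^-1.
have t1 : 1 < t by rewrite invf_gt1.
have et : 0 < e * (t - 1) by rewrite mulr_gt0// subr_gt0.
have [N hN] := ccf_archi et; exists N.+1 => k hk; rewrite subr0 normrX.
have := bernoulli_inequality k (ltW t1) => hb.
have tk : e^-1 < t ^+ k.
  apply: lt_le_trans hb; rewrite ltr_wpDl// -mulr_natr -ltr_pdivrMl ?subr_gt0//.
  rewrite -invfM mulrC.
  apply: lt_le_trans (_ : N.+1%:R <= _); last by rewrite ler_nat.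
  by rewrite invf_plt ?posrE ?ltr0n.
have : (t ^+ k)^-1 < e by rewrite invf_plt ?posrE// exprn_gt0// (lt_trans ltr01).
by rewrite /t exprVn invrK.
Qed.

Lemma tendsX (u : nat -> C) a k : tends u a -> tends (fun i => u i ^+ k) (a ^+ k).
Proof.
move=> h; elim: k => [|k ih]; first exact: tends_cst.
by rewrite exprS; apply: tends_ext (tendsM h ih) => i; rewrite exprS.
Qed.

Lemma tends_prod (I : Type) (r : seq I) (u : I -> nat -> C) (l : I -> C) :
  (forall i, tends (u i) (l i)) -> tends (fun k => \prod_(i <- r) u i k) (\prod_(i <- r) l i).
Proof.
move=> h; elim: r => [|i r ih].
  by rewrite big_nil; apply: tends_ext (tends_cst 1) => k; rewrite big_nil.
by rewrite big_cons; apply: tends_ext (tendsM (h i) ih) => k; rewrite big_cons.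
Qed.

Lemma trunc_tends x : (forall j, `|meval x (P j)| < 1) ->
  tends (fun k => meval x (trunc k)) (kerfun x).
Proof.
move=> h; apply: tends_ext (_ : tends (fun k => \prod_j (\sum_(i < k) meval x (P j) ^+ i) ^+ m j) _).
  move=> k; rewrite /trunc rmorph_prod; apply: eq_bigr => j _; rewrite rmorphXn; congr (_ ^+ _).
  by rewrite rmorph_sum; apply: eq_bigr => i _; rewrite rmorphXn.
by apply: tends_prod => j; rewrite -exprVn; apply: tendsX; exact: tends_geometric.
Qed.

End Truncations.

Lemma meval_le_arg (C : numDomainType) (n : nat) (p : {mpoly C[n]}) (x y : 'I_n -> C) :
  coefle 0 p -> (forall j, 0 <= x j <= y j) -> meval x p <= meval y p.
Proof.
move=> p0 xy; rewrite !mpoly.mevalE; apply: ler_sum => b _.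
have := p0 b; rewrite mpoly.mcoeff0 => hb; rewrite ler_wpM2l//.
apply: ler_prod => j _; have /andP[x0 h] := xy j.
by rewrite exprn_ge0//= lerXn2r// nnegrE (le_trans x0 h).
Qed.

Section KernelCoefficients.
Variables (C : completeClosedField) (n : nat).
Variables (P : 'I_n -> {mpoly C[n]}) (m : 'I_n -> nat).
Hypothesis P_ge0 : forall j, coefle 0 (P j).
Hypothesis P_0 : forall j, mcoeff (@mnm0 n) (P j) = 0.
Hypothesis P_lin : forall j, 0 < mcoeff (mnm1 j) (P j).
Hypothesis m_gt0 : forall j, (0 < m j)%N.
Variables (A : multinom n -> C) (rho : C).
Hypothesis rho_gt0 : 0 < rho.
Hypothesis A_sum : forall x : 'I_n -> C, (forall j, `|x j| < rho) ->
  hassum (fun b => A b * mon x b) (kerfun P m x).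

(** As P_j has no constant term, P_j(t, ..., t) <= t P_j(1, ..., 1) for t < 1. Hence t = q / B
    works, with q below 1 and rho and B above all P_j(1, ..., 1) + c_j. *)
Lemma small_radius (c : 'I_n -> C) : (forall j, 0 <= c j) ->
  exists t : C, [/\ 0 < t, t < 1, t < rho &
    forall j, t * c j < rho /\ meval (fun=> t) (P j) < 1].
Proof.
move=> c0; pose S j := meval (fun=> 1) (P j).
have S0 j : 0 <= S j.
  by have := @meval_coefle C n 0 (P j) (fun=> 1) (fun=> ler01) (P_ge0 j); rewrite mpoly.meval0.
pose B := 1 + \sum_j (S j + c j).
have SB j : S j + c j < B.
  rewrite /B (bigD1 j)//= [ltRHS]addrCA ltrDl ltr_pwDl//.
  by apply: sumr_ge0 => i _; rewrite addr_ge0.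
have B1 : 1 <= B by rewrite lerDl sumr_ge0// => i _; rewrite addr_ge0.
have B0 : 0 < B := lt_le_trans ltr01 B1.
have r1 : 0 < 1 + rho by rewrite addr_gt0.
pose q := rho / (1 + rho); have q0 : 0 < q by rewrite divr_gt0.
have q1 : q < 1 by rewrite ltr_pdivrMr// mul1r ltrDr.
have qr : q < rho by rewrite ltr_pdivrMr// ltr_pMr// ltrDl.
pose t := q / B; have t0 : 0 < t by rewrite divr_gt0.
have tq : t <= q by rewrite ler_pdivrMr// ler_peMr// ltW.
have tB : t * B = q by rewrite /t mulfVK// gt_eqF.
have t1 : t < 1 by apply: le_lt_trans q1.
exists t; split=> //; first exact: le_lt_trans qr.
move=> j; split.
  apply: le_lt_trans qr; rewrite -tB ler_pM2l// ltW//.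
  by apply: le_lt_trans (SB j); rewrite lerDr.
apply: (@le_lt_trans _ _ (t * S j)); last first.
  apply: lt_trans q1; rewrite -tB ltr_pM2l//.
  by apply: le_lt_trans (SB j); rewrite lerDl.
rewrite /S !mpoly.mevalE mulr_sumr; apply: ler_sum => b _.
under [X in t * (_ * X)]eq_bigr do rewrite expr1n.
rewrite big1_eq mulr1 mulrC.
have := P_ge0 j b; rewrite mpoly.mcoeff0 => hb.
have [->|b0] := eqVneq b (@mnm0 n); first by rewrite P_0 !mulr0.
rewrite ler_wpM2r// prodrXr -mpoly.mdegE.
have : (0 < mdeg b)%N by rewrite lt0n mpoly.mdeg_eq0.
case: (mdeg b) => // k _; rewrite exprS ler_piMr// ?(ltW t0)//.
by rewrite exprn_ile1// ltW.
Qed.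

Definition tavg K (b : multinom n) (f : ('I_n -> C) -> C) : C :=
  (K.+1%:R ^+ n)^-1 * \sum_(s : {ffun 'I_n -> 'I_K.+1}) mon (tor C s) b * f (pconj (tor C s)).

Lemma tavg_mon K b d : tavg K b (fun y => mon y d) = (cong K b d)%:R.
Proof. exact: tor_sum. Qed.

Lemma pmul_norm (x : 'I_n -> C) K (s : {ffun 'I_n -> 'I_K.+1}) j :
  `|pmul (pconj (tor C s)) x j| = `|x j|.
Proof. by rewrite normrM norm_conjC tor_norm mul1r. Qed.

Lemma tavg_hassum K b (x : 'I_n -> C) : (forall j, `|x j| < rho) ->
  hassum (fun d => (cong K b d)%:R * (A d * mon x d))
    (tavg K b (fun y => kerfun P m (pmul y x))).
Proof.
move=> xr; have h (s : {ffun 'I_n -> 'I_K.+1}) : hassum (fun d => A d * mon (pmul (pconj (tor C s)) x) d)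
    (kerfun P m (pmul (pconj (tor C s)) x)) by apply: A_sum => j; rewrite pmul_norm.
apply: hassum_ext (hassumZ _ (hassum_lincomb _ _ h)) => d.
rewrite /= -tavg_mon /tavg -mulrA mulr_suml; congr (_ * _); apply: eq_bigr => s _.
by rewrite mon_pmul; ring.
Qed.

Lemma tavg_tends b (x : 'I_n -> C) : (forall j, `|x j| < rho) ->
  tends (fun K => tavg K b (fun y => kerfun P m (pmul y x))) (A b * mon x b).
Proof.
move=> xr e e0; have [J0 hJ] := hassum_restrict (A_sum xr) (divr_gt0 e0 (ltr0n C 2)).
exists (\sum_j b j + \sum_(d <- J0) \sum_j d j)%N => K hK.
apply: le_lt_trans (_ : e / 2 < e); last by rewrite ltr_pdivrMr// ltr_pMr// ltr1n.
have := hJ (cong K b) b _ _ (tavg_hassum K b xr); rewrite cong_refl mul1r; apply.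
move=> d dJ bd; apply/esym; apply: cong_eq bd.
  exact: leq_trans (leq_addr _ _) hK.
apply: leq_trans hK; rewrite (big_rem d dJ)/=.
by rewrite addnCA leq_addr.
Qed.

(* The Fourier coefficient of kerfun dominates that of its truncation, whose coefficients are nonnegative. *)
Lemma coef_ge b k : mcoeff b (trunc P m k) <= A b.
Proof.
have [t [t0 t1 tr ht]] := @small_radius (fun=> 0) (fun=> lexx 0).
pose x : 'I_n -> C := fun=> t.
have xr j : `|x j| < rho by rewrite gtr0_norm.
have mx d : 0 < mon x d by apply: prodr_gt0 => j _; rewrite exprn_gt0.
rewrite -(ler_pM2r (mx b)) -subr_ge0.
apply: (@tends_ge0 C (fun K => tavg K b (fun y => kerfun P m (pmul y x)) -
  mcoeff b (trunc P m k) * mon x b)); last first.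
  by apply: tendsB; [exact: tavg_tends|exact: tends_cst].
move=> K; rewrite subr_ge0.
apply: (@tends_le C (fun=> mcoeff b (trunc P m k) * mon x b)
  (fun i => tavg K b (fun y => meval (pmul y x) (trunc P m (i + k)%N)))); last 2 first.
- exact: tends_cst.
- apply: tendsZ; apply: tends_sum => s _; apply: tendsZ.
  apply: (@tends_shift C C (fun i => meval (pmul (pconj (tor C s)) x) (trunc P m i)) k).
  apply: trunc_tends => j.
  apply: le_lt_trans (meval_norm _ (P_ge0 j)) _.
  apply: le_lt_trans (ht j).2; rewrite (mpoly.meval_eq (v2 := fun=> t))// => i.
  by rewrite pmul_norm gtr0_norm.
move=> i; set p := trunc P m (i + k)%N.
have p0 : coefle 0 p by exact: trunc_ge0.
have -> : tavg K b (fun y => meval (pmul y x) p) =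
    \sum_(d <- msupp p) mcoeff d p * ((cong K b d)%:R * mon x d).
  rewrite /tavg; under eq_bigr do rewrite mpoly.mevalE mulr_sumr.
  rewrite exchange_big mulr_sumr; apply: eq_bigr => d _.
  rewrite -tavg_mon /tavg mulrCA -mulrA mulr_suml; congr (_ * _).
  apply: eq_bigr => s _.
  by rewrite -/(mon _ d) mon_pmul; ring.
apply: le_trans (_ : mcoeff b p * mon x b <= _).
  by rewrite ler_pM2r// trunc_nd// leq_addl.
have pos d : 0 <= mcoeff d p * ((cong K b d)%:R * mon x d).
  by have := p0 d; rewrite mpoly.mcoeff0 => h; rewrite mulr_ge0// mulr_ge0// ltW.
have [bp|/mpoly.memN_msupp_eq0 ->] := boolP (b \in msupp p); last first.
  by rewrite mul0r; apply: sumr_ge0.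
rewrite (bigD1_seq b)//=.
by rewrite cong_refl mul1r lerDl sumr_ge0.
Qed.

Lemma coef_gt0 b : 0 < A b.
Proof.
apply: lt_le_trans (coef_ge b (\sum_j b j).+1).
by apply: trunc_gt0 => // j; rewrite ltnS (bigD1 j)//= leq_addr.
Qed.

End KernelCoefficients.

Section SemidotLimits.
Variables (C : numClosedFieldType) (U : lmodType C) (g : semidot U).

Definition stends (u : nat -> U) (l : U) := tends (fun k => snorm g (u k - l)) 0.

Lemma sdot_tends u w a b : stends u a -> stends w b -> tends (fun k => g (u k) (w k)) (g a b).
Proof.
move=> ua wb.
apply: tends_ext (_ : tends (fun k => g (u k - a) (w k - b) + g (u k - a) b + g a (w k - b) + g a b) _).
  by move=> k; rewrite !sdotBl !sdotBr; ring.
rewrite -[X in tends _ X]add0r; apply: tendsD; last exact: tends_cst.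
apply: (@tends_squeeze _ _ _ (fun k => snorm g (u k - a) * snorm g (w k - b) +
  snorm g (u k - a) * snorm g b + snorm g a * snorm g (w k - b))).
  move=> k; rewrite subr0; apply: le_trans (ler_normD _ _) _; apply: lerD; last exact: cauchy_schwarz.
  by apply: le_trans (ler_normD _ _) _; apply: lerD; exact: cauchy_schwarz.
rewrite -[X in tends _ X]addr0 -[X in tends _ (X + _)]addr0.
apply: tendsD; last by rewrite -[X in tends _ X](mulr0 (snorm g a)); exact: tendsZ.
apply: tendsD; first by rewrite -[X in tends _ X](mulr0 0); exact: tendsM.
by rewrite -[X in tends _ X](mul0r (snorm g b)); apply: tendsM => //; exact: tends_cst.
Qed.

Lemma stends_cst a : stends (fun=> a) a.
Proof. by apply: tends_ext (tends_cst 0) => k; rewrite subrr snorm0. Qed.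

End SemidotLimits.

(** * An orthogonal basis obtained from kernel functions *)

Section KernelBasis.
Variables (C : completeClosedField) (n : nat).
Variables (P : 'I_n -> {mpoly C[n]}) (m : 'I_n -> nat).
Hypothesis P_ge0 : forall j, coefle 0 (P j).
Hypothesis P_0 : forall j, mcoeff (@mnm0 n) (P j) = 0.
Hypothesis P_lin : forall j, 0 < mcoeff (mnm1 j) (P j).
Hypothesis m_gt0 : forall j, (0 < m j)%N.
Variables (A : multinom n -> C) (rho : C).
Hypothesis rho_gt0 : 0 < rho.
Hypothesis A_sum : forall x : 'I_n -> C, (forall j, `|x j| < rho) ->
  hassum (fun b => A b * mon x b) (kerfun P m x).

Variables (U : lmodType C) (g : semidot U).
Hypothesis g_def : forall x, g x x = 0 -> x = 0.
Hypothesis g_complete : forall u : nat -> U,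
  (forall e, 0 < e -> exists N, forall i j, (N <= i)%N -> (N <= j)%N -> snorm g (u i - u j) < e) ->
  exists l, stends g u l.

Definition sqmod (u : 'I_n -> C) := pmul u (pconj u).
Definition kdom (u : 'I_n -> C) :=
  (forall j : 'I_n, (0 < j)%N -> u j != 0) /\ forall j, meval (sqmod u) (P j) < 1.

Variable kap : ('I_n -> C) -> U.
Hypothesis kapE : forall u w, kdom u -> kdom w ->
  g (kap u) (kap w) = kerfun P m (pmul w (pconj u)).
Hypothesis kap_total : forall f, (forall u, kdom u -> g f (kap u) = 0) -> f = 0.

Let A_gt0 := coef_gt0 P_ge0 P_0 P_lin m_gt0 rho_gt0 A_sum.

Lemma sqmod_ge0 u j : 0 <= sqmod u j.
Proof. exact: mul_conjC_ge0. Qed.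

(** With a the coefficient of X_j in P_j, one has a |u_j|^2 <= P_j(|u|^2) < 1. The domain is
    therefore bounded, and a single small t brings all products t u into the polydisc of
    convergence. *)
Lemma kdom_bound u j : kdom u -> `|u j| <= 1 + (mcoeff (mnm1 j) (P j))^-1.
Proof.
move=> [_ /(_ j)]; set a := mcoeff _ _ => h.
have a0 : 0 < a by exact: P_lin.
have h1 : a * sqmod u j < 1.
  apply: le_lt_trans h; rewrite -(mpoly.mevalXU (sqmod u) j) -mpoly.mevalZ.
  apply: meval_coefle => [i|d]; first exact: sqmod_ge0.
  rewrite mpoly.mcoeffZ mpoly.mcoeffX; case: eqVneq => [<-|_]; first by rewrite mulr1.
  by rewrite mulr0; have := P_ge0 j d; rewrite mpoly.mcoeff0.
have {h1}h2 : `|u j| ^+ 2 <= a^-1.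
  by rewrite ltW// -[ltRHS]mulr1 ltr_pdivlMl// normCK.
have [u1|u1] := real_leP (normr_real (u j)) (real1 C).
  by apply: le_trans u1 _; rewrite lerDl invr_ge0 ltW.
apply: le_trans (_ : `|u j| ^+ 2 <= _); first by rewrite expr2 ler_peMr// ltW.
by apply: le_trans h2 _; rewrite lerDr ler01.
Qed.

Section Eta.
Variable t : C.
Hypotheses (t0 : 0 < t) (t1 : t < 1) (tr : t < rho).
Hypothesis tP : forall j, meval (fun=> t) (P j) < 1.
Hypothesis tu : forall u j, kdom u -> `|u j| * t < rho.
Let v : 'I_n -> C := fun=> t.

(* Averaging the kernel functions over the torus of K-th roots of unity isolates a Fourier coefficient. *)
Definition eta K b : U := (K.+1%:R ^+ n)^-1 *:
  \sum_(s : {ffun 'I_n -> 'I_K.+1}) mon (tor C s) b *: kap (pmul (tor C s) v).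

Lemma kdom_tor K (s : {ffun 'I_n -> 'I_K.+1}) : kdom (pmul (tor C s) v).
Proof.
split=> j.
  move=> _; rewrite /pmul mulf_neq0 //; last by rewrite gt_eqF.
  by rewrite -normr_eq0 tor_norm oner_eq0.
apply: le_lt_trans (tP j); apply: meval_le_arg => // i; rewrite sqmod_ge0 /=.
rewrite /sqmod /pmul /pconj -normCK normrM tor_norm mul1r gtr0_norm//.
by rewrite expr2 ler_piMl// ltW.
Qed.

Lemma pconj_tor K (s : {ffun 'I_n -> 'I_K.+1}) u :
  pmul u (pconj (pmul (tor C s) v)) = pmul (pconj (tor C s)) (pmul u v).
Proof.
apply/funext => j; rewrite /pmul /pconj rmorphM /= /v (conj_Creal (gtr0_real t0)).
by rewrite mulrCA.
Qed.

Lemma eta_kap K b u : kdom u ->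
  g (eta K b) (kap u) = tavg K b (fun y => kerfun P m (pmul y (pmul u v))).
Proof.
move=> hu; rewrite sdotZl sdot_suml; congr (_ * _); apply: eq_bigr => s _.
by rewrite sdotZl kapE// ?pconj_tor//; exact: kdom_tor.
Qed.

Lemma uv_small u j : kdom u -> `|pmul u v j| < rho.
Proof. by move=> hu; rewrite normrM (gtr0_norm t0) tu. Qed.

Lemma vv_small j : `|pmul v v j| < rho.
Proof.
rewrite normrM (gtr0_norm t0); apply: lt_trans tr.
by rewrite gtr_pMr.
Qed.

Lemma eta_gram_hassum K K' b d :
  hassum (fun e => (cong K b e && cong K' e d)%:R * (A e * mon (pmul v v) e))
    (g (eta K b) (eta K' d)).
Proof.
have h (s : {ffun 'I_n -> 'I_K'.+1}) : hassum
   (fun e => (cong K b e)%:R * (A e * mon (pmul (pmul (tor C s) v) v) e))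
   (g (eta K b) (kap (pmul (tor C s) v))).
  rewrite eta_kap; last exact: kdom_tor.
  by apply: (tavg_hassum (m := m) A_sum) => j; apply: uv_small; exact: kdom_tor.
rewrite /(eta K') sdotZr sdot_sumr.
under eq_bigr do rewrite sdotZr.
have -> : ((K'.+1%:R ^+ n)^-1)^* = (K'.+1%:R ^+ n)^-1 :> C.
  by rewrite fmorphV rmorphXn rmorph_nat.
apply: hassum_ext (hassumZ _ (hassum_lincomb _ _ h)) => e.
rewrite -mulnb natrM -(tor_sum _ K' e d).
set T := \sum_s _; set S := \sum_s _; move: (_ ^- n) => c.
have -> : T = S * ((cong K b e)%:R * (A e * mon (pmul v v) e)).
  by rewrite mulr_suml; apply: eq_bigr => s _; rewrite -mon_pconj !mon_pmul; ring.
by move: (cong K b e)%:R => z; ring.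
Qed.

(** The averages of orders K and K' keep only exponents congruent to b and to d. Once both orders
    exceed the degrees of b and d and of the finitely many significant exponents, only b can
    survive, and only if b = d. *)
Lemma eta_gram b d e : 0 < e -> exists N, forall K K', (N <= K)%N -> (N <= K')%N ->
  `|g (eta K b) (eta K' d) - (b == d)%:R * (A b * mon (pmul v v) b)| <= e.
Proof.
move=> e0; have [J0 hJ] := hassum_restrict (A_sum vv_small) e0.
exists (\sum_j b j + \sum_j d j + \sum_(d <- J0) \sum_j d j)%N => K K' hK hK'.
have bK : (\sum_j b j <= K)%N by apply: leq_trans hK; rewrite -addnA leq_addr.
have bK' : (\sum_j b j <= K')%N by apply: leq_trans hK'; rewrite -addnA leq_addr.
have dK' : (\sum_j d j <= K')%N by apply: leq_trans hK'; rewrite -addnA addnCA leq_addr.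
have := hJ (fun e => cong K b e && cong K' e d) b _ _ (eta_gram_hassum K K' b d).
have -> : cong K b b && cong K' b d = (b == d).
  rewrite cong_refl /=; apply/idP/eqP => [|->]; last exact: cong_refl.
  exact: cong_eq.
apply=> a aJ /andP[ba _]; apply/esym; apply: cong_eq ba => //.
apply: leq_trans hK; rewrite (big_rem a aJ)/= addnCA leq_addr//.
Qed.

Lemma eta_cauchy b e : 0 < e -> exists N, forall i j, (N <= i)%N -> (N <= j)%N ->
  snorm g (eta i b - eta j b) < e.
Proof.
move=> e0; have e1 : 0 < e ^+ 2 / 8 by rewrite divr_gt0// exprn_gt0.
have [N hN] := eta_gram b b e1; exists N => i j Ni Nj.
rewrite -(@ltr_pXn2r _ 2)// ?nnegrE ?snorm_ge0 ?(ltW e0)//.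
have x0 : 0 <= g (eta i b - eta j b) (eta i b - eta j b) by exact: sdot_ge0.
rewrite snormE -(ger0_norm x0); move: {x0}(x0); rewrite sdotBl !sdotBr => _.
set l := (b == b)%:R * _ in hN.
have h1 := hN i i Ni Ni; have h2 := hN i j Ni Nj; have h3 := hN j i Nj Ni.
have h4 := hN j j Nj Nj; move: h1 h2 h3 h4.
move: (g (eta i b) (eta i b)) (g (eta i b) (eta j b)) (g (eta j b) (eta i b)) (g (eta j b) (eta j b)).
move=> x1 x2 x3 x4 h1 h2 h3 h4.
have -> : x1 - x2 - (x3 - x4) = (x1 - l) - (x2 - l) - ((x3 - l) - (x4 - l)) by ring.
apply: le_lt_trans (_ : e ^+ 2 / 8 + e ^+ 2 / 8 + (e ^+ 2 / 8 + e ^+ 2 / 8) < _).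
  by apply: le_trans (ler_normB _ _) _; apply: lerD; apply: le_trans (ler_normB _ _) _; apply: lerD.
have -> : e ^+ 2 / 8 + e ^+ 2 / 8 + (e ^+ 2 / 8 + e ^+ 2 / 8) = e ^+ 2 / 2 by field.
by rewrite ltr_pdivrMr// ltr_pMr ?exprn_gt0// ltr1n.
Qed.

Lemma eta_limits : exists eta' : multinom n -> U, forall b, stends g (eta^~ b) (eta' b).
Proof.
have /boolp.choice [f hf] : forall b, exists l, stends g (eta^~ b) l.
  by move=> b; apply: g_complete => e; exact: eta_cauchy.
by exists f.
Qed.

Lemma mon_v b : 0 < mon v b.
Proof. by apply: prodr_gt0 => j _; rewrite exprn_gt0. Qed.

(** The limit of [eta] pairs with kap u to A_b (t u)^b; dividing by A_b and the monomial of v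
    removes the auxiliary radius t. *)
Lemma basis_at : exists E : multinom n -> U,
  (forall b u, kdom u -> g (E b) (kap u) = mon u b) /\
  (forall b d, g (E b) (E d) = (b == d)%:R / A b).
Proof.
have [f hf] := eta_limits; exists (fun b => (A b * mon v b)^-1 *: f b).
have A0 b : A b != 0 by rewrite gt_eqF.
have v0 b : mon v b != 0 by rewrite gt_eqF// mon_v.
split=> [b u hu|b d].
  rewrite sdotZl; have -> : g (f b) (kap u) = A b * mon (pmul u v) b.
    apply: (@tends_uniq _ _ (fun K => g (eta K b) (kap u))).
      exact: sdot_tends (hf b) (stends_cst _ _).
    apply: tends_ext (tavg_tends A_sum b (fun j => uv_small j hu)) => K.
    by rewrite eta_kap.
  by rewrite mon_pmul; field; rewrite A0 v0.
rewrite sdotZl sdotZr.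
have -> : g (f b) (f d) = (b == d)%:R * (A b * mon (pmul v v) b).
  apply: (@tends_uniq _ _ (fun K => g (eta K b) (eta K d))).
    exact: sdot_tends (hf b) (hf d).
  move=> e e0; have [N hN] := eta_gram b d (divr_gt0 e0 (ltr0n _ 2)).
  exists N => k hk; apply: le_lt_trans (hN k k hk hk) _.
  by rewrite ltr_pdivrMr// ltr_pMr// ltr1n.
have [<-|_] := eqVneq b d; last by rewrite !mul0r !mulr0.
have -> : ((A b * mon v b)^-1)^* = (A b * mon v b)^-1.
  by apply: conj_Creal; rewrite gtr0_real// invr_gt0 mulr_gt0// mon_v.
by rewrite mon_pmul; field; rewrite A0 v0.
Qed.

End Eta.

(** For totality, kap u must be a limit of combinations of the E_b for every u of the domain,
    although the expansion with coefficients A is assumed only near 0. The truncations converge on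
    the whole domain, and their coefficients are at most those of A, so the squared distance is at
    most kerfun r - trunc(r) with r = |u|^2. *)
Theorem kernel_basis : exists E : multinom n -> U,
  [/\ forall b, 0 < A b,
      forall b u, kdom u -> g (E b) (kap u) = mon u b,
      forall b d, g (E b) (E d) = (b == d)%:R / A b &
      forall f, (forall b, g f (E b) = 0) -> f = 0].
Proof.
pose c (j : 'I_n) := 1 + (mcoeff (mnm1 j) (P j))^-1.
have c0 j : 0 <= c j by rewrite addr_ge0// invr_ge0 ltW.
have [t [t0 t1 tr ht]] := small_radius P_ge0 P_0 rho_gt0 c0.
have tP j := (ht j).2.
have tu u j : kdom u -> `|u j| * t < rho.
  move=> hu; apply: le_lt_trans (ht j).1; rewrite mulrC ler_wpM2l ?(ltW t0)//.
  exact: kdom_bound.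
have [E [Ek EE]] := basis_at t0 t1 tr tP tu.
exists E; split=> // f hf; apply: kap_total => u hu.
pose r := sqmod u; pose J k := msupp (trunc P m k).
pose y k := kap u - \sum_(b <- J k) (A b * (mon u b)^*) *: E b.
have gy k : g f (kap u) = g f (y k).
  rewrite sdotBr sdot_sumr big1 ?subr0// => b _.
  by rewrite sdotZr hf mulr0.
have Ar b : (A b)^* = A b by rewrite conj_Creal// gtr0_real.
have kE b : g (kap u) (E b) = (mon u b)^* by rewrite sdotC Ek.
have gyy k : g (y k) (y k) = kerfun P m r - \sum_(b <- J k) A b * mon r b.
  have mr b : mon r b = mon u b * (mon u b)^* by rewrite /r /sqmod mon_pmul mon_pconj.
  rewrite sdotBl !sdotBr kapE// !sdot_suml !sdot_sumr.
  have -> : \sum_(i <- J k) g (kap u) ((A i * (mon u i)^*) *: E i) = \sum_(b <- J k) A b * mon r b.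
    by apply: eq_bigr => b _; rewrite sdotZr kE rmorphM /= Ar conjCK mr; ring.
  have -> : \sum_(i <- J k) g ((A i * (mon u i)^*) *: E i) (kap u) = \sum_(b <- J k) A b * mon r b.
    by apply: eq_bigr => b _; rewrite sdotZl Ek// mr; ring.
  have -> : \sum_(i <- J k) g ((A i * (mon u i)^*) *: E i) (\sum_(b <- J k) (A b * (mon u b)^*) *: E b)
    = \sum_(b <- J k) A b * mon r b.
    apply: eq_big_seq => b bJ; rewrite sdotZl sdot_sumr.
    have uJ : uniq (J k) by exact: mpoly.msupp_uniq.
    have -> : \sum_(i <- J k) g (E b) ((A i * (mon u i)^*) *: E i) = mon u b.
      have A0 : A b != 0 by rewrite gt_eqF.
      rewrite (bigD1_seq b bJ uJ) /=.
      have -> : \sum_(i <- J k | i != b) g (E b) ((A i * (mon u i)^*) *: E i) = 0.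
        by apply: big1 => d /negPf db; rewrite sdotZr EE eq_sym db mul0r mulr0.
      by rewrite addr0 sdotZr EE eqxx rmorphM /= Ar conjCK; field.
    by rewrite mr; ring.
  by rewrite -/r; ring.
have rP j : `|meval r (P j)| < 1.
  rewrite ger0_norm; first by have [_ h] := hu; exact: h.
  have := @meval_coefle C n 0 (P j) r (sqmod_ge0 u) (P_ge0 j).
  by rewrite mpoly.meval0.
have gyle k : g (y k) (y k) <= kerfun P m r - meval r (trunc P m k).
  rewrite gyy lerD2l lerN2 mpoly.mevalE; apply: ler_sum => b _.
  rewrite -/(mon r b) ler_wpM2r//; last exact: coef_ge A_sum _ _.
  by apply: prodr_ge0 => j _; rewrite exprn_ge0// sqmod_ge0.
have h : tends (fun k => g f f * (kerfun P m r - meval r (trunc P m k))) 0.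
  rewrite -(mulr0 (g f f)) -(subrr (kerfun P m r)); apply: tendsZ; apply: tendsB.
    exact: tends_cst.
  exact: trunc_tends.
have : `|g f (kap u)| ^+ 2 <= 0.
  apply: tends_le (tends_cst _) h => k; rewrite (gy k).
  apply: le_trans (cauchy_schwarz_sq g f (y k)) _.
  by rewrite ler_wpM2l// sdot_ge0.
rewrite real_exprn_even_le0 ?normr_real//= normr_eq0 => /eqP //.
Qed.

End KernelBasis.

(** * Positivity in an orthogonal basis *)

Lemma multinom_ind (n : nat) (Q : multinom n -> Prop) :
  Q (@mnm0 n) -> (forall j, Q (mnm1 j)) -> (forall b d, Q b -> Q d -> Q (mnm_add b d)) ->
  forall b, Q b.
Proof.
move=> Q0 Q1 QD b; rewrite (mpoly.multinomUE_id b).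
apply: big_ind => // j _; elim: (b j) => [|k ih]; first by rewrite mpoly.mulm0n.
by rewrite mpoly.mulmS; apply: QD.
Qed.

Lemma opow_staircase (n : nat) (T : Type) (S : 'I_n -> T -> T) (E : multinom n -> T) :
  (forall j k x, S j (S k x) = S k (S j x)) ->
  (forall j a, S j (E a) = E (staircase a (mnm1 j))) ->
  forall b a, opow S b (E a) = E (staircase a b).
Proof.
move=> Sc SE; apply: multinom_ind => [a|j a|b d hb hd a].
- by rewrite opow0 staircase0.
- by rewrite opow1 SE.
- by rewrite opowD// hd hb staircaseD mpoly.addmC.
Qed.

(* A complex quadratic form with a real symmetric matrix splits into its real and imaginary parts. *)
Lemma real_gram_ge0 (R : realFieldType) (C : numClosedFieldType) (h : {rmorphism R -> C})
  (m : nat) (G : 'I_m -> 'I_m -> R) (c : 'I_m -> C) :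
  (forall x, 0 <= x -> 0 <= h x) -> (forall z : C, z \is Num.real -> exists x, h x = z) ->
  (forall i j, G i j = G j i) ->
  (forall x : 'I_m -> R, 0 <= \sum_i \sum_j x i * x j * G i j) ->
  0 <= \sum_i \sum_j c i * (c j)^* * h (G i j).
Proof.
move=> h0 hs Gs Gp.
have [x hx] := boolp.choice (fun i => hs _ (Creal_Re (c i))).
have [y hy] := boolp.choice (fun i => hs _ (Creal_Im (c i))).
have cE i : c i = h (x i) + 'i * h (y i) by rewrite hx hy -Crect.
have cC i : (c i)^* = h (x i) - 'i * h (y i).
  by rewrite cE rmorphD rmorphM /= conjCi !conj_Creal ?mulNr// ?hx ?hy ?Creal_Re ?Creal_Im.
have -> : \sum_i \sum_j c i * (c j)^* * h (G i j) =
   h (\sum_i \sum_j x i * x j * G i j) + h (\sum_i \sum_j y i * y j * G i j) +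
   'i * (h (\sum_i \sum_j y i * x j * G i j) - h (\sum_i \sum_j x i * y j * G i j)).
  rewrite !rmorph_sum /= -sumrB mulr_sumr -!big_split /=; apply: eq_bigr => i _.
  rewrite !rmorph_sum /= -sumrB mulr_sumr -!big_split /=; apply: eq_bigr => j _.
  rewrite cC cE !rmorphM /=; have := sqrCi C.
  by rewrite expr2 => ii; ring: ii.
have -> : \sum_i \sum_j y i * x j * G i j = \sum_i \sum_j x i * y j * G i j.
  rewrite exchange_big; apply: eq_bigr => i _; apply: eq_bigr => j _.
  by rewrite Gs; ring.
by rewrite subrr mulr0 addr0 addr_ge0// h0.
Qed.

Section OrthogonalBasis.
Variables (C : completeClosedField) (n : nat) (U : lmodType C) (g : semidot U).
Hypothesis g_def : forall x, g x x = 0 -> x = 0.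
Hypothesis g_complete : forall u : nat -> U,
  (forall e, 0 < e -> exists N, forall i j, (N <= i)%N -> (N <= j)%N -> snorm g (u i - u j) < e) ->
  exists l, stends g u l.
Variables (A : multinom n -> C) (E : multinom n -> U).
Hypothesis A_gt0 : forall b, 0 < A b.
Hypothesis E_dot : forall b d, g (E b) (E d) = (b == d)%:R / A b.
Hypothesis E_total : forall f, (forall b, g f (E b) = 0) -> f = 0.

(** If increments of at least e kept recurring, u would exceed B after finitely many of them. *)
Lemma bounded_nd_cauchy (u : nat -> C) (B : C) :
  (forall i j, (i <= j)%N -> u i <= u j) -> (forall k, u k <= B) ->
  forall e, 0 < e -> exists N, forall k, (N <= k)%N -> u k - u N < e.
Proof.
move=> nd uB e e0; apply: contrapT => /forallNP h.
have {h}h N : exists k, u N + e <= u k.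
  have /existsNP[k /not_implyP[Nk]] := h N; move/negP.
  move=> hk.
  have r1 : u k - u N \is Num.real by rewrite ger0_real// subr_ge0 nd.
  by exists k; rewrite -lerBrDl real_leNgt// gtr0_real.
have grow m : exists k, u 0%N + m%:R * e <= u k.
  elim: m => [|m [k ih]]; first by exists 0%N; rewrite mul0r addr0.
  have [k' hk'] := h k; exists k'; apply: le_trans hk'.
  by rewrite -natr1 mulrDl mul1r addrA lerD2r.
have B0 : 0 <= B - u 0%N by rewrite subr_ge0.
have [q hq] := ccf_archi (divr_gt0 e0 (ltr_wpDl B0 ltr01)).
have [k hk] := grow q.+1.
move: hq; rewrite ltr_pdivlMr ?ltr_wpDl// mulrC ltr_pdivrMr ?ltr0n// mulrC => hq.
have := le_trans hk (uB k); rewrite -lerBrDl => hh.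
have := lt_le_trans hq hh; rewrite gtrDl => /lt_trans/(_ ltr01).
by rewrite ltxx.
Qed.

Definition basis_seq k : seq (multinom n) := pmap (@choice.pickle_inv (multinom n)) (iota 0 k).

Lemma basis_seq_uniq k : uniq (basis_seq k).
Proof. by apply: (pmap_uniq (@choice.pickle_invK _)); exact: iota_uniq. Qed.

Definition basis_part f k := \sum_(b <- basis_seq k) (g f (E b) * A b) *: E b.

Lemma basis_part_coef f k b : b \in basis_seq k -> g (basis_part f k) (E b) = g f (E b).
Proof.
move=> bk; rewrite sdot_suml (bigD1_seq b bk (basis_seq_uniq k)) /=.
have -> : \sum_(i <- basis_seq k | i != b) g ((g f (E i) * A i) *: E i) (E b) = 0.
  by apply: big1 => d /negPf db; rewrite sdotZl E_dot db mul0r mulr0.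
have A0 : A b != 0 by rewrite gt_eqF.
by rewrite addr0 sdotZl E_dot eqxx mul1r mulfK.
Qed.

Lemma basis_seq_mem (b : multinom n) k : (choice.pickle b < k)%N -> b \in basis_seq k.
Proof.
move=> bk; rewrite mem_pmap; apply/mapP; exists (choice.pickle b); last by rewrite choice.pickleK_inv.
by rewrite mem_iota.
Qed.

Lemma basis_seq_sub k l b : (k <= l)%N -> b \in basis_seq k -> b \in basis_seq l.
Proof.
move=> kl; rewrite !mem_pmap => /mapP[i ik e]; apply/mapP; exists i => //.
by move: ik; rewrite !mem_iota /= !add0n => /leq_trans; apply.
Qed.

Definition bessel f k := \sum_(b <- basis_seq k) g f (E b) * A b * (g f (E b))^*.

Lemma basis_part_dot f k : g (basis_part f k) f = bessel f k.
Proof.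
rewrite sdot_suml; apply: eq_bigr => b _; rewrite sdotZl; congr (_ * _).
exact: sdotC.
Qed.

Lemma basis_part_gram f k l : (k <= l)%N -> g (basis_part f k) (basis_part f l) = bessel f k.
Proof.
move=> kl; rewrite sdot_suml; apply: eq_big_seq => b bk; rewrite sdotZl.
have -> : g (E b) (basis_part f l) = (g (basis_part f l) (E b))^* by exact: sdotC.
by rewrite basis_part_coef// (basis_seq_sub kl bk).
Qed.

Lemma besselC f k : (bessel f k)^* = bessel f k.
Proof.
rewrite rmorph_sum; apply: eq_bigr => b _; rewrite !rmorphM /= conjCK.
by rewrite (conj_Creal (gtr0_real (A_gt0 b))); ring.
Qed.

Lemma bessel_diff f k l : (k <= l)%N ->
  g (basis_part f l - basis_part f k) (basis_part f l - basis_part f k) =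
  bessel f l - bessel f k.
Proof.
move=> kl; rewrite sdotBl !sdotBr !(basis_part_gram f (leqnn _)).
have -> : g (basis_part f l) (basis_part f k) = (g (basis_part f k) (basis_part f l))^*.
  exact: sdotC.
by rewrite basis_part_gram// besselC; ring.
Qed.

(** Bessel's inequality makes the partial sums Cauchy; their limit has the same coefficients as f,
    so it is f by totality. *)
Lemma basis_part_tends f : stends g (basis_part f) f.
Proof.
have nd i j : (i <= j)%N -> bessel f i <= bessel f j.
  by move=> ij; rewrite -subr_ge0 -bessel_diff// sdot_ge0.
have bb k : bessel f k <= g f f.
  have := sdot_ge0 g (f - basis_part f k); rewrite sdotBl !sdotBr basis_part_gram//.
  have -> : g f (basis_part f k) = (g (basis_part f k) f)^* by exact: sdotC.
  by rewrite basis_part_dot besselC subrr subr0 subr_ge0.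
have cau e : 0 < e -> exists N, forall i j, (N <= i)%N -> (N <= j)%N ->
    snorm g (basis_part f i - basis_part f j) < e.
  move=> e0; have [N hN] := bounded_nd_cauchy nd bb (exprn_gt0 2 e0).
  exists N.
  have half i j : (N <= i)%N -> (i <= j)%N -> snorm g (basis_part f j - basis_part f i) < e.
    move=> Ni ij; rewrite -(@ltr_pXn2r _ 2)// ?nnegrE ?snorm_ge0 ?(ltW e0)//.
    rewrite snormE bessel_diff//; apply: le_lt_trans (hN j (leq_trans Ni ij)).
    by rewrite lerD2l lerN2 nd.
  move=> i j Ni Nj; have [ij|/ltnW ji] := leqP i j; last exact: half.
  by rewrite snormBC; exact: half.
have [l hl] := g_complete cau.
suff fl : f = l by rewrite [X in stends _ _ X]fl.
apply/eqP; rewrite -subr_eq0; apply/eqP/E_total => b; rewrite sdotBl.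
apply/eqP; rewrite subr_eq0; apply/eqP.
apply: (tends_uniq _ (sdot_tends hl (stends_cst g (E b)))).
move=> e e0; exists (choice.pickle b).+1 => k hk.
by rewrite basis_part_coef ?subrr ?normr0// basis_seq_mem.
Qed.

Section Positivity.
Variables (R : realType) (h : {rmorphism R -> C}) (a : multinom n -> R).
Hypothesis h_ge0 : forall x, 0 <= x -> 0 <= h x.
Hypothesis h_surj : forall z : C, z \is Num.real -> exists x, h x = z.
Hypothesis hA : forall b, h (a b) = (A b)^-1.
Variables (S : 'I_n -> {linear U -> U}) (c : 'I_n -> C).
Hypothesis S_comm : forall j k x, S j (S k x) = S k (S j x).
Hypothesis S_bound : forall j x, snorm g (S j x) <= c j * snorm g x.
Hypothesis SE : forall j d, S j (E d) = E (staircase d (mnm1 j)).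
Hypothesis gram : forall (m : nat) (x : 'I_m -> R) (d b : 'I_m -> multinom n),
  0 <= \sum_i \sum_j x i * x j * ((gram_eq d b i j)%:R * a (staircase (d i) (b j))).

Lemma stends_opow b u l : stends g u l -> stends g (fun k => opow S b (u k)) (opow S b l).
Proof.
have step j w x : stends g w x -> stends g (fun k => S j (w k)) (S j x).
  move=> wx; apply: (@tends_squeeze _ _ _ (fun k => c j * snorm g (w k - x))).
    by move=> k; rewrite subr0 ger0_norm ?snorm_ge0// -linearB.
  by rewrite -(mulr0 (c j)); exact: tendsZ.
rewrite /opow; elim: (enum _) => //= j s ih ul; have {ih ul} := ih ul.
by elim: (b j) => //= k ih ul; apply: step; exact: ih.
Qed.

Lemma opow_suml (I : Type) (r : seq I) (x : I -> C) (y : I -> U) b :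
  opow S b (\sum_(i <- r) x i *: y i) = \sum_(i <- r) x i *: opow S b (y i).
Proof.
elim: r => [|i r ih]; last by rewrite !big_cons opow_linear ih.
rewrite !big_nil /opow; elim: (enum _) => //= j s ->.
by elim: (b j) => //= k ->; rewrite linear0.
Qed.

(** By continuity it suffices to treat partial sums of the orthogonal expansions. Their double sum
    is a quadratic form indexed by pairs of a vector and a basis element, and orthogonality leaves
    the entries 1 / A on the pairs related by [gram_eq]. *)
Lemma shift_gram_ge0 (m : nat) (y : 'I_m -> U) (b : 'I_m -> multinom n) :
  0 <= \sum_i \sum_j g (opow S (b j) (y i)) (opow S (b i) (y j)).
Proof.
pose Q k := \sum_i \sum_j g (opow S (b j) (basis_part (y i) k)) (opow S (b i) (basis_part (y j) k)).
apply: (@tends_ge0 _ Q); last first.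
  apply: tends_sum => i _; apply: tends_sum => j _.
  by apply: sdot_tends; apply: stends_opow; exact: basis_part_tends.
move=> k; rewrite /Q /basis_part.
pose I : finType := ('I_m * 'I_(size (basis_seq k)))%type.
pose e (q : 'I_(size (basis_seq k))) := nth (@mnm0 n) (basis_seq k) q.
pose x (p : I) : C := g (y p.1) (E (e p.2)) * A (e p.2).
pose d (p : I) := e p.2.
have G i : \sum_(b <- basis_seq k) (g (y i) (E b) * A b) *: E b = \sum_q x (i, q) *: E (e q).
  by rewrite (big_nth (@mnm0 n)) big_mkord.
have -> : \sum_i \sum_j g (opow S (b j) (\sum_(b <- basis_seq k) (g (y i) (E b) * A b) *: E b))
    (opow S (b i) (\sum_(b <- basis_seq k) (g (y j) (E b) * A b) *: E b)) =
  \sum_(p : I) \sum_(q : I) x p * (x q)^* *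
    h ((staircase (d p) (b q.1) == staircase (d q) (b p.1))%:R * a (staircase (d p) (b q.1))).
  rewrite [RHS](eq_bigr (fun p : I => \sum_j \sum_r x p * (x (j, r))^* *
    h ((staircase (d p) (b j) == staircase (e r) (b p.1))%:R * a (staircase (d p) (b j))))); last first.
    by move=> p _; rewrite [RHS]pair_bigA /=; apply: eq_bigr => -[].
  rewrite -(pair_bigA _ (fun i s => \sum_j \sum_r x (i, s) * (x (j, r))^* *
    h ((staircase (e s) (b j) == staircase (e r) (b i))%:R * a (staircase (e s) (b j))))) /=.
  apply: eq_bigr => i _; rewrite [RHS]exchange_big; apply: eq_bigr => j _.
  rewrite !G !opow_suml sdot_suml; apply: eq_bigr => s _.
  rewrite sdot_sumr; apply: eq_bigr => r _.
  rewrite sdotZl sdotZr !(opow_staircase S_comm SE) E_dot rmorphM hA rmorph_nat.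
  exact: mulrA.
pose f (i : 'I_#|I|) := enum_val i : I.
have re (F : I -> C) : \sum_p F p = \sum_(i < #|I|) F (f i).
  by rewrite (reindex f)//; apply: onW_bij; exact: enum_val_bij.
rewrite re; under eq_bigr do rewrite re.
apply: (@real_gram_ge0 R C h #|I| (fun i j => (staircase (d (f i)) (b (f j).1) ==
   staircase (d (f j)) (b (f i).1))%:R * a (staircase (d (f i)) (b (f j).1)))) => //.
  by move=> i j; rewrite eq_sym; case: eqP => [->|_]//; rewrite !mul0r.
by move=> z; exact: (gram z (fun i => d (f i)) (fun i => b (f i).1)).
Qed.

End Positivity.

End OrthogonalBasis.

Lemma moment_functional_ge0 (R : realType) (n : nat) (a : multinom n -> R)
    (mu : {finite_measure set borel_rV R n -> \bar R}) (c : 'rV[R]_n) (s B : R) :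
  (forall j, 0 <= c ord0 j) -> (forall j, c ord0 j + s <= B) ->
  (forall b : multinom n, (a b)%:E = (\int[mu]_(t in cube c s)
             (\prod_(j < n) (t : 'rV[R]_n) ord0 j ^+ b j)%:E)%E) ->
  forall q : {mpoly R[n]}, (forall t : 'I_n -> R, (forall j, 0 <= t j <= B) -> 0 <= meval t q) ->
  0 <= mfun a q.
Proof.
move=> c0 cB ha q hq.
have mC := measurable_cube c s.
have t0 (t : 'rV[R]_n) : cube c s t -> forall j, 0 <= t ord0 j <= B.
  move=> ct j; have /andP[h1 h2] := ct j.
  by rewrite (le_trans (c0 j) h1)/= (le_trans h2).
have ig (b : multinom n) : mu.-integrable (cube c s)
    (fun t => (\prod_(j < n) (t : 'rV[R]_n) ord0 j ^+ b j)%:E).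
  apply/integrableP; split.
    by apply: measurable_funTS; apply/measurable_EFinP; exact: measurable_monomial.
  rewrite (eq_integral (fun t : borel_rV R n => (\prod_(j < n) (t : 'rV[R]_n) ord0 j ^+ b j)%:E)).
    by rewrite -ha ltry.
  move=> t; rewrite inE => ct; rewrite gee0_abs// lee_fin; apply: prodr_ge0 => j _.
  by rewrite exprn_ge0//; have /andP[] := t0 t ct j.
rewrite -lee_fin mfunE -sumEFin.
rewrite (eq_bigr (fun b => \int[mu]_(t in cube c s)
   ((mcoeff b q)%:E * (\prod_(j < n) (t : 'rV[R]_n) ord0 j ^+ b j)%:E))%E); last first.
  by move=> b _; rewrite integralZl// -ha EFinM.
rewrite -integral_sum//; last by move=> b; exact: integrableZl.
apply: integral_ge0 => t ct.
under eq_bigr do rewrite -EFinM.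
rewrite sumEFin lee_fin; have := hq (fun j => t ord0 j) (t0 t ct).
by rewrite mpoly.mevalE.
Qed.

Lemma normal_extension_bernstein (R : realFieldType) (C : completeClosedField)
    (h : {rmorphism R -> C}) (U : lmodType C) (g : semidot U) (n : nat)
    (N N' : 'I_n -> {linear U -> U}) (c : R) (y : U) (a : multinom n -> R) :
  (forall x, 0 <= h x -> 0 <= x) -> (forall x, 0 < x -> 0 < h x) ->
  (forall u, g u u = 0 -> u = 0) ->
  (forall j u v, g (N j u) v = g u (N' j v)) ->
  (forall j k u, N j (N k u) = N k (N j u)) ->
  (forall j u, N j (N' j u) = N' j (N j u)) ->
  0 < c -> (forall j u, snorm g (N j u) <= h c * snorm g u) ->
  (forall b, h (a b) = g (opow N b y) (opow N b y)) ->
  forall i k : 'I_n -> nat, 0 <= mfun (fun b => a b / (c ^+ 2) ^+ mdeg b)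
    (\prod_l (@mpolyX n R (mnm1 l) ^+ i l * (1 - @mpolyX n R (mnm1 l)) ^+ k l)).
Proof.
move=> h_ge0 h_mono gdef adjN commN normN c0 bN ha i k.
have hc0 : 0 < h c by exact: h_mono.
have hc0' : 0 <= h c by exact: ltW.
(* Joint subnormality provides commuting N_j only; Fuglede's theorem, with N_j in the role of T,
   adds the adjoints. *)
have commN' j l u : N j (N' l u) = N' l (N j u).
  apply: (fuglede (adjN l) (normN l) _ hc0' hc0' (bN l) (bN j) gdef) => w.
  exact: commN.
(* Scaling by 1 / c makes the operators contractions and divides |N^b y|^2 by c^(2 |b|). *)
pose d := (h c)^-1; have dr : d^* = d by rewrite conj_Creal// gtr0_real// invr_gt0.
pose T j : {linear U -> U} := (d \*: N j)%R.
pose T' j : {linear U -> U} := (d \*: N' j)%R.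
have TE j u : T j u = d *: N j u by [].
have T'E j u : T' j u = d *: N' j u by [].
have opT b u : opow T b u = d ^+ mdeg b *: opow N b u.
  rewrite mpoly.mdegE /opow -big_enum /=; elim: (enum _) => [|j s ih] /=.
    by rewrite big_nil scale1r.
  rewrite big_cons ih; elim: (b j) => [|p ihp] //=.
  by rewrite ihp linearZ /= scalerA -exprS addSn.
have TT : [/\ forall j u v, g (T j u) v = g u (T' j v),
  forall j l u, T j (T l u) = T l (T j u), forall j l u, T j (T' l u) = T' l (T j u) &
  forall j u, g (T j u) (T j u) <= g u u].
  split=> [j u v|j l u|j l u|j u]; rewrite ?TE ?T'E.
  - by rewrite sdotZl sdotZr dr adjN.
  - by rewrite !linearZ /= commN.
  - by rewrite !linearZ /= commN'.
  - rewrite sdotZl sdotZr dr -!snormE mulrA -expr2 -exprMn lerXn2r ?nnegrE ?mulr_ge0 ?snorm_ge0 ?invr_ge0//.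
    by rewrite ler_pdivrMl.
have [adjT commT commT' contrT] := TT.
have /(_ (fun b => a b / (c ^+ 2) ^+ mdeg b)) := @cone_pos_bernstein R C h h_ge0 h_mono U g n T T' adjT commT commT' contrT i k.
apply.
apply: (cone_sqpow (u := y)) => b.
have dbr : (d ^+ mdeg b)^* = d ^+ mdeg b by rewrite rmorphXn /= dr.
rewrite /sqpow opT sdotZl sdotZr dbr -ha fmorph_div !rmorphXn /= mulrA mulrC.
by congr (_ * _); rewrite -exprMn -exprVn /d expr2 -invfM -expr2.
Qed.

(** * Kernel functions on the triangle *)

Lemma positive_regular_coef (R : realType) (n : nat) (P : 'I_n -> {mpoly R[i][n]}) :
  positive_regular P ->
  [/\ forall j, coefle 0 (P j), forall j, mcoeff (@mnm0 n) (P j) = 0 &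
      forall j, 0 < mcoeff (mnm1 j) (P j)].
Proof.
move=> hP; split=> j; have [P0 [a [N [Q [a0 hQ PE]]]]] := hP j.
- by move=> b; rewrite mpoly.mcoeff0.
- rewrite PE mpoly.mcoeffD mpoly.mcoeffZ mpoly.mcoeffX mpoly.mnm1_eq0 mulr0 add0r.
  rewrite raddf_sum big_nat big1// => k /andP[k2 _]; apply: mpoly.memN_msupp_eq0.
  have /allP h := hQ k; apply/negP => /h /=.
  by rewrite mpoly.mdeg0 => /eqP k0; rewrite -k0 in k2.
- rewrite PE mpoly.mcoeffD mpoly.mcoeffZ mpoly.mcoeffX eqxx mulr1 raddf_sum big_nat big1 ?addr0//.
  move=> k /andP[k2 _]; apply: mpoly.memN_msupp_eq0.
  have /allP h := hQ k; apply/negP => /h /=.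
  by rewrite mpoly.mdeg1 => /eqP k0; rewrite -k0 in k2.
Qed.

Lemma power_series_hassum (R : realType) (n : nat) (P : 'I_n -> {mpoly R[i][n]}) (m : 'I_n -> nat)
    (A : multinom n -> R) :
  power_series_at0 (fun x => \prod_(j < n) (1 - peval (P j) x) ^- m j) A ->
  exists2 rho : complexF R, 0 < rho & forall x : 'I_n -> complexF R, (forall j, `|x j| < rho) ->
    hassum (fun b => (real_complex R (A b) : complexF R) * mon x b) (@kerfun (complexF R) n P m x).
Proof.
move=> /nbhs_ballP[rho /= rho0 hr]; exists rho => // x xr e e0.
pose z : 'rV[R[i]]_n := \row_j x j.
have zE j : z ord0 j = x j by rewrite mxE.
have /hr : ball (0 : 'rV[(R[i])^o]_n) rho z.
  by split=> // i j; rewrite ord1 /ball /= mxE sub0r normrN zE.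
move=> hs; have [J0 _ hJ] := hs _ (nbhsx_ballx (_ : (R[i])^o) e e0).
exists (enum_fset J0) => J uJ sJ.
have := hJ [fset b in J]%fset; rewrite /=.
have sub : fsubset J0 [fset b in J]%fset by apply/fsubsetP => b bJ; rewrite !inE; exact: sJ.
move=> /(_ sub); rewrite /ball /= distrC => /ltW.
have -> : partial_sum (fun a : multinom n => ((A a)%:C%C * \prod_(j < n) z ord0 j ^+ a j : (R[i])^o))
    [fset b in J]%fset = \sum_(b <- J) (real_complex R (A b) : complexF R) * mon x b.
  rewrite /partial_sum -(big_seq_fsetE _ [fset b in J]%fset xpredT
    (fun b : multinom n => ((A b)%:C%C * \prod_(j < n) z ord0 j ^+ b j : (R[i])^o))).
  rewrite (perm_big J); last by apply: uniq_perm => // b; rewrite !inE.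
  by apply: eq_bigr => b _; congr (_ * _); apply: eq_bigr => j _; rewrite zE.
have -> : \prod_(j < n) (1 - peval (P j) z) ^- m j = @kerfun (complexF R) n P m x.
  have pE j : peval (P j) z = mpoly.meval x (P j).
    by apply: mpoly.meval_eq => i; rewrite zE.
  under eq_bigr do rewrite pE.
  reflexivity.
by [].
Qed.

Section TriangleCoordinates.
Variables (F : fieldType) (n : nat).
Implicit Types u z : 'I_n -> F.

Definition quot_coords z (j : 'I_n) : F := if insub j.+1 is Some k then z j / z k else z j.
(** The inverse of varphi where all coordinates but the first are nonzero: z_j = u_j u_(j+1) ...
    u_n. *)
Definition prod_coords u (j : 'I_n) : F := \prod_(k < n | (j <= k)%N) u k.

Lemma prod_coordsS u (j k : 'I_n) : k = j.+1 :> nat -> prod_coords u j = u j * prod_coords u k.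
Proof.
move=> kj; rewrite /prod_coords (bigD1 j)//=; congr (_ * _); apply: eq_bigl => i.
by rewrite kj ltn_neqAle andbC eq_sym.
Qed.

Lemma prod_coords_last u (j : 'I_n) : (n <= j.+1)%N -> prod_coords u j = u j.
Proof.
move=> nj; rewrite /prod_coords (bigD1 j)//= big1 ?mulr1// => i /andP[ji ij].
have := ltn_ord i; rewrite ltnNge (leq_trans nj)// ltn_neqAle ji andbT.
by apply: contra ij => /eqP h; apply/eqP/val_inj.
Qed.

Lemma prod_coords_neq0 u (j : 'I_n) : (forall k : 'I_n, (0 < k)%N -> u k != 0) -> (0 < j)%N ->
  prod_coords u j != 0.
Proof.
by move=> u0 j0; apply/prodf_neq0 => k jk; apply: u0; exact: leq_trans jk.
Qed.

Lemma quot_prod_coords u : (forall k : 'I_n, (0 < k)%N -> u k != 0) -> quot_coords (prod_coords u) = u.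
Proof.
move=> u0; apply/funext => j; rewrite /quot_coords; case: insubP => [k _ kj|].
  by rewrite (prod_coordsS u kj) mulfK// prod_coords_neq0// kj.
by rewrite -leqNgt; exact: prod_coords_last.
Qed.

Lemma prod_quot_coords z : (forall k : 'I_n, (0 < k)%N -> z k != 0) -> prod_coords (quot_coords z) = z.
Proof.
move=> z0; apply/funext => j; have [d] := ubnP (n - j)%N.
elim: d j => // d ih j; rewrite ltnS => jd.
have [h|h] := ltnP j.+1 n; last first.
  by rewrite prod_coords_last// /quot_coords insubN// -leqNgt.
rewrite (@prod_coordsS _ j (Ordinal h))// ih /=; last first.
  by move: jd; have := ltn_ord j; lia.
by rewrite /quot_coords insubT mulfVK// z0.
Qed.

Lemma quot_coords_neq0 z (j : 'I_n) : (forall k : 'I_n, (0 < k)%N -> z k != 0) -> (0 < j)%N ->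
  quot_coords z j != 0.
Proof.
move=> z0 j0; rewrite /quot_coords; case: insubP => [k _ kj|_]; last exact: z0.
by rewrite mulf_neq0 ?invr_eq0 ?z0// kj.
Qed.

End TriangleCoordinates.

Section HilbertCompleteness.
Variables (R : realType) (H : hilbert R).

Lemma hilbert_complete (u : nat -> H) :
  (forall e : complexF R, 0 < e -> exists N, forall i j, (N <= i)%N -> (N <= j)%N ->
    snorm (hilbert_semidot H) (u i - u j) < e) ->
  exists l, stends (hilbert_semidot H) u l.
Proof.
move=> h; have : cauchy (u @ \oo).
  apply: cauchy_exP => e e0; have [N hN] := h e e0; exists (u N).
  exists N => // k /= Nk; rewrite -ball_normE /ball_ /=.
  by rewrite -hilbert_snorm; apply: hN.
move=> /cauchy_cvg c; exists (lim (u @ \oo)) => e e0.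
have [N _ hN] := c _ (nbhsx_ballx _ e e0); exists N => k Nk.
have := hN k Nk; rewrite -ball_normE /ball_ /= => hk.
by rewrite subr0 hilbert_snorm normr_id distrC.
Qed.

End HilbertCompleteness.

Section KernelFunctions.
Variables (R : realType) (n : nat) (P : 'I_n -> {mpoly R[i][n]}) (m : 'I_n -> nat).
Implicit Types (u : 'I_n -> R[i]) (z w : 'rV[R[i]]_n).

Definition zvec u : 'rV[R[i]]_n := \row_j prod_coords u j.
Definition ucoord z : 'I_n -> R[i] := quot_coords (z ord0).

Lemma peval_diamond p z w :
  peval p (diamond (varphi z) (conjv (varphi w))) = mpoly.meval (pmul (ucoord z) (pconj (ucoord w))) p.
Proof. by apply: mpoly.meval_eq => j; rewrite !mxE. Qed.

Lemma zvec0 u : zvec u ord0 = prod_coords u.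
Proof. by apply/funext => j; rewrite mxE. Qed.

Lemma ucoord_zvec u : (forall k : 'I_n, (0 < k)%N -> u k != 0) -> ucoord (zvec u) = u.
Proof. by move=> u0; rewrite /ucoord zvec0 quot_prod_coords. Qed.

Lemma zvec_ucoord z : (forall k : 'I_n, (0 < k)%N -> z ord0 k != 0) -> zvec (ucoord z) = z.
Proof. by move=> z0; apply/rowP => j; rewrite mxE prod_quot_coords. Qed.

Lemma triangle_zvec u : kdom (C := complexF R) P u -> triangle P (zvec u).
Proof.
move=> [u0 u1]; split=> [j j0|j]; first by rewrite mxE prod_coords_neq0.
by rewrite peval_diamond ucoord_zvec//; exact: u1.
Qed.

Lemma kdom_ucoord z : triangle P z -> kdom (C := complexF R) P (ucoord z).
Proof.
move=> [z0 z1]; split=> [j j0|j]; first exact: quot_coords_neq0.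
by have := z1 j; rewrite peval_diamond.
Qed.

Variable H : hilbert_of_functions R (triangle P).
Hypothesis HK : reproducing_kernel H (triangle_kernel P m).

Definition zprod z : R[i] := \prod_(j < n | (0 < j)%N) z ord0 j.

Lemma triangle_kernelE z w : triangle_kernel P m z w =
  (zprod z * Num.conj (zprod w))^-1 *
  @kerfun (complexF R) n P m (pmul (ucoord z) (pconj (ucoord w))).
Proof.
have e1 : \prod_(j < n | (0 < j)%N) (z ord0 j * Num.conj (w ord0 j))^-1 =
    (zprod z * Num.conj (zprod w))^-1.
  by rewrite prodfV big_split /= rmorph_prod.
have e2 : \prod_(j < n) (1 - peval (P j) (diamond (varphi z) (conjv (varphi w)))) ^- m j =
    @kerfun (complexF R) n P m (pmul (ucoord z) (pconj (ucoord w))).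
  by apply: eq_bigr => j _; rewrite peval_diamond.
by rewrite -e1 -e2.
Qed.

Lemma zprod_neq0 z : triangle P z -> zprod z != 0.
Proof. by move=> [z0 _]; apply/prodf_neq0 => j; exact: z0. Qed.

(* kap u is the kernel function at the point z with varphi z = u, rescaled to cancel the factor \prod 1/z_j. *)
Lemma kernel_functions : exists kap : ('I_n -> R[i]) -> H,
  (forall u, kdom (C := complexF R) P u ->
    forall f : H, hdot H f (kap u) = zprod (zvec u) * ev f (zvec u)) /\
  (forall u (w : 'I_n -> R[i]), kdom (C := complexF R) P u -> kdom (C := complexF R) P w ->
    hdot H (kap u) (kap w) = @kerfun (complexF R) n P m (pmul w (pconj u))).
Proof.
have /boolp.choice[k hk] : forall w, exists k : H, triangle P w ->
    (forall z, triangle P z -> ev k z = triangle_kernel P m z w) /\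
    forall f : H, ev f w = hdot H f k.
  move=> w; have [wT|wT] := pselect (triangle P w); last by exists 0.
  by have [k k1 k2] := HK wT; exists k.
pose kap u := Num.conj (zprod (zvec u)) *: k (zvec u).
have kapE u (f : H) : kdom (C := complexF R) P u ->
    hdot H f (kap u) = zprod (zvec u) * ev f (zvec u).
  move=> hu; rewrite ((hk _ (triangle_zvec hu)).2 f).
  have h := @sdotZr (complexF R) H (hilbert_semidot H) (Num.conj (zprod (zvec u))) f (k (zvec u)).
  by rewrite [LHS]h conjCK.
exists kap; split=> [u hu f|u w hu hw]; first exact: kapE.
have zu := triangle_zvec hu; have zw := triangle_zvec hw.
have cz : Num.conj (zprod (zvec u)) != 0 by rewrite conjC_eq0 zprod_neq0.
rewrite kapE//; have evZ : ev (kap u) (zvec w) =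
    Num.conj (zprod (zvec u)) * ev (k (zvec u)) (zvec w).
  have := ev_linear zw (Num.conj (zprod (zvec u))) (k (zvec u)) 0.
  rewrite addr0 => ->; have := ev_linear zw 1 0 (0 : H).
  by rewrite scaler0 addr0 mul1r => /esym/eqP; rewrite -subr_eq0 addrK => /eqP ->; rewrite addr0.
rewrite evZ ((hk _ zu).1 _ zw) triangle_kernelE !ucoord_zvec; last 2 first.
- by have [] := hu.
- by have [] := hw.
move: (kerfun _ _ _) => K; rewrite !mulrA mulfV ?mul1r//.
by rewrite mulf_neq0// zprod_neq0.
Qed.

Lemma ev0 z : triangle P z -> ev (0 : H) z = 0.
Proof.
move=> zT; have := ev_linear zT 1 0 (0 : H).
by rewrite scaler0 addr0 mul1r => /esym/eqP; rewrite -subr_eq0 addrK => /eqP.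
Qed.

Theorem triangle_basis (A : multinom n -> R) (M : 'I_n -> {linear H -> H}) :
  positive_regular P -> (forall j, (0 < m j)%N) ->
  power_series_at0 (fun x => \prod_(j < n) (1 - peval (P j) x) ^- m j) A ->
  (forall j, multiplication_operator (fun z : 'rV[R[i]]_n => z ord0 j) (M j)) ->
  exists E : multinom n -> H,
    [/\ forall b, 0 < A b,
        forall b d, hilbert_semidot H (E b) (E d) = (b == d)%:R / (real_complex R (A b) : complexF R),
        forall f : H, (forall b, hilbert_semidot H f (E b) = 0) -> f = 0 &
        forall j d, M j (E d) = E (staircase d (mnm1 j))].
Proof.
move=> /positive_regular_coef[P0 Pz Pl] m0 /power_series_hassum[rho rho0 hA] hM.
have [kap [kapE kapG]] := kernel_functions.
have kap_total (f : H) : (forall u, kdom (C := complexF R) P u -> hilbert_semidot H f (kap u) = 0) -> f = 0.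
  move=> hf; apply: ev_inj => z zT; rewrite ev0//.
  have [z0 _] := zT; have hu := kdom_ucoord zT.
  have := hf _ hu; rewrite /= kapE// zvec_ucoord// => /eqP.
  by rewrite mulf_eq0 (negPf (zprod_neq0 zT)) => /eqP.
have [E [A0 Ek EE Et]] := @kernel_basis (complexF R) n P m P0 Pz Pl m0 _ rho rho0 hA H
  (hilbert_semidot H) (@hilbert_complete R H) kap kapG kap_total.
exists E; split=> //.
  by move=> b; have := A0 b; rewrite -[(_ < _)%R]/((0 : R[i]) < (A b)%:C%C) ltcR.
(* Tested against kap u, M_j multiplies by z_j = u_j ... u_n, which is the monomial of exponent
   sigma_j in u. *)
move=> j d; apply/eqP; rewrite -subr_eq0; apply/eqP/kap_total => u hu.
rewrite sdotBl [X in _ - X]Ek// [X in X - _](_ : _ = mon u (staircase d (mnm1 j))) ?subrr//.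
rewrite /= kapE// (hM j).2; last exact: triangle_zvec.
rewrite mulrCA -kapE// staircaseE monD mulrC; congr (_ * _); first exact: Ek.
rewrite mxE /prod_coords /mon big_mkcond; apply: eq_bigr => i _.
rewrite stairE big_mkcond (bigD1 j)//= mpoly.mnm1E eqxx big1 => [|l /negPf lj].
  by rewrite addn0; case: ifP.
by rewrite mpoly.mnm1E eq_sym lj; case: ifP.
Qed.

End KernelFunctions.

(** * Joint subnormality *)

Lemma real_complex_surj (R : realType) (z : complexF R) : z \is Num.real ->
  exists x, (real_complex R x : complexF R) = z.
Proof. by move/complex_realP => [k ->]; exists k. Qed.

Lemma real_complex_ge0 (R : realType) (x : R) : (0 <= (real_complex R x : complexF R)) = (0 <= x).
Proof. exact: ler0c. Qed.

Lemma real_complex_gt0 (R : realType) (x : R) : (0 < (real_complex R x : complexF R)) = (0 < x).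
Proof. exact: (ltcR 0 x). Qed.

Definition real_complexF (R : realType) : {rmorphism R -> complexF R} := real_complex R.

Section Subnormality.
Variables (R : realType) (n : nat) (H : hilbert R) (M : 'I_n -> {linear H -> H}).
Variables (A : multinom n -> R) (E : multinom n -> H).
Hypothesis n_gt0 : (0 < n)%N.
Hypothesis A_gt0 : forall b, 0 < A b.
Hypothesis E_dot : forall b d, hilbert_semidot H (E b) (E d) = (b == d)%:R / real_complexF R (A b).
Hypothesis E_total : forall f : H, (forall b, hilbert_semidot H f (E b) = 0) -> f = 0.
Hypothesis M_E : forall j d, M j (E d) = E (staircase d (mnm1 j)).
Hypothesis M_bounded : forall j, bounded_operator (M j).
Hypothesis M_comm : forall j k x, M j (M k x) = M k (M j x).

Lemma bounded_operators_bound (K : hilbert R) (N : 'I_n -> {linear K -> K}) :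
  (forall j, bounded_operator (N j)) -> exists2 c : R, 0 < c &
  forall j x, snorm (hilbert_semidot K) (N j x) <= real_complexF R c * snorm (hilbert_semidot K) x.
Proof.
move=> /boolp.choice[c hc].
have s0 : 0 < 1 + \sum_j `|c j| by rewrite ltr_pwDl ?ltr01 ?sumr_ge0.
have [r rE'] := @real_complex_surj R _ (gtr0_real s0).
have rE : real_complexF R r = 1 + \sum_j `|c j| := rE'.
exists r; first by rewrite -real_complex_gt0 rE'.
move=> j x; rewrite !hilbert_snorm rE; apply: le_trans (hc j x) _.
have h : c j * `|x| <= `|c j| * `|x|.
  have [->|x0] := eqVneq x 0; first by rewrite normr0 !mulr0.
  have cx : 0 <= c j.
    by have := le_trans (normr_ge0 _) (hc j x); rewrite pmulr_lge0 ?normr_gt0.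
  by rewrite ger0_norm.
apply: le_trans h _; rewrite ler_wpM2r//.
rewrite (bigD1 j)//= addrCA lerDl addr_ge0 ?ler01// sumr_ge0//.
Qed.

Lemma subnormal_hausdorff : jointly_subnormal M ->
  forall d : multinom n, hausdorff_moment (fun b => (A (staircase d b))^-1).
Proof.
move=> [K [V [N [Viso Nn Nc NV]]]] d.
have [c c0 hc] := bounded_operators_bound (fun j => (Nn j).1).
have /boolp.choice[N' hN'] : forall j, exists T : {linear K -> K}, adjoint (N j) T /\
    forall x, N j (T x) = T (N j x) by move=> j; exact: (Nn j).2.
apply: (@hausdorff_of_bernstein R n _ (c ^+ 2)) => //.
- by rewrite exprn_gt0.
- by move=> b; rewrite invr_gt0.
apply: (@normal_extension_bernstein R (complexF R) (real_complexF R) K (hilbert_semidot K) n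
  N N' c (V (E d))) => //.
- by move=> x; rewrite real_complex_ge0.
- by move=> x; rewrite real_complex_gt0.
- exact: hilbert_definite.
- by move=> j; exact: (hN' j).1.
- by move=> j; exact: (hN' j).2.
move=> b; have NVb y : opow N b (V y) = V (opow M b y).
  rewrite /opow; elim: (enum _) => //= j s ->.
  by elim: (b j) => //= k ->; rewrite NV.
(* Hence |N^b V E_d|^2 = |M^b E_d|^2 is the squared norm of E_(d + sigma b). *)
rewrite NVb (opow_staircase M_comm M_E) [RHS]Viso.
have := E_dot (staircase d b) (staircase d b); rewrite eqxx mul1r => h.
by rewrite [RHS]h fmorphV.
Qed.

Lemma hausdorff_subnormal :
  (forall d : multinom n, hausdorff_moment (fun b => (A (staircase d b))^-1)) ->
  jointly_subnormal M.
Proof.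
move=> hm; apply: halmos_bram => // k y b.
pose a d := (A d)^-1.
have hB' : forall d, exists B : R, 0 <= B /\
    forall q : {mpoly R[n]}, (forall t : 'I_n -> R, (forall j, 0 <= t j <= B) -> 0 <= meval t q) ->
    0 <= mfun (fun b => a (staircase d b)) q.
  move=> d; have [_ [mu [c [s [_ [s0 c0] _ hmu]]]]] := hm d.
  (* The moment cube has lower corner c, with nonnegative entries, and side s; this B makes [0, B]^n
     contain it. *)
  exists (s + \sum_j c ord0 j); split.
    by rewrite addr_ge0 ?(ltW s0)// sumr_ge0.
  apply: (moment_functional_ge0 c0 _ hmu) => j.
  by rewrite addrC lerD2l (bigD1 j)//= lerDl sumr_ge0.
have [B hB] := boolp.choice hB'.
have [c c0 hc] := bounded_operators_bound M_bounded.
apply: (@shift_gram_ge0 (complexF R) n H (hilbert_semidot H) (@hilbert_complete R H)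
  (fun d => real_complexF R (A d)) E _ E_dot E_total R (real_complexF R) a _ _ _ M
  (fun=> real_complexF R c) M_comm hc M_E).
- by move=> d; rewrite real_complex_gt0.
- by move=> x; rewrite real_complex_ge0.
- exact: real_complex_surj.
- by move=> d; rewrite fmorphV.
move=> p x d b'.
have := @gram_ge0 R n a B (fun d => (hB d).1) (fun d => (hB d).2) p x d b'.
under [X in _ -> is_true (_ <= X)]eq_bigr do under eq_bigr do rewrite mulrA.
by apply=> e; rewrite invr_ge0 ltW.
Qed.

End Subnormality.

Local Open Scope complex_scope.

Theorem proposition7p2 (R : realType) (n : nat)
  (P : 'I_n -> {mpoly R[i][n]}) (m : 'I_n -> nat)
  (A : multinom n -> R)
  (H : hilbert_of_functions R (triangle P))
  (M : 'I_n -> {linear H -> H}) :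
  (2 <= n)%N ->
  positive_regular P ->
  (forall j, (0 < m j)%N) ->
  power_series_at0 (fun x => \prod_(j < n) (1 - peval (P j) x) ^- m j) A ->
  (forall f : H, holomorphic (triangle P) (ev f)) ->
  reproducing_kernel H (triangle_kernel P m) ->
  (forall j, multiplication_operator (fun z : 'rV[R[i]]_n => z ord0 j) (M j)) ->
  jointly_subnormal M <->
  forall g : multinom n, hausdorff_moment (fun b => (A (staircase g b))^-1).
Proof.
move=> n2 hP m0 hA _ hK hM.
have [E [A0 EE Et ME]] := triangle_basis hK hP m0 hA hM.
have n0 : (0 < n)%N by exact: ltnW.
have Mc j k (x : H) : M j (M k x) = M k (M j x).
  apply: ev_inj => z zT; rewrite !((hM _).2 _ z zT).
  by rewrite mulrCA.
split; first exact: (subnormal_hausdorff n0 A0 EE ME Mc).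
exact: (hausdorff_subnormal A0 EE Et ME (fun j => (hM j).1) Mc).
Qed.
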